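(* Newton's equations on $\mathrm{Dens}(M)$ with respect to the Fisher–Rao metric and with the Fisher information potential $$I(\rho)=\frac12\int_M\frac{|\nabla\rho|^2}{\rho}\,\mu$$ are $$\ddot\rho-\Delta\rho-\frac1{2\rho}\big(\dot\rho^2-|\nabla\rho|^2\big)=\lambda\rho,$$ where $\lambda$ is a Lagrange multiplier for the constraint $\int_M\rho\mu=1$. The map $\rho\mapsto f=\sqrt\rho$ establishes an isomorphism with the infinite-dimensional Neumann problem, i.e. with the equation $$\ddot f-\Delta f=-\lambda' f$$ on the sphere $S^\infty(M)=\{f\in C^\infty(M)\mid\int_Mf^2\mu=1\}$, where $\lambda'$ is a Lagrange multiplier for the constraint $\int_Mf^2\mu=1$.
   Context: $M$ is a compact connected oriented Riemannian manifold (without boundary) with volume form $\mu$, $\int_M\mu=1$, and Laplacian $\Delta=\operatorname{div}\nabla$. $\mathrm{Dens}(M)$ is the space of smooth functions $\rho>0$ with $\int_M\rho\mu=1$. The Fisher–Rao metric is $\bar{\mathsf G}_\rho(\dot\rho,\dot\rho)=\int_M\frac{\dot\rho^2}{\rho}\mu$ for $\dot\rho$ of zero mean, and Newton's equations for a potential $\bar U$ are the Euler–Lagrange equations of $\frac12\bar{\mathsf G}_\rho(\dot\rho,\dot\rho)-\bar U(\rho)$. Multipliers depend only on time. The infinite-dimensional Neumann problem is Newton's equation on $S^\infty(M)$ with the $L^2$ metric and potential $V(f)=\frac12\int_M|\nabla f|^2\mu$. The square root map takes $\mathrm{Dens}(M)$ bijectively to the subset $\{f\in S^\infty(M): f>0\}$,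 and the isomorphism is with the Neumann problem on this subset. *)

(* Defs.v *)
From HB Require Import structures.
From mathcomp Require Import all_boot all_order all_algebra.
From mathcomp Require Import all_classical all_reals all_analysis.

Set Implicit Arguments.
Unset Strict Implicit.
Unset Printing Implicit Defensive.

Import Order.TTheory GRing.Theory Num.Theory.
Import numFieldNormedType.Exports.

Local Open Scope classical_set_scope.
Local Open Scope ring_scope.

(* Class C^k on an open set U: all iterated directional derivatives up to order
   k exist and are continuous on U.  For finite-dimensional V this is the usual
   notion; it is only used with V built from R and 'rV[R]_n. *)
Fixpoint Ck (R : realType) (V W : normedModType R) (k : nat) (U : set V)
    (f : V -> W) : Prop :=
  (forall x, U x -> {for x, continuous f}) /\
  (if k is k'.+1 then
     forall v : V, (forall x, U x -> derivable f x v) /\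
                   Ck k' U (fun x => 'D_v f x)
   else True).

Definition smooth_on (R : realType) (V W : normedModType R) (U : set V)
  (f : V -> W) : Prop := forall k, Ck k U f.

(* The integral over R^n, written as an iterated one-dimensional Lebesgue
   integral; it is only applied to compactly supported continuous functions. *)
Fixpoint integral_rV (R : realType) (n : nat) : ('rV[R]_n -> R) -> R :=
  if n is n'.+1 then fun F =>
    \int[@lebesgue_measure R]_t
      integral_rV (fun v : 'rV[R]_n' => F (row_mx t%:M v : 'rV[R]_(1 + n')))
  else fun F => F 0.

(* An oriented smooth atlas on M without boundary: [coord i] restricted to
   [dom i] is a homeomorphism onto an open subset of R^n, with inverse
   [param i].  Both maps are total, and meaningless outside [dom i] and its
   image.  [chart_at p] is a preferred chart around p, through which the
   (chart-independent) differential operators below are evaluated. *)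
Record oriented_atlas (R : realType) (n : nat) (M : topologicalType) :=
  OrientedAtlas {
    index : Type;
    dom : index -> set M;
    coord : index -> M -> 'rV[R]_n;
    param : index -> 'rV[R]_n -> M;
    chart_at : M -> index;
    dom_open : forall i, open (dom i);
    dom_chart_at : forall p, dom (chart_at p) p;
    image_open : forall i, open (coord i @` dom i);
    coordK : forall i p, dom i p -> param i (coord i p) = p;
    coord_continuous : forall i p, dom i p -> {for p, continuous (coord i)};
    param_continuous : forall i x, (coord i @` dom i) x -> {for x, continuous (param i)};
    transition_smooth : forall i j,
        smooth_on (coord i @` (dom i `&` dom j)) (coord j \o param i);
    transition_oriented : forall i j x, (coord i @` (dom i `&` dom j)) x ->
        0 < \det (jacobian (coord j \o param i) x)
  }.

(* [gmx i x] is the matrix (g_kl) of the metric at the point of chart i with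
   coordinates x.  The library's jacobian acts on row vectors on the right,
   whence the form of the transformation law. *)
Record riemannian_metric (R : realType) (n : nat) (M : topologicalType)
    (A : oriented_atlas R n M) := RiemannianMetric {
  gmx : index A -> 'rV[R]_n -> 'M[R]_n;
  gmx_smooth : forall i k l,
      smooth_on (coord i @` dom i) (fun x => gmx i x k l : R);
  gmx_sym : forall i x, (coord i @` dom i) x -> (gmx i x)^T = gmx i x;
  gmx_posdef : forall i x, (coord i @` dom i) x -> forall v : 'rV[R]_n, v != 0 ->
      0 < (v *m gmx i x *m v^T) 0 0;
  gmx_transition : forall i j x, (coord i @` (dom i `&` dom j)) x ->
      gmx i x = jacobian (coord j \o param i) x
                *m gmx j (coord j (param i x))
                *m (jacobian (coord j \o param i) x)^T
}.

Notation borel M := (g_sigma_algebraType (@open M)).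

Section RiemannianCalculus.
Variables (R : realType) (n : nat) (M : ptopologicalType).
Variables (A : oriented_atlas R n M) (g : riemannian_metric A).

Definition sqrtdetg (i : index A) (x : 'rV[R]_n) : R :=
  Num.sqrt (\det (gmx g i x)).

(* mu is the measure of the Riemannian volume form, equal in each oriented
   chart to sqrt(det g) dx^1 /\ ... /\ dx^n. *)
Definition is_volume (mu : {measure set (borel M) -> \bar R}) : Prop :=
  forall (i : index A) (h : M -> R), continuous h ->
    closure [set p | h p != 0] `<=` dom i ->
    \int[mu]_p h p =
    integral_rV ((fun x => h (param i x) * sqrtdetg i x) \_ (coord i @` dom i)).

Definition partial (F : 'rV[R]_n -> R) (k : 'I_n) (x : 'rV[R]_n) : R :=
  'D_(delta_mx 0 k) F x.

Definition local_grad (i : index A) (F : 'rV[R]_n -> R) (x : 'rV[R]_n) :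
  'rV[R]_n := (\row_k partial F k x) *m invmx (gmx g i x).

Definition local_div (i : index A) (X : 'rV[R]_n -> 'rV[R]_n) (x : 'rV[R]_n) :
  R := (sqrtdetg i x)^-1 *
       \sum_(k < n) partial (fun y => sqrtdetg i y * X y 0 k) k x.

Definition grad_normsq (f : M -> R) (p : M) : R :=
  let i := chart_at A p in
  let x := coord i p in
  let X := local_grad i (f \o param i) x in
  (X *m gmx g i x *m X^T) 0 0.

Definition laplacian (f : M -> R) (p : M) : R :=
  let i := chart_at A p in
  local_div i (local_grad i (f \o param i)) (coord i p).

(* Smoothness on W x M of a function on M depending on a parameter in the open
   set W. *)
Definition smooth_family (P : normedModType R) (W : set P) (F : P -> M -> R) :
  Prop :=
  forall i : index A,
    smooth_on (W `*` (coord i @` dom i))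
      (fun z : P * 'rV[R]_n => F z.1 (param i z.2) : R).

Definition smooth_fun (f : M -> R) : Prop :=
  forall i : index A, smooth_on (coord i @` dom i) (f \o param i).

Definition dt (q : R -> M -> R) (t : R) (p : M) : R :=
  derive1 (fun s => q s p) t.

(* A smooth curve in a set Q of functions on M is a family in Q that is jointly
   smooth in (t, p); J is an open time interval. *)
Definition curve_in (Q : set (M -> R)) (J : set R) (q : R -> M -> R) : Prop :=
  smooth_family J q /\ forall t, J t -> Q (q t).

Definition action (L : (M -> R) -> (M -> R) -> R) (a b : R) (q : R -> M -> R) :
  R := \int[@lebesgue_measure R]_(t in `[a, b]) L (q t) (dt q t).

(* Euler-Lagrange equations on the configuration space Q, in the form of
   Hamilton's principle: on each [a, b] in J the action is stationary under all
   smooth variations inside Q with fixed end points. *)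
Definition euler_lagrange (Q : set (M -> R)) (L : (M -> R) -> (M -> R) -> R)
    (J : set R) (q : R -> M -> R) : Prop :=
  curve_in Q J q /\
  forall (a b e : R) (c : R -> R -> M -> R),
    a < b -> `[a, b] `<=` J -> 0 < e ->
    smooth_family (`]- e, e[ `*` J) (fun z : R * R => c z.1 z.2) ->
    (forall s t, s \in `]- e, e[ -> J t -> Q (c s t)) ->
    (forall t, J t -> c 0 t = q t) ->
    (forall s, s \in `]- e, e[ -> c s a = q a /\ c s b = q b) ->
    is_derive (0 : R) 1 (fun s => action L a b (c s)) 0.

(* [G q v] is the squared length G_q(v, v). *)
Definition newton (Q : set (M -> R)) (G : (M -> R) -> (M -> R) -> R)
    (U : (M -> R) -> R) : set R -> (R -> M -> R) -> Prop :=
  euler_lagrange Q (fun q v => 2^-1 * G q v - U q).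

Variable mu : {measure set (borel M) -> \bar R}.

Definition Dens : set (M -> R) :=
  [set r | [/\ smooth_fun r, forall p, 0 < r p & \int[mu]_p r p = 1]].

Definition Sphere : set (M -> R) :=
  [set f | smooth_fun f /\ \int[mu]_p (f p ^+ 2) = 1].

Definition fisher_rao (r v : M -> R) : R := \int[mu]_p (v p ^+ 2 / r p).

Definition fisher_information (r : M -> R) : R :=
  2^-1 * \int[mu]_p (grad_normsq r p / r p).

(* The first argument is the base point, on which this metric does not depend. *)
Definition L2_metric (_ v : M -> R) : R := \int[mu]_p (v p ^+ 2).

Definition dirichlet (f : M -> R) : R := 2^-1 * \int[mu]_p grad_normsq f p.

End RiemannianCalculus.

Definition sqrt_map (R : realType) (M : Type) (r : M -> R) : M -> R :=
  fun p => Num.sqrt (r p).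

(* Main.v *)
Require Import Defs.
From HB Require Import structures.
From mathcomp Require Import all_boot all_order all_algebra.
From mathcomp Require Import all_classical all_reals all_analysis.
From mathcomp Require Import ring lra.

Set Implicit Arguments.
Unset Strict Implicit.
Unset Printing Implicit Defensive.

Import Order.TTheory GRing.Theory Num.Theory.
Import numFieldNormedType.Exports.
Import Defs.

Local Open Scope classical_set_scope.
Local Open Scope ring_scope.

(* Writing rho = f^2, the Fisher-Rao Lagrangian of (rho, rho') is four times the
   L^2 Lagrangian of (f, f'), so Hamilton's principle on Dens(M) and on the
   positive part of the sphere are equivalent.  By Green's formula the first
   variation of the spherical action along zeta is
   - \int\int (f'' - Delta f) zeta.  Variations inside the sphere satisfy
   \int f zeta = 0, so f'' - Delta f parallel to f suffices; conversely, the
   normalized variations (f + s eta) / |f + s eta|, with eta a bump function in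
   time and space, force f'' - Delta f to be parallel to f.  The equation for
   rho is 2 f times the equation for f. *)

(** * Functions of class C^k *)

(** The equivalence of the two variational principles cannot be proved variation by variation in
    both directions. Square roots of density variations are sphere variations, but a sphere
    variation of a positive curve may change sign, and over the open time set [J] no single bound on
    [s] keeps it positive at all times. That implication therefore goes through the differential
    equation, tested with eta = chi f for a cutoff 0 <= chi <= 1: then f + s eta = (1 + s chi) f
    stays positive for |s| < 1/4. Pairing the equation with f, of unit norm, shows that the
    multiplier can only be - \int (f'' - Delta f) f. Two definitions shape the analysis. [laplacian]
    at [p] is computed in [chart_at A p], which varies with [p] without any continuity, so even the
    continuity of [laplacian g f] rests on independence of the chart. [is_volume] determines
    integrals only for functions supported in one chart, so Green's formula is proved in charts and
    glued. Since [Ck] speaks of directional derivatives, linearity in the direction, symmetry of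
    second derivatives and total differentiability are all drawn from the mean value theorem. *)

Section Ck_calculus.
Context {R : realType} {V : normedModType R}.
Implicit Types (U : set V) (f g : V -> R) (k : nat).

Lemma derive_near (W : normedModType R) (f g : V -> W) (x v : V) :
  (\forall y \near x, f y = g y) -> \forall y \near x, 'D_v f y = 'D_v g y.
Proof.
move=> /near_join; apply: filterS => y; exact: near_eq_derive.
Qed.

(** Equality is asked near each point of [U], because derivatives at these points see a
    neighbourhood; in this form the lemma also applies when [U] is a singleton. *)
Lemma Ck_near (W : normedModType R) k U (f g : V -> W) :
  (forall x, U x -> \forall y \near x, f y = g y) -> Ck k U g -> Ck k U f.
Proof.
elim: k f g => [|k IH] f g fg [gc gD]; split=> //.
- move=> x Ux; have fgx := fg x Ux.
  rewrite /prop_for /continuous_at (nbhs_singleton fgx).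
  by apply: cvg_trans (gc x Ux); apply: near_eq_cvg; apply: filterS fgx => y ->.
- move=> x Ux; have fgx := fg x Ux.
  rewrite /prop_for /continuous_at (nbhs_singleton fgx).
  by apply: cvg_trans (gc x Ux); apply: near_eq_cvg; apply: filterS fgx => y ->.
- move=> v; split.
    move=> x Ux; apply: (@near_eq_derivable _ _ _ g); last exact: (gD v).1.
    by have := fg x Ux; apply: filterS => y ->.
  apply: (IH _ (fun x => 'D_v g x)); last exact: (gD v).2.
  by move=> x Ux; apply: derive_near; exact: fg.
Qed.

Lemma CkW (W : normedModType R) k l U (f : V -> W) : (l <= k)%N -> Ck k U f -> Ck l U f.
Proof.
elim: k l f => [|k IH] [|l] f //= lk [fc fD]; split=> // v.
by split; [exact: (fD v).1|apply: IH => //; exact: (fD v).2].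
Qed.

Lemma Ck_sub (W : normedModType R) k U U' (f : V -> W) :
  U' `<=` U -> Ck k U f -> Ck k U' f.
Proof.
move=> UU'; elim: k f => [|k IH] f [fc fD]; split=> //; try by move=> x /UU'; exact: fc.
move=> v; split; first by move=> x /UU'; exact: (fD v).1.
exact: IH (fD v).2.
Qed.

(** All clauses of [Ck] are pointwise, those on the derivatives included. Smoothness can thus be
    checked one point at a time, with a different local formula for [f] at each. *)
Lemma Ck_cover (W : normedModType R) k U (f : V -> W) :
  (forall x, U x -> Ck k [set x] f) -> Ck k U f.
Proof.
elim: k f => [|k IH] f H; split=> //; try by move=> x Ux; apply: (H x Ux).1.
move=> v; split; first by move=> x Ux; exact: ((H x Ux).2 v).1.
by apply: IH => x Ux; exact: ((H x Ux).2 v).2.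
Qed.

Lemma Ck_cst (W : normedModType R) k U (c : W) : Ck k U (fun=> c).
Proof.
elim: k c => [|k IH] c; split=> //; try by move=> x _; apply: cst_continuous.
move=> v; split; first by move=> x _; exact: derivable_cst.
have -> : (fun x : V => 'D_v (fun=> c) x) = fun=> 0 by apply/funext => x; exact: derive_cst.
exact: IH.
Qed.

(** It suffices to exhibit a candidate [g] for the derivative on [U]: as [U] is open, [g] agrees
    with ['D_v f] near each of its points and passes its regularity on. *)
Lemma Ck_step k U f : open U ->
  (forall x, U x -> {for x, continuous f}) ->
  (forall v, exists2 g, (forall x, U x -> is_derive x v f (g x)) & Ck k U g) ->
  Ck k.+1 U f.
Proof.
move=> Uo fc H; split=> // v; have [g fg gk] := H v.
split; first by move=> x Ux; have [] := fg x Ux.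
apply: Ck_near gk => x Ux; near=> y.
have Uy : U y by near: y; exact: open_nbhs_nbhs.
by have [_] := fg y Uy.
Unshelve. all: by end_near. Qed.

Lemma Ck_derive k U f x v : Ck k.+1 U f -> U x -> is_derive x v f ('D_v f x).
Proof. by move=> [_ fD] Ux; apply: derivableP; exact: (fD v).1. Qed.

Lemma Ck_continuous (W : normedModType R) k U (f : V -> W) x :
  Ck k U f -> U x -> {for x, continuous f}.
Proof. by case: k => [|k] [fc _]; exact: fc. Qed.

Lemma CkD k U f g : open U -> Ck k U f -> Ck k U g -> Ck k U (fun x => f x + g x).
Proof.
move=> Uo; elim: k f g => [|k IH] f g fk gk.
  by split=> // x Ux; apply: continuousD; [exact: fk.1|exact: gk.1].
apply: Ck_step => //.
  by move=> x Ux; apply: continuousD; [exact: fk.1|exact: gk.1].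
move=> v; exists (fun x => 'D_v f x + 'D_v g x).
  move=> x Ux; apply: is_deriveD; [exact: Ck_derive fk Ux|exact: Ck_derive gk Ux].
by apply: IH; [exact: (fk.2 v).2|exact: (gk.2 v).2].
Qed.

Lemma CkM k U f g : open U -> Ck k U f -> Ck k U g -> Ck k U (fun x => f x * g x).
Proof.
move=> Uo; elim: k f g => [|k IH] f g fk gk.
  by split=> // x Ux; apply: continuousM; [exact: fk.1|exact: gk.1].
apply: Ck_step => //.
  by move=> x Ux; apply: continuousM; [exact: fk.1|exact: gk.1].
move=> v; exists (fun x => f x * 'D_v g x + g x * 'D_v f x).
  move=> x Ux; apply: is_deriveM; [exact: Ck_derive fk Ux|exact: Ck_derive gk Ux].
apply: CkD => //; apply: IH; try exact: CkW (leqnSn k) _ => //.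
- exact: (gk.2 v).2.
- exact: (fk.2 v).2.
Qed.

Lemma CkN k U f : open U -> Ck k U f -> Ck k U (fun x => - f x).
Proof.
move=> Uo fk; apply: (@Ck_near _ _ _ _ (fun x => (-1) * f x)).
  by move=> x _; near=> y; rewrite mulN1r.
by apply: CkM => //; exact: Ck_cst.
Unshelve. all: by end_near. Qed.

Lemma CkB k U f g : open U -> Ck k U f -> Ck k U g -> Ck k U (fun x => f x - g x).
Proof. by move=> Uo fk gk; apply: CkD => //; exact: CkN. Qed.

Lemma Ck_sum k U (I : Type) (r : seq I) (P : pred I) (F : I -> V -> R) : open U ->
  (forall i, P i -> Ck k U (F i)) -> Ck k U (fun x => \sum_(i <- r | P i) F i x).
Proof.
move=> Uo HF; elim: r => [|i r IH].
  by under eq_fun do rewrite big_nil; exact: Ck_cst.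
under eq_fun do rewrite big_cons; case Pi: (P i) => //.
by apply: CkD => //; exact: HF.
Qed.

Lemma Ck_prod k U (I : Type) (r : seq I) (P : pred I) (F : I -> V -> R) : open U ->
  (forall i, P i -> Ck k U (F i)) -> Ck k U (fun x => \prod_(i <- r | P i) F i x).
Proof.
move=> Uo HF; elim: r => [|i r IH].
  by under eq_fun do rewrite big_nil; exact: Ck_cst.
under eq_fun do rewrite big_cons; case Pi: (P i) => //.
by apply: CkM => //; exact: HF.
Qed.

Lemma derive_line (g : V -> R) x v : 'D_v g x = derive1 (fun h : R => g (h *: v + x)) 0.
Proof.
have E' : (fun h : R => h^-1 *: ((g \o shift x) (h *: v) - g x))
   = (fun h => h^-1 *: (((fun h : R => g (h *: v + x)) \o shift 0) (h *: 1) - g (0 *: v + x))).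
  by apply/funext => h /=; rewrite addr0 scale0r add0r [_%:A]mulr1.
by rewrite derive1E /derive E'.
Qed.

(** Restricting [f] to the line through [x] along [v] turns this into the chain rule in one
    variable. *)
Lemma is_derive_comp1 (phi : R -> R) f x v : derivable f x v ->
  derivable phi (f x) 1 -> is_derive x v (phi \o f) ((phi^`())%classic (f x) * 'D_v f x).
Proof.
move=> /derivable1P; set F := fun h : R => f (h *: v + x) => df dphi.
have E : F 0 = f x by rewrite /F scale0r add0r.
rewrite -E in dphi *.
have FE : (fun h : R => (phi \o f) (h *: v + x)) = phi \o F by [].
apply: DeriveDef.
  apply/derivable1P; rewrite FE; apply/derivable1_diffP.
  by apply: differentiable_comp; exact/derivable1_diffP.
by rewrite !derive_line FE derive1_comp.
Qed.

End Ck_calculus.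

Section Ck_composition.
Context {R : realType} {V : normedModType R}.
Implicit Types (U : set V) (f g : V -> R) (k : nat).

Lemma Ck_comp k U (O : set R) (phi : R -> R) f : open U -> open O ->
  (forall x, U x -> O (f x)) -> Ck k O phi -> Ck k U f -> Ck k U (phi \o f).
Proof.
move=> Uo Oo UO; elim: k phi f UO => [|k IH] phi f UO pk fk.
  by split=> // x Ux; apply: continuous_comp; [exact: fk.1|exact: pk.1 (UO _ Ux)].
apply: Ck_step => //.
  by move=> x Ux; apply: continuous_comp; [exact: fk.1|exact: pk.1 (UO _ Ux)].
move=> v; exists (fun x => ((fun y => 'D_1 phi y) \o f) x * 'D_v f x).
  move=> x Ux /=; rewrite -derive1E; apply: is_derive_comp1; first exact: (fk.2 v).1.
  by apply: (pk.2 1).1; exact: UO.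
apply: CkM => //; last exact: (fk.2 v).2.
by apply: IH => //; [exact: (pk.2 1).2|exact: CkW (leqnSn k) _].
Qed.

(** [L] is the linear part of [A]. The difference quotients of [f \o A] along [v] are literally
    those of [f] along [L v], so every derivative of the composite is again a composite with [A]. *)
Lemma Ck_affine (V' W : normedModType R) k U (U' : set V') (f : V -> W)
    (A L : V' -> V) :
  continuous A -> (forall x v h, A (h *: v + x) = h *: L v + A x) ->
  (forall x, U' x -> U (A x)) -> Ck k U f -> Ck k U' (f \o A).
Proof.
move=> Ac AL UU'.
have E (g : V -> W) x v : (fun h : R => h^-1 *: (((g \o A) \o shift x) (h *: v) - (g \o A) x))
     = (fun h => h^-1 *: ((g \o shift (A x)) (h *: L v) - g (A x))).
  by apply/funext => h /=; rewrite AL.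
elim: k f => [|k IH] f fk; split=> //;
  try by move=> x Ux; apply: continuous_comp; [exact: Ac|exact: fk.1 (UU' _ Ux)].
move=> v; split; first by move=> x /UU' Ux; rewrite /derivable E; exact: (fk.2 (L v)).1.
have -> : (fun x => 'D_v (f \o A) x) = (fun x => 'D_(L v) f x) \o A.
  by apply/funext => x; rewrite /derive E.
exact: IH (fk.2 _).2.
Qed.

Lemma derive_affine (V' W : normedModType R) (f : V -> W) (A L : V' -> V) x v :
  (forall x v h, A (h *: v + x) = h *: L v + A x) ->
  'D_v (f \o A) x = 'D_(L v) f (A x).
Proof.
move=> AL; have E : (fun h : R => h^-1 *: (((f \o A) \o shift x) (h *: v) - (f \o A) x))
     = (fun h => h^-1 *: ((f \o shift (A x)) (h *: L v) - f (A x))).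
  by apply/funext => h /=; rewrite AL.
by rewrite /derive E.
Qed.

End Ck_composition.
Section Ck_inverse_root.
Context {R : realType} {V : normedModType R}.
Implicit Types (U : set V) (f g : V -> R) (k : nat).

Lemma CkV k U f : open U -> (forall x, U x -> f x != 0) -> Ck k U f ->
  Ck k U (fun x => (f x)^-1).
Proof.
move=> Uo f0; elim: k => [|k IH] fk.
  by split=> // x Ux; apply: continuousV; [exact: f0|exact: fk.1].
apply: Ck_step => //.
  by move=> x Ux; apply: continuousV; [exact: f0|exact: fk.1].
(* The derivative of the inverse contains the inverse again, whose regularity one order lower is the
   induction hypothesis. *)
have IHk := IH (CkW (leqnSn k) fk).
move=> v; exists (fun x => (-1) * ((f x)^-1 * (f x)^-1 * 'D_v f x)).
  move=> x Ux; have df := (fk.2 v).1 x Ux; apply: DeriveDef.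
    by apply: derivableV => //; exact: f0.
  rewrite deriveV //; last exact: f0.
  by rewrite -[X in X = _]/(_ * _) expr2 invfM mulN1r mulNr.
apply: CkM => //; first exact: Ck_cst.
by apply: CkM; [|exact: CkM|exact: (fk.2 v).2].
Qed.

Lemma Ck_sqrt k U f : open U -> (forall x, U x -> 0 < f x) -> Ck k U f ->
  Ck k U (fun x => Num.sqrt (f x)).
Proof.
move=> Uo f0; elim: k => [|k IH] fk.
  by split=> // x Ux; apply: continuous_comp; [exact: fk.1|exact: sqrt_continuous].
apply: Ck_step => //.
  by move=> x Ux; apply: continuous_comp; [exact: fk.1|exact: sqrt_continuous].
have IHk := IH (CkW (leqnSn k) fk).
move=> v; exists (fun x => (2 * Num.sqrt (f x))^-1 * 'D_v f x).
  move=> x Ux; have df := (fk.2 v).1 x Ux.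
  have [ds ds'] := is_derive1_sqrt (f0 x Ux).
  by have := is_derive_comp1 df ds; rewrite derive1E ds'.
apply: CkM => //; last exact: (fk.2 v).2.
apply: CkV => // [x Ux|]; first by rewrite mulf_neq0 // gt_eqF // sqrtr_gt0 f0.
by apply: CkM => //; exact: Ck_cst.
Qed.

End Ck_inverse_root.

Lemma Ck_id (R : realType) k : Ck k [set: R] (@id R).
Proof.
elim: k => [|k IH]; first by split=> // x _; exact: cvg_id.
apply: Ck_step; [exact: openT|by move=> x _; exact: cvg_id|].
by move=> v; exists (fun=> v); [move=> x _; exact: is_derive_id|exact: Ck_cst].
Qed.

(** * The mean value theorem and the symmetry of second derivatives *)

Section mean_value.
Context {R : realType} {V : normedModType R}.
Implicit Types (U : set V) (f g : V -> R) (k : nat).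

Lemma is_derive_line f x v t : derivable f (t *: v + x) v ->
  is_derive t (1 : R) (fun s : R => f (s *: v + x)) ('D_v f (t *: v + x)).
Proof.
move=> df.
have E (h : R) : h *: v + (t *: v + x) = (h *: 1 + t) *: v + x.
  by rewrite [h *: 1]mulr1 scalerDl addrA.
have E' : (fun h : R => h^-1 *: ((f \o shift (t *: v + x)) (h *: v) - f (t *: v + x)))
   = (fun h => h^-1 *: (((fun s : R => f (s *: v + x)) \o shift t) (h *: 1) - f (t *: v + x))).
  by apply/funext => h /=; rewrite E.
by split; [move: df|]; rewrite /derivable /derive E'.
Qed.

Lemma mvt_line f x v : (forall t : R, 0 <= t <= 1 -> derivable f (t *: v + x) v) ->
  exists2 t : R, 0 <= t <= 1 & f (v + x) - f x = 'D_v f (t *: v + x).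
Proof.
move=> H.
have D (t : R) : t \in `[0, 1] -> is_derive t (1 : R) (fun s : R => f (s *: v + x)) ('D_v f (t *: v + x)).
  by rewrite in_itv /= => t01; exact: is_derive_line (H _ t01).
have D' (t : R) : t \in `]0, 1[ -> is_derive t (1 : R) (fun s : R => f (s *: v + x)) ('D_v f (t *: v + x)).
  by move=> t01; apply: D; exact: subset_itv_oo_cc t01.
have Dc : {within `[0, 1], continuous (fun s : R => f (s *: v + x))}.
  by apply: derivable_within_continuous => t /D [].
have [t] := MVT_segment ler01 D' Dc.
by rewrite in_itv /= => t01; rewrite scale1r scale0r add0r subr0 mulr1 => ->; exists t.
Qed.

Lemma is_derive1_scale (F : R -> R) a : derivable F 0 1 ->
  is_derive (0 : R) (1 : R) (fun h => F (h * a)) (a * 'D_1 F 0).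
Proof.
move=> dF; have dm : is_derive (0 : R) (1 : R) (fun h : R => h * a) a.
  split; first by apply: derivableM; [exact: derivable_id|exact: derivable_cst].
  by rewrite deriveMr ?derive_id ?mulr1//; exact: derivable_id.
have dF' : derivable F (0 * a) 1 by rewrite mul0r.
have [ddm dm'] := dm.
have := is_derive_comp1 ddm dF'.
by rewrite dm' mul0r derive1E mulrC.
Qed.

Lemma is_derive_dirZ f x v a : derivable f x v -> is_derive x (a *: v) f (a * 'D_v f x).
Proof.
move=> df.
have dF : derivable (fun h : R => f (h *: v + x)) 0 1 by move/derivable1P : df.
have [d1 d2] := is_derive1_scale a dF.
have FE : (fun h : R => f (h *: (a *: v) + x)) = (fun h => f ((h * a) *: v + x)).
  by apply/funext => h; rewrite scalerA.
split; first by apply/derivable1P; rewrite FE.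
by rewrite (derive_line f x (a *: v)) FE derive1E d2 (derive_line f x v) derive1E.
Qed.

Lemma near_ball_segment U x : nbhs x U -> exists2 d : R, 0 < d &
  forall y, `|y - x| < d -> U y.
Proof.
by move=> /nbhs_ballP[d /= d0 dU]; exists d => // y yd; apply: dU; rewrite -ball_normE /= distrC.
Qed.

(** The mean value theorem, applied along [h *: v] to the increment of [f] by [h *: w] and then
    along [h *: w] to ['D_v f], writes the second difference as [h ^+ 2] times the mixed derivative
    at a point of the small parallelogram. Continuity at [x] does the rest. *)
Lemma derive_mixed_diff U f x v w : open U -> U x -> Ck 2 U f ->
  forall e : R, 0 < e -> \forall h \near (0 : R)^'+,
  `|f (h *: w + (h *: v + x)) - f (h *: v + x) - f (h *: w + x) + f x
    - h ^+ 2 * 'D_w ('D_v f) x| <= e * h ^+ 2.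
Proof.
move=> Uo Ux fk e e0.
have c : {for x, continuous (fun y => 'D_w ('D_v f) y)}.
  exact: ((((fk.2 v).2).2 w).2).1.
have : nbhs x (U `&` [set y | `|'D_w ('D_v f) x - 'D_w ('D_v f) y| <= e]).
  apply: filterI; first exact: open_nbhs_nbhs.
  by move/cvgrPdist_le : c => /(_ e e0).
move=> /near_ball_segment[d d0 dU].
near=> h.
have h0 : 0 < h by near: h; exact: nbhs_right_gt.
have small (a b : R) : 0 <= a <= 1 -> 0 <= b <= 1 -> `|a *: (h *: w) + (b *: (h *: v) + x) - x| < d.
  move=> /andP[a0 a1] /andP[b0 b1].
  rewrite addrA addrK (le_lt_trans (ler_normD _ _))// !normrZ !ger0_norm ?(ltW h0)//.
  apply: (@le_lt_trans _ _ (h * (`|w| + `|v|))).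
    by rewrite mulrDr lerD// ler_piMl // mulr_ge0// ltW.
  (* The summand 1 keeps the divisor positive when both directions vanish. *)
  have q : 0 < `|w| + `|v| + 1 by rewrite ltr_wpDl// addr_ge0.
  apply: (@lt_trans _ _ (h * (`|w| + `|v| + 1))); first by rewrite ltr_pM2l// ltrDl.
  rewrite -ltr_pdivlMr //; near: h; apply: nbhs_right_lt; exact: divr_gt0.
have U1 (a b : R) : 0 <= a <= 1 -> 0 <= b <= 1 -> U (a *: (h *: w) + (b *: (h *: v) + x)).
  by move=> a1 b1; have [] := dU _ (small _ _ a1 b1).
have in0 : 0 <= (0 : R) <= 1 by rewrite lexx ler01.
have in1 : 0 <= (1 : R) <= 1 by rewrite lexx ler01.
have dv z : U z -> is_derive z (h *: v) f (h * 'D_v f z).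
  by move=> Uz; apply: is_derive_dirZ; exact: (fk.2 v).1.
have dw z : U z -> is_derive z (h *: w) ('D_v f) (h * 'D_w ('D_v f) z).
  by move=> Uz; apply: is_derive_dirZ; exact: ((fk.2 v).2.2 w).1.
have A (y : V) : f \o (fun y => h *: w + y) = (fun y => f (h *: w + y)) by [].
have ds z : U (h *: w + z) -> is_derive z (h *: v) (fun y => f (h *: w + y)) (h * 'D_v f (h *: w + z)).
  move=> Uz; have [d1 d2] := dv _ Uz; have E : (fun s : R => s^-1 *: (((fun y => f (h *: w + y)) \o shift z) (s *: (h *: v)) - f (h *: w + z)))
    = (fun s : R => s^-1 *: ((f \o shift (h *: w + z)) (s *: (h *: v)) - f (h *: w + z))).
    by apply/funext => s /=; rewrite addrCA.
  by split; [move: d1|rewrite -d2]; rewrite /derivable /derive E.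
have [|a a01] := @mvt_line (fun y => f (h *: w + y) - f y) x (h *: v).
  move=> t t01; have := U1 _ _ in1 t01; have := U1 _ _ in0 t01.
  rewrite scale0r scale1r add0r => u1 u2.
  by apply: derivableB; [have [] := ds _ u2|have [] := dv _ u1].
have -> : 'D_(h *: v) (fun y : V => f (h *: w + y) - f y) (a *: (h *: v) + x) =
   h * ('D_v f (h *: w + (a *: (h *: v) + x)) - 'D_v f (a *: (h *: v) + x)).
  have := U1 _ _ in1 a01; have := U1 _ _ in0 a01.
  rewrite scale0r scale1r add0r => /dv[u1 u1'] /ds[u2 u2'].
  by rewrite deriveB // u1' u2' mulrBr.
have [|b b01] := @mvt_line ('D_v f) (a *: (h *: v) + x) (h *: w).
  by move=> t t01; have [] := dw _ (U1 _ _ t01 a01).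
move=> ->; have [_ ->] := dw _ (U1 _ _ b01 a01).
rewrite opprB addrA addrAC => ->.
rewrite mulrA -expr2 -mulrBr normrM mulrC [X in _ * X]ger0_norm ?sqr_ge0 // distrC.
by rewrite ler_wpM2r ?sqr_ge0 //; have [] := dU _ (small _ _ b01 a01).
Unshelve. all: by end_near. Qed.

(** The second difference is symmetric in the two directions, so for a single small [h] it is close,
    up to [e / 2 * h ^+ 2], to [h ^+ 2] times either mixed derivative. *)
Lemma deriveC U f x v w : open U -> U x -> Ck 2 U f ->
  'D_w ('D_v f) x = 'D_v ('D_w f) x.
Proof.
move=> Uo Ux fk; apply/eqP; rewrite -subr_eq0 -normr_le0; apply/ler_addgt0Pr => e e0.
rewrite add0r; have e2 : 0 < e / 2 by rewrite divr_gt0.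
have A := derive_mixed_diff w v Uo Ux fk e2; have B := derive_mixed_diff v w Uo Ux fk e2.
have [h [[A' B'] /= h0]] := filter_ex (filterI (filterI A B) (nbhs_right_gt (0 : R))).
move: A'; rewrite addrCA (addrAC _ (- _) (- _)) => A'.
rewrite -(@ler_pM2r _ (h ^+ 2)) ?exprn_gt0// -[X in _ * X <= _]ger0_norm ?sqr_ge0 // -normrM.
have alg (X a b c : R) : (a - b) * c = (X - c * b) - (X - c * a) by ring.
rewrite (alg (f (h *: w + (h *: v + x)) - f (h *: v + x) - f (h *: w + x) + f x)) (le_trans (ler_normB _ _))// (le_trans (lerD A' B'))//.
by rewrite -mulrDl -splitr.
Qed.

End mean_value.

(** * Linearity in the direction and total differentiability *)

Section directional_linear.
Context {R : realType} {V : normedModType R}.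
Implicit Types (U : set V) (f g : V -> R) (k : nat).

(** Going to [h *: (v + w) + x] through [h *: v + x], the second leg is [h] times ['D_w f] at an
    intermediate point, and continuity of ['D_w f] brings this point back to [x]. The three errors
    are the two difference quotients and this displacement. *)
Lemma derive_dirD U f x v w : open U -> U x -> Ck 1 U f ->
  'D_(v + w) f x = 'D_v f x + 'D_w f x.
Proof.
move=> Uo Ux fk; apply/eqP; rewrite -subr_eq0 -normr_le0; apply/ler_addgt0Pr => e e0.
rewrite add0r; have e3 : 0 < e / 3 by rewrite divr_gt0.
have dq u : \forall h \near (0 : R)^', `|h^-1 *: (f (h *: u + x) - f x) - 'D_u f x| <= e / 3.
  have := (fk.2 u).1 x Ux; move=> /cvgrPdist_le /(_ _ e3); apply: filterS => h.
  by rewrite distrC.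
have c : {for x, continuous (fun y => 'D_w f y)} by exact: (fk.2 w).2.1.
have : nbhs x (U `&` [set y | `|'D_w f x - 'D_w f y| <= e / 3]).
  apply: filterI; first exact: open_nbhs_nbhs.
  by move/cvgrPdist_le : c => /(_ _ e3).
move=> /near_ball_segment[d d0 dU].
have small : \forall h \near (0 : R)^', forall b : R, 0 <= b <= 1 -> `|b *: (h *: w) + (h *: v + x) - x| < d.
  near=> h => b /andP[b0 b1].
  rewrite addrA addrK (le_lt_trans (ler_normD _ _))// !normrZ (ger0_norm b0).
  apply: (@le_lt_trans _ _ (`|h| * (`|w| + `|v|))).
    by rewrite mulrDr lerD// ler_piMl // mulr_ge0// ltW.
  have q : 0 < `|w| + `|v| + 1 by rewrite ltr_wpDl// addr_ge0.
  apply: (@le_lt_trans _ _ (`|h| * (`|w| + `|v| + 1))); first by rewrite ler_wpM2l// lerDl.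
  by rewrite -ltr_pdivlMr //; near: h; apply: dnbhs0_lt; exact: divr_gt0.
have [h [[[A B] S] h0]] := filter_ex (filterI (filterI (filterI (dq (v + w)) (dq v)) small) (nbhs_dnbhs_neq (0 : R))).
have dw z : U z -> is_derive z (h *: w) f (h * 'D_w f z).
  by move=> Uz; apply: is_derive_dirZ; exact: (fk.2 w).1.
have US b : 0 <= b <= 1 -> U (b *: (h *: w) + (h *: v + x)).
  by move=> b01; have [] := dU _ (S b b01).
have [|b b01] := @mvt_line _ _ f (h *: v + x) (h *: w).
  by move=> t t01; have [] := dw _ (US _ t01).
have [_ ->] := dw _ (US _ b01) => E.
have alg (P Q r D : R) : P - Q = h * D -> h^-1 *: (P - r) = h^-1 *: (Q - r) + D.
  move=> PQ; rewrite -[h^-1 *: (P - r)]/(_ * _) -[h^-1 *: (Q - r)]/(_ * _).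
  have -> : P = h * D + Q by rewrite -PQ subrK.
  by rewrite -addrA mulrDr mulKf // [RHS]addrC.
have alg' (P Q D D1 D2 D3 : R) : P = Q + D -> D3 - (D1 + D2) = - (P - D3) + (Q - D1) - (D2 - D).
  by move=> ->; ring.
have {}E : h^-1 *: (f (h *: (v + w) + x) - f x) = h^-1 *: (f (h *: v + x) - f x)
   + 'D_w f (b *: (h *: w) + (h *: v + x)).
  by apply: alg; rewrite -E scalerDr -addrA addrCA.
have [_ /= C] := dU _ (S b b01).
rewrite (alg' _ _ _ _ _ _ E) (le_trans (ler_normB _ _))// (le_trans (lerD (ler_normD _ _) C))// normrN.
by move: A B; lra.
Unshelve. all: by end_near. Qed.

Lemma derive_dir_sum U f x (I : Type) (r : seq I) (a : I -> R) (v : I -> V) :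
  open U -> U x -> Ck 1 U f ->
  'D_(\sum_(i <- r) a i *: v i) f x = \sum_(i <- r) a i * 'D_(v i) f x.
Proof.
move=> Uo Ux fk; elim: r => [|i r IH]; first by rewrite !big_nil derive0.
rewrite !big_cons (derive_dirD _ _ Uo) // IH; congr (_ + _).
by have [_ ->] := is_derive_dirZ (a i) ((fk.2 (v i)).1 x Ux).
Qed.

End directional_linear.

Section rV_differentiable.
Context {R : realType} {n : nat}.
Implicit Types (U : set 'rV[R]_n) (f g : 'rV[R]_n -> R) (k : nat).

Lemma derive_rV U f x v : open U -> U x -> Ck 1 U f ->
  'D_v f x = \sum_k v 0 k * partial f k x.
Proof. by move=> Uo Ux fk; rewrite {1}[v]row_sum_delta (derive_dir_sum _ _ _ Uo). Qed.

(** The increment is ['D_h f] at a point of the segment, hence a combination of partial derivatives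
    close to those at [x]. A total differential is what the chain rule under a change of chart
    requires. *)
Lemma Ck1_differentiable U f x : open U -> U x -> Ck 1 U f -> differentiable f x.
Proof.
move=> Uo Ux fk.
pose df (v : 'rV[R]_n) : R := \sum_k v 0 k * partial f k x.
have dfl : linear df.
  move=> a u v; rewrite /df scaler_sumr -big_split /=; apply: eq_bigr => i _.
  by rewrite !mxE mulrDl -[_ *: _]/(_ * _) mulrA.
pose dfL := GRing.isLinear.Build _ _ _ _ df dfl.
pose Df : {linear 'rV[R]_n -> R} := HB.pack df dfL.
have cDf : continuous Df.
  have Cdf : Ck 0 setT df.
    apply: Ck_sum => [|i _]; first exact: openT.
    apply: CkM; [exact: openT| |exact: Ck_cst].
    by split=> // y _; exact: matrix_normedtype.coord_continuous.
  by move=> y; exact: Cdf.1.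
have K := @diff_unique R _ _ f Df x cDf.
match type of K with ?P -> _ => have key : P end.
  apply/eqaddoP => e e0.
  (* The error is shared between [n] partial derivatives; dividing by [n.+1] covers [n = 0]. *)
  have c : \forall y \near x, U y /\ forall k : 'I_n, `|partial f k x - partial f k y| <= e / n.+1%:R.
    apply: filterI; first exact: open_nbhs_nbhs.
    have c (k : 'I_n) : \forall y \near x, `|partial f k x - partial f k y| <= e / n.+1%:R.
      have : {for x, continuous (partial f k)} by exact: (fk.2 _).2.1.
      by move/cvgrPdist_le; apply; rewrite divr_gt0.
    exact: (@filter_forall _ _ _ (nbhs x) _ c).
  have [d d0 dU] := near_ball_segment c.
  have hd : \forall h \near (0 : 'rV[R]_n), `|h| < d by exact: nbhs0_lt.
  apply: filterS hd => h hd.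
  have S (t : R) : 0 <= t <= 1 -> `|t *: h + x - x| < d.
    move=> /andP[t0 t1]; rewrite addrK normrZ ger0_norm //.
    by rewrite (@le_lt_trans _ _ `|h|) ?ler_piMl//.
  have [|t t01] := @mvt_line _ _ f x h.
    by move=> t t01; apply: (fk.2 h).1; have [] := dU _ (S t t01).
  have -> : (f \o shift x - (cst (f x) + Df)) h = f (h + x) - f x - df h.
    by rewrite -[LHS]/(f (h + x) - (f x + df h)) opprD addrA.
  have [Ut Bt] := dU _ (S t t01).
  move=> ->; rewrite (derive_rV _ Uo) // /df -sumrB.
  rewrite (le_trans (ler_norm_sum _ _ _))//.
  apply: (@le_trans _ _ (\sum_(k < n) `|h| * (e / n.+1%:R))).
    apply: ler_sum => k _; rewrite -mulrBr normrM distrC ler_pM//.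
    by rewrite [leRHS]/Num.Def.normr /= mx_normrE; apply: (le_bigmax _ _ (0, k)).
  have en : e / n.+1%:R * n%:R <= e.
    by rewrite mulrAC ler_pdivrMr // ler_wpM2l ?(ltW e0) // ler_nat.
  by rewrite sumr_const card_ord -[X in X <= _]mulr_natr -mulrA mulrC ler_wpM2r.
have E := K key.
by apply/diff_locallyP; rewrite E; split.
Qed.

Lemma Ck_coord (V : normedModType R) m p k (U : set V) (f : V -> 'M[R]_(m, p)) i j :
  open U -> Ck k U f -> Ck k U (fun x => f x i j).
Proof.
move=> Uo; elim: k f => [|k IH] f [fc fD].
  by split=> // x Ux; apply: (@continuous_comp _ _ _ f (fun M : 'M[R]_(m, p) => M i j)); [exact: fc|exact: matrix_normedtype.coord_continuous].
have dc v x : U x -> derivable f x v by exact: (fD v).1.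
apply: Ck_step => //.
  by move=> x Ux; apply: (@continuous_comp _ _ _ f (fun M : 'M[R]_(m, p) => M i j)); [exact: fc|exact: matrix_normedtype.coord_continuous].
move=> v; exists (fun x => 'D_v f x i j).
  move=> x Ux; have /derivable_mxP/(_ i j) d := dc v x Ux.
  by split => //; rewrite (derive_mx (dc v x Ux)) mxE.
exact: IH (fD v).2.
Qed.

Lemma differentiable_rV (V : normedModType R) m (f : V -> 'rV[R]_m) x :
  (forall j, differentiable (fun y => f y 0 j) x) -> differentiable f x.
Proof.
move=> df; have -> : f = fun y => \sum_j (f y 0 j) *: delta_mx 0 j.
  by apply/funext => y; rewrite -row_sum_delta.
have -> : (fun y => \sum_j (f y 0 j) *: delta_mx 0 j) = \sum_j (fun y => f y 0 j *: (delta_mx 0 j : 'rV[R]_m)).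
  by apply/funext => y; rewrite fct_sumE.
by apply: differentiable_sum => j; exact: differentiableZl.
Qed.

End rV_differentiable.

(** * Integrals depending on a parameter, and integration over R^n *)

Lemma continuous_pair (S T U : topologicalType) (f : S -> T) (g : S -> U) (x : S) :
  {for x, continuous f} -> {for x, continuous g} -> {for x, continuous (fun y => (f y, g y))}.
Proof. by move=> cf cg; exact: (@cvg_pair _ _ _ _ (nbhs (f x)) (nbhs (g x)) _ _ _ f g cf cg). Qed.

Section compact_uniformity.
Context {R : realType}.

(** A tube argument: continuity at [(w0, k)] controls the difference on a product neighbourhood, by
    comparison with [F w0 k], and compactness of [K] makes the neighbourhood of [w0] uniform in
    [k]. *)
Lemma compact_near_uniform (P T : topologicalType) (K : set T) (F : P -> T -> R) (w0 : P) :
  compact K -> (forall k, K k -> {for (w0, k), continuous (fun z => F z.1 z.2)}) ->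
  forall e : R, 0 < e -> \forall w \near w0, forall k, K k -> `|F w k - F w0 k| <= e.
Proof.
move=> /compact_near_coveringP Kc Fc e e0.
have := Kc P (nbhs w0) (fun w k => `|F w k - F w0 k| <= e) _.
apply => // k Kk; have e2 : 0 < e / 2 by rewrite divr_gt0.
have /cvgrPdist_le /(_ _ e2) [[A B] /= [Aw Bk] AB] := Fc k Kk.
exists (B, A); first by split.
move=> [k' w] /= [Bk' Aw'].
rewrite (splitr e) -(subrKA (F w0 k)) (le_trans (ler_normD _ _))// lerD//.
  by rewrite distrC; have := AB (w, k') (conj Aw' Bk').
by have := AB (w0, k') (conj (nbhs_singleton Aw) Bk').
Qed.

(** The difference quotient is [dF (t *: h) k] for some [t] in [0, 1] depending on [k]; uniform
    continuity over [K] absorbs this dependence. *)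
Lemma compact_diffquot (T : topologicalType) (K : set T) (F dF : R -> T -> R) (d : R) :
  compact K -> 0 < d ->
  (forall k, K k -> {for (0, k), continuous (fun z => dF z.1 z.2)}) ->
  (forall s k, `|s| < d -> K k -> is_derive s (1 : R) (F ^~ k) (dF s k)) ->
  forall e : R, 0 < e -> \forall h \near (0 : R)^', forall k, K k ->
    `|h^-1 * (F h k - F 0 k) - dF 0 k| <= e.
Proof.
move=> Kc d0 dFc FdF e e0.
have /nbhs_ballP[r /= r0 H] := compact_near_uniform Kc dFc e0.
near=> h => k Kk.
have h0 : h != 0 by near: h; exact: nbhs_dnbhs_neq.
have hd : `|h| < Num.min d r by near: h; apply: dnbhs0_lt; rewrite lt_min d0 r0.
have small (t : R) : 0 <= t <= 1 -> `|t *: h + 0| < Num.min d r.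
  move=> /andP[t0 t1]; rewrite addr0 normrZ ger0_norm // (le_lt_trans _ hd)//.
  by rewrite ler_piMl.
have D (t : R) : 0 <= t <= 1 -> is_derive (t *: h + 0) (h *: 1) (F ^~ k) (h * dF (t *: h + 0) k).
  move=> /small; rewrite lt_min => /andP[td _]; have [d1 d2] := FdF _ k td Kk.
  by rewrite -d2; apply: is_derive_dirZ.
have [|t t01] := @mvt_line _ _ (F ^~ k) 0 (h *: 1).
  by move=> t t01; rewrite [h *: 1]mulr1; have [] := D t t01; rewrite [h *: 1]mulr1.
rewrite [h *: 1]mulr1 addr0 => ->; have [_] := D t t01; rewrite [h *: 1]mulr1 => ->.
rewrite mulKf //; apply: H => //.
by rewrite -ball_normE /= sub0r normrN; have := small t t01; rewrite lt_min => /andP[].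
Unshelve. all: by end_near. Qed.

(* I stands for integration over M, over [a, b], or over R^n inside the
   iterated integral. *)
Variables (T : topologicalType) (K : set T) (C : set (T -> R)) (I : (T -> R) -> R) (B : R).
Hypothesis Kc : compact K.
Hypothesis CL : forall a u v, C u -> C v -> C (fun k => a * u k + v k).
Hypothesis IL : forall a u v, C u -> C v -> I (fun k => a * u k + v k) = a * I u + I v.
Hypothesis IB : forall u c, C u -> (forall k, K k -> `|u k| <= c) -> `|I u| <= B * c.

Lemma functional_continuous (P : topologicalType) (F : P -> T -> R) (w0 : P) :
  (forall k, K k -> {for (w0, k), continuous (fun z => F z.1 z.2)}) ->
  (\forall w \near w0, C (F w)) -> {for w0, continuous (fun w => I (F w))}.
Proof.
move=> Fc CF; apply/cvgrPdist_le => e e0.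
(* [B] has no prescribed sign and may vanish; [|B| + 1] is a positive majorant. *)
have q : 0 < e / (`|B| + 1) by rewrite divr_gt0// ltr_wpDl.
have H := compact_near_uniform Kc Fc q.
have C0 := nbhs_singleton CF.
near=> w.
have Cw : C (F w) by near: w.
have -> : I (F w0) - I (F w) = I (fun k => (-1) * F w k + F w0 k) by rewrite IL // mulN1r addrC.
rewrite (le_trans (@IB _ (e / (`|B| + 1)) (CL _ Cw C0) _))//.
  move=> k Kk; rewrite mulN1r addrC distrC.
  have Hw : forall k, K k -> `|F w k - F w0 k| <= e / (`|B| + 1) by near: w.
  exact: Hw.
rewrite mulrA ler_pdivrMr ?ltr_wpDl// mulrC ler_wpM2l ?ltW//.
by rewrite (le_lt_trans (ler_norm _))// ltrDl.
Unshelve. all: by end_near. Qed.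

(** Differentiation under the integral sign without dominated convergence: the quotients converge
    uniformly on [K], and [I] is bounded for the uniform norm. *)
Lemma functional_derive (F dF : R -> T -> R) (d : R) : 0 < d ->
  (forall k, K k -> {for (0, k), continuous (fun z => dF z.1 z.2)}) ->
  (forall s k, `|s| < d -> K k -> is_derive s (1 : R) (F ^~ k) (dF s k)) ->
  (forall s, `|s| < d -> C (F s)) -> C (dF 0) ->
  is_derive (0 : R) (1 : R) (fun s => I (F s)) (I (dF 0)).
Proof.
move=> d0 dFc FdF CF CdF.
have H : (fun h : R => h^-1 *: (((fun s => I (F s)) \o shift 0) (h *: 1) - I (F 0))) @ (0 : R)^' --> I (dF 0).
  apply/cvgrPdist_le => e e0.
  have q : 0 < e / (`|B| + 1) by rewrite divr_gt0// ltr_wpDl.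
  have H := compact_diffquot Kc d0 dFc FdF q.
  have C0 : C (F 0) by apply: CF; rewrite normr0.
  near=> h.
  have Ch : C (F h) by apply: CF; near: h; exact: dnbhs0_lt.
  have Cq : C (fun k => h^-1 * ((-1) * F 0 k + F h k) + (-1) * dF 0 k + 0 * F 0 k).
    have C1 := CL (-1) C0 Ch; have Z := CL (-1) C0 C0.
    have C2 := CL (-1) CdF Z; have := CL h^-1 C1 C2.
    congr C; apply/funext => k; ring.
  (* The vanishing summand [(-1) * F 0 k + F 0 k] is there because [C] is only known to be stable
     under [a * u + v]; it provides the second operand after [(-1) * dF 0 k]. *)
  have E : h^-1 *: (((fun s => I (F s)) \o shift 0) (h *: 1) - I (F 0)) - I (dF 0)
     = I (fun k => h^-1 * ((-1) * F 0 k + F h k) + ((-1) * dF 0 k + ((-1) * F 0 k + F 0 k))).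
    rewrite IL; [|exact: CL|by apply: CL => //; exact: CL].
    rewrite IL // IL //; last exact: CL.
    rewrite IL // /= addr0 [h *: 1]mulr1 -[_ *: _]/(_ * _); ring.
  rewrite distrC E.
  rewrite (le_trans (@IB _ (e / (`|B| + 1)) _ _))//.
  - by apply: CL; [exact: CL|apply: CL => //; exact: CL].
  - move=> k Kk; rewrite !mulN1r addNr addr0 (addrC _ (F h k)).
    have Hw : forall k, K k -> `|h^-1 * (F h k - F 0 k) - dF 0 k| <= e / (`|B| + 1) by near: h.
    exact: Hw.
  rewrite mulrA ler_pdivrMr ?ltr_wpDl// mulrC ler_wpM2l ?ltW//.
  by rewrite (le_lt_trans (ler_norm _))// ltrDl.
split; first by apply/cvg_ex; exists (I (dF 0)).
exact: cvg_lim H.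
Unshelve. all: by end_near. Qed.

End compact_uniformity.
Section row_mx_facts.
Context {R : realType} {n : nat}.
Notation rm t v := (row_mx (t%:M : 'M[R]_1) (v : 'rV[R]_n) : 'rV[R]_(1 + n)).

Lemma norm_row_mx_l (t : R) (v : 'rV[R]_n) : `|t| <= `|rm t v|.
Proof.
rewrite [leRHS]/Num.Def.normr /= mx_normrE.
by apply: le_trans (le_bigmax _ _ (0, lshift n (0 : 'I_1))); rewrite row_mxEl mxE eqxx mulr1n.
Qed.

Lemma norm_row_mx_r (t : R) (v : 'rV[R]_n) : `|v| <= `|rm t v|.
Proof.
rewrite [leLHS]/Num.Def.normr /= mx_normrE; apply: bigmax_le => [|[i j] _] //=.
rewrite [leRHS]/Num.Def.normr /= mx_normrE.
by apply: le_trans (le_bigmax _ _ (i, rshift 1 j)); rewrite row_mxEr.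
Qed.

Lemma norm_row_mx_le (t : R) (v : 'rV[R]_n) c : `|t| <= c -> `|v| <= c -> `|rm t v| <= c.
Proof.
move=> tc vc; rewrite [leLHS]/Num.Def.normr /= mx_normrE.
apply: bigmax_le => [|[i j] _] /=; first exact: le_trans tc.
rewrite (ord1 i); case: (split_ordP j) => k ->; rewrite ?row_mxEl ?row_mxEr.
  by rewrite (ord1 k) mxE eqxx mulr1n.
apply: le_trans vc; rewrite [leRHS]/Num.Def.normr /= mx_normrE.
exact: (le_bigmax _ _ (0, k)).
Qed.

Lemma row_mx_continuous : continuous (fun z : R * 'rV[R]_n => rm z.1 z.2).
Proof.
move=> z; apply/cvgrPdist_le => e e0.
have : \forall y \near z, ball z e y by apply: nbhsx_ballx.
apply: filterS => -[t v] [/= zt zv].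
rewrite opp_row_mx add_row_mx -raddfB /=.
apply: norm_row_mx_le; first by apply: ltW; move: zt; rewrite -ball_normE.
by apply: ltW; move: zv; rewrite -ball_normE.
Qed.

End row_mx_facts.

(** * One-dimensional integrals *)

Section segment_integral.
Context {R : realType}.
Notation lam := (@lebesgue_measure R).
Implicit Types (u v f : R -> R) (a b c r : R).

Lemma within_continuous_lin (A : set R) c u v : {within A, continuous u} ->
  {within A, continuous v} -> {within A, continuous (fun t => c * u t + v t)}.
Proof.
move=> cu cv x; apply: cvgD; last exact: cv.
by apply: cvgM; [exact: cvg_cst|exact: cu].
Qed.

Lemma segment_integrable a b f : {within `[a, b], continuous f} ->
  lam.-integrable `[a, b] (EFin \o f).
Proof. by apply: continuous_compact_integrable; exact: segment_compact. Qed.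

Lemma segment_integral_lin a b c u v : {within `[a, b], continuous u} ->
  {within `[a, b], continuous v} ->
  \int[lam]_(t in `[a, b]) (c * u t + v t) =
  c * \int[lam]_(t in `[a, b]) u t + \int[lam]_(t in `[a, b]) v t.
Proof.
move=> cu cv; have cc : {within `[a, b], continuous (fun t => c * u t)}.
  by move=> x; apply: cvgM; [exact: cvg_cst|exact: cu].
rewrite RintegralD ?RintegralZl //; exact: segment_integrable.
Qed.

Lemma segment_integral_cst a b c : a <= b -> \int[lam]_(t in `[a, b]) c = (b - a) * c.
Proof.
move=> ab; rewrite Rintegral_cst // mulrC; congr (_ * _).
rewrite [X in fine X]lebesgue_measure_itv /= lte_fin.
case: ltP => //= ba; have -> : a = b by apply/eqP; rewrite eq_le ab.
by rewrite subrr.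
Qed.

Lemma segment_integral_le a b u v : {within `[a, b], continuous u} ->
  {within `[a, b], continuous v} -> (forall t, a <= t <= b -> u t <= v t) ->
  \int[lam]_(t in `[a, b]) u t <= \int[lam]_(t in `[a, b]) v t.
Proof.
by move=> cu cv uv; apply: le_Rintegral => //; exact: segment_integrable.
Qed.

Lemma segment_integral_bound a b f c : a <= b -> {within `[a, b], continuous f} ->
  (forall t, `[a, b]%classic t -> `|f t| <= c) -> `|\int[lam]_(t in `[a, b]) f t| <= (b - a) * c.
Proof.
move=> ab cf fc; have cn : {within `[a, b], continuous (fun t => `|f t|)}.
  by move=> x; apply: continuous_comp; [exact: cf|exact: norm_continuous].
rewrite (le_trans (le_normr_Rintegral _ (segment_integrable cf)))//.
rewrite -segment_integral_cst //; apply: segment_integral_le => //.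
by move=> x; exact: cst_continuous.
Qed.

Lemma Rintegral_compact_support f r : (forall t, r < `|t| -> f t = 0) ->
  \int[lam]_t f t = \int[lam]_(t in `[- r, r]) f t.
Proof.
move=> f0; rewrite [RHS]Rintegral_mkcond; congr (Rintegral _ _ _); apply/funext => t.
rewrite patchE; case: ifPn => //; rewrite notin_setE /= in_itv /= => /negP.
by rewrite -ler_norml -ltNge; exact: f0.
Qed.

Lemma segment_integral_derive a b (f F : R -> R) : a < b ->
  {within `[a, b], continuous f} ->
  (forall t, a <= t <= b -> is_derive t (1 : R) F (f t)) ->
  \int[lam]_(t in `[a, b]) f t = F b - F a.
Proof.
move=> ab cf dF; rewrite /Rintegral (@continuous_FTC2 _ f F) //.
- have cF t : a <= t <= b -> {for t, continuous F}.
    move=> /dF [d _]; apply: differentiable_continuous; exact/derivable1_diffP.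
  split.
  + by move=> t; rewrite in_itv /= => /andP[ta tb]; have [] := dF t; rewrite ?(ltW ta) ?(ltW tb).
  + by apply: cvg_at_right_filter; apply: cF; rewrite lexx ltW.
  + by apply: cvg_at_left_filter; apply: cF; rewrite lexx ltW.
- move=> t; rewrite in_itv /= => /andP[ta tb]; rewrite derive1E.
  by have [] := dF t; rewrite ?(ltW ta) ?(ltW tb).
Qed.

(** Near [t0] the function exceeds half its value there, so it dominates a positive multiple of the
    indicator of a nondegenerate segment. *)
Lemma Rintegral_pos f r t0 : continuous f -> (forall t, r < `|t| -> f t = 0) ->
  (forall t, 0 <= f t) -> 0 < f t0 -> 0 < \int[lam]_t f t.
Proof.
move=> cf fr f0 ft0.
have /cvgrPdist_le /(_ (f t0 / 2)) := cf t0.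
rewrite divr_gt0 // => /(_ isT) /nbhs_ballP[d /= d0 H].
have B t : t0 - d / 2 <= t <= t0 + d / 2 -> f t0 / 2 <= f t.
  move=> /andP[t1 t2]; have : ball t0 d t by rewrite -ball_normE /= ltr_norml; lra.
  by move=> /H; rewrite ler_norml; lra.
have tr : t0 - d / 2 < t0 + d / 2 by lra.
pose I : set R := `[t0 - d / 2, t0 + d / 2]%classic.
have int0 : lam.-integrable setT (EFin \o f).
  have : lam.-integrable `[-r, r] (EFin \o f) by apply: segment_integrable; exact: continuous_subspaceT.
  rewrite integrable_mkcond //; congr (_.-integrable _ _); apply/funext => t.
  rewrite patchE; case: ifPn => //; rewrite notin_setE /= in_itv /= => /negP.
  by rewrite -ler_norml -ltNge => /fr ->.
have int1 : lam.-integrable setT (EFin \o ((fun=> f t0 / 2) \_ I)).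
  have H1 : lam.-integrable I (EFin \o (fun=> f t0 / 2)).
    by apply: segment_integrable => x; exact: cst_continuous.
  rewrite integrable_mkcond in H1; last exact: measurable_itv.
  have -> : EFin \o ((fun=> f t0 / 2) \_ I) = (EFin \o (fun=> f t0 / 2)) \_ I.
    by apply/funext => t /=; rewrite !patchE; case: ifP.
  exact: H1.
apply: (@lt_le_trans _ _ (\int[lam]_t ((fun=> f t0 / 2) \_ I) t)).
  rewrite -Rintegral_mkcond segment_integral_cst ?(ltW tr) //.
  by rewrite mulr_gt0 ?divr_gt0 //; lra.
apply: le_Rintegral => // t _; rewrite patchE; case: ifPn => // /set_mem.
by rewrite /I /= in_itv /=; exact: B.
Qed.

End segment_integral.

(** * The iterated integral of compactly supported continuous functions *)

Section integral_rV_theory.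
Context {R : realType}.
Notation lam := (@lebesgue_measure R).
Notation rm t v := (row_mx (t%:M : 'M[R]_1) v).

(** The norm is the sup norm, so the support lies in a cube. Fixing the radius makes the class
    stable under linear combinations and under slicing, with the same [r] in every dimension. *)
Definition csupp n (r : R) : set ('rV[R]_n -> R) :=
  [set F | continuous F /\ forall x, r < `|x| -> F x = 0].

Lemma csupp_lin n r a (u v : 'rV[R]_n -> R) : csupp r u -> csupp r v -> csupp r (fun x => a * u x + v x).
Proof.
move=> [cu u0] [cv v0]; split; last by move=> x rx; rewrite u0 // v0 // mulr0 addr0.
have H : Ck 0 setT (fun x => a * u x + v x).
  by apply: CkD; [exact: openT|apply: CkM; [exact: openT|exact: Ck_cst|by split=> // y _; exact: cu]|by split=> // y _; exact: cv].
by move=> x; exact: H.1.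
Qed.

Lemma csupp_slice n r (F : 'rV[R]_(1 + n) -> R) t : csupp r F -> csupp r (fun v : 'rV[R]_n => F (rm t v)).
Proof.
move=> [cF F0]; split; last by move=> v rv; apply: F0; exact: lt_le_trans rv (norm_row_mx_r _ _).
move=> v; apply: (@continuous_comp _ _ _ (fun v => rm t v) F); last exact: cF.
apply: (@continuous_comp _ _ _ (fun v => (t, v)) (fun z : R * 'rV[R]_n => rm z.1 z.2)).
  by apply: (@cvg_pair _ _ _ (nbhs v) (nbhs t) (nbhs v) _ _ _ (fun=> t) id); [exact: cvg_cst|exact: cvg_id].
exact: row_mx_continuous.
Qed.

Lemma csupp_joint n r (F : 'rV[R]_(1 + n) -> R) : csupp r F ->
  continuous (fun z : R * 'rV[R]_n => F (rm z.1 z.2)).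
Proof.
move=> [cF _] z; apply: (@continuous_comp _ _ _ (fun z : R * 'rV[R]_n => rm z.1 z.2) F).
  exact: row_mx_continuous.
exact: cF.
Qed.

Lemma box_compact n (r : R) : compact [set x : 'rV[R]_n | `|x| <= r].
Proof.
apply: bounded_closed_compact.
  exists r; split; first exact: num_real.
  by move=> M rM x /= xr; rewrite (le_trans xr)// ltW.
have -> : [set x : 'rV[R]_n | `|x| <= r] = (fun x : 'rV[R]_n => `|x|) @^-1` [set y | y <= r] by [].
by apply: closed_comp => [x _|]; [exact: norm_continuous|exact: closed_le].
Qed.

Lemma csupp_bound n r (F : 'rV[R]_n -> R) c : csupp r F -> 0 <= c ->
  (forall x, `|x| <= r -> `|F x| <= c) -> forall x, `|F x| <= c.
Proof.
move=> [_ F0] c0 Fc x; have [xr|rx] := leP `|x| r; first exact: Fc.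
by rewrite F0 // normr0.
Qed.

(* The bound in dimension n makes the inner integral continuous in the first
   coordinate, which is what linearity in dimension n + 1 needs. *)
Lemma integral_rV_package n r : 0 <= r ->
  (forall a (u v : 'rV[R]_n -> R), csupp r u -> csupp r v ->
     integral_rV (fun x => a * u x + v x) = a * integral_rV u + integral_rV v) /\
  (forall (u : 'rV[R]_n -> R) c, csupp r u -> (forall x, `|x| <= r -> `|u x| <= c) ->
     `|integral_rV u| <= (2 * r) ^+ n * c).
Proof.
move=> r0; elim: n => [|n [IHL IHB]].
  split => // u c [_ u0] uc; rewrite /= expr0 mul1r; apply: uc.
  by rewrite normr0.
have cslice (F : 'rV[R]_(1 + n) -> R) : csupp r F ->
    continuous (fun t : R => integral_rV (fun v : 'rV[R]_n => F (rm t v))).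
  move=> CF t.
  apply: (functional_continuous (box_compact (r := r)) (@csupp_lin n r) IHL IHB
    (F := fun t v => F (rm t v)) (w0 := t)).
    by move=> k _; exact: csupp_joint CF _.
  by near=> s; exact: csupp_slice.
have slice0 (F : 'rV[R]_(1 + n) -> R) : csupp r F -> forall t, r < `|t| ->
    integral_rV (fun v : 'rV[R]_n => F (rm t v)) = 0.
  move=> CF t rt; apply/eqP; rewrite -normr_le0.
  rewrite (le_trans (IHB _ 0 (csupp_slice _ CF) _)) ?mulr0 //.
  by move=> v _; rewrite CF.2 ?normr0 //; exact: lt_le_trans rt (norm_row_mx_l _ _).
have rr : - r <= r by lra.
split.
  move=> a u v Cu Cv /=; have Cw := csupp_lin a Cu Cv.
  rewrite (Rintegral_compact_support (slice0 _ Cw)) (Rintegral_compact_support (slice0 _ Cu))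
    (Rintegral_compact_support (slice0 _ Cv)).
  rewrite -segment_integral_lin; [|exact/continuous_subspaceT/cslice..].
  by congr (Rintegral _ _ _); apply/funext => t; rewrite -IHL //; exact: csupp_slice.
move=> u c Cu uc /=; rewrite (Rintegral_compact_support (slice0 _ Cu)).
have c0 : 0 <= c by rewrite (le_trans (normr_ge0 (u 0)))// uc // normr0.
rewrite (le_trans (segment_integral_bound (c := (2 * r) ^+ n * c) rr _ _))//.
- exact/continuous_subspaceT/cslice.
- move=> t _; apply: IHB; first exact: csupp_slice.
  by move=> v _; exact: csupp_bound Cu c0 uc _.
- by rewrite exprS opprK -mulrA ler_wpM2r ?mulr_ge0 ?exprn_ge0 ?mulr_ge0 //; lra.
Unshelve. all: by end_near. Qed.

Section integral_rV_lemmas.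
Variables (n : nat) (r : R).
Hypothesis r0 : 0 <= r.

Lemma integral_rV_lin a (u v : 'rV[R]_n -> R) : csupp r u -> csupp r v ->
  integral_rV (fun x => a * u x + v x) = a * integral_rV u + integral_rV v.
Proof. exact: (integral_rV_package n r0).1. Qed.

Lemma integral_rV_bound (u : 'rV[R]_n -> R) c : csupp r u -> (forall x, `|x| <= r -> `|u x| <= c) ->
  `|integral_rV u| <= (2 * r) ^+ n * c.
Proof. exact: (integral_rV_package n r0).2. Qed.

Lemma integral_rV_slice_continuous (F : 'rV[R]_(1 + n) -> R) : csupp r F ->
    continuous (fun t : R => integral_rV (fun v : 'rV[R]_n => F (rm t v))).
Proof.
move=> CF t.
apply: (functional_continuous (box_compact (r := r)) (@csupp_lin n r) integral_rV_lin
  integral_rV_bound (F := fun t v => F (rm t v)) (w0 := t)).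
  by move=> k _; exact: csupp_joint CF _.
by near=> s; exact: csupp_slice.
Unshelve. all: by end_near. Qed.

Lemma integral_rV_slice_supp (F : 'rV[R]_(1 + n) -> R) : csupp r F -> forall t, r < `|t| ->
    integral_rV (fun v : 'rV[R]_n => F (rm t v)) = 0.
Proof.
move=> CF t rt; apply/eqP; rewrite -normr_le0.
rewrite (le_trans (@integral_rV_bound _ 0 (csupp_slice _ CF) _)) ?mulr0 //.
by move=> v _; rewrite CF.2 ?normr0 //; exact: lt_le_trans rt (norm_row_mx_l _ _).
Qed.

End integral_rV_lemmas.

Lemma integral_rV_ge0 n (F : 'rV[R]_n -> R) : (forall x, 0 <= F x) -> 0 <= integral_rV F.
Proof.
elim: n F => [|n IH] F F0 /=; first exact: F0.
by apply: Rintegral_ge0 => t _; apply: IH => v; exact: F0.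
Qed.

(** By induction the slice through [x0] has positive integral, and the integral of a slice depends
    continuously on its first coordinate. *)
Lemma integral_rV_gt0 n r (F : 'rV[R]_n -> R) x0 : 0 <= r -> csupp r F -> (forall x, 0 <= F x) ->
  0 < F x0 -> 0 < integral_rV F.
Proof.
move=> r0; elim: n F x0 => [|n IH] F x0 CF F0 Fx0 /=; first by rewrite (thinmx0 x0) in Fx0.
pose G : 'rV[R]_(1 + n) -> R := F.
have E : x0 = rm (lsubmx (x0 : 'rV[R]_(1 + n)) 0 0) (rsubmx (x0 : 'rV[R]_(1 + n))).
  by rewrite -[LHS](@hsubmxK _ 1 1 n) [lsubmx _ in LHS]mx11_scalar.
apply: (@Rintegral_pos _ _ r (lsubmx (x0 : 'rV[R]_(1 + n)) 0 0)).
- exact: (integral_rV_slice_continuous r0 (F := G)).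
- exact: (integral_rV_slice_supp r0 (F := G)).
- by move=> t; apply: integral_rV_ge0 => v; exact: F0.
- apply: IH (rsubmx (x0 : 'rV[R]_(1 + n))) _ _ _.
  + exact: (csupp_slice _ (F := G)).
  + by move=> v; exact: F0.
  + by rewrite -E.
Qed.

End integral_rV_theory.

(** * The divergence theorem on R^n *)

Section integral_rV_divergence.
Context {R : realType}.
Notation lam := (@lebesgue_measure R).
Notation rm t v := (row_mx (t%:M : 'M[R]_1) v).

Lemma Rintegral_derive0 (f F : R -> R) r : 0 <= r -> continuous f ->
  (forall t, is_derive t (1 : R) F (f t)) -> (forall t, r < `|t| -> F t = 0) ->
  (forall t, r < `|t| -> f t = 0) -> \int[lam]_t f t = 0.
Proof.
(* Vanishing of [F] is assumed strictly beyond [r], so the end points are moved out to [r + 1]. *)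
move=> r0 cf dF F0 f0; have r1 : r < r + 1 by rewrite ltrDl.
have r2 t : r + 1 < `|t| -> f t = 0 by move=> /(lt_trans r1) /f0.
rewrite (Rintegral_compact_support r2) (@segment_integral_derive _ _ _ f F) //.
- rewrite !F0 ?subrr ?normrN // ger0_norm //; lra.
- lra.
- exact: continuous_subspaceT.
Qed.

(** No exchange of integrals occurs. For the first coordinate the derivative is pulled out of the
    inner integral and the outer one is evaluated by the fundamental theorem of calculus; any other
    coordinate belongs to the slice, where the induction hypothesis gives 0 before the outer
    integration. *)
Lemma integral_rV_partial n r (F : 'rV[R]_n -> R) (k : 'I_n) : 0 <= r ->
  csupp r F -> (forall x, derivable F x (delta_mx 0 k)) -> csupp r (partial F k) ->
  integral_rV (partial F k) = 0.
Proof.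
move=> r0; elim: n F k => [|n IH] F k CF dF CdF; first by have := ltn_ord k.
pose G : 'rV[R]_(1 + n) -> R := F.
rewrite /=; case: (@split_ordP 1 n k) => j kE.
  have A t v h : rm (h *: 1 + t) v = h *: (delta_mx 0 k : 'rV[R]_(1 + n)) + rm t v.
    have -> : delta_mx 0 k = row_mx (delta_mx 0 j) 0 :> 'rV[R]_(1 + n).
      by rewrite kE; exact: delta_mx_lshift.
    rewrite scale_row_mx add_row_mx scaler0 add0r; congr row_mx.
    rewrite [h *: 1]mulr1 raddfD /=; congr (_ + _).
    by apply/matrixP => a b; rewrite !ord1 !mxE eqxx mulr1n mulr1.
  have D (t : R) v : is_derive t (1 : R) (fun t => G (rm t v)) (partial F k (rm t v)).
    have E : (fun h : R => h^-1 *: (((fun t => G (rm t v)) \o shift t) (h *: 1) - G (rm t v)))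
      = (fun h : R => h^-1 *: ((F \o shift (rm t v)) (h *: delta_mx 0 k) - F (rm t v))).
      by apply/funext => h /=; rewrite A.
    by split; [have := dF (rm t v)|]; rewrite /derivable /partial /derive E.
  have slD (t : R) : is_derive t (1 : R) (fun t => integral_rV (fun v : 'rV[R]_n => G (rm t v)))
     (integral_rV (fun v : 'rV[R]_n => partial F k (rm t v))).
    have CG : csupp r G by exact: CF.
    have CP : csupp r (partial F k : 'rV[R]_(1 + n) -> R) by exact: CdF.
    (* [functional_derive] differentiates at parameter 0, hence the translation by [t], undone
       below. *)
    have H := functional_derive (box_compact (r := r)) (@csupp_lin _ n r) (integral_rV_lin r0)
      (integral_rV_bound r0) (F := fun s v => G (rm (s + t) v)) 
      (dF := fun s v => partial F k (rm (s + t) v)) ltr01.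
    have : is_derive (0 : R) (1 : R) (fun s => integral_rV (fun v : 'rV[R]_n => G (rm (s + t) v)))
       (integral_rV (fun v : 'rV[R]_n => partial F k (rm (0 + t) v))).
      apply: H.
      - move=> v _.
        apply: (@continuous_comp _ _ _ (fun z : R * 'rV[R]_n => (z.1 + t, z.2))
          (fun z : R * 'rV[R]_n => partial F k (rm z.1 z.2))); last exact: csupp_joint CP _.
        apply: continuous_pair; last exact: cvg_snd.
        by apply: cvgD; [exact: cvg_fst|exact: cvg_cst].
      - move=> s v _ _; have [d1 d2] := D (s + t) v.
        have E : (fun h : R => h^-1 *: (((fun s => G (rm (s + t) v)) \o shift s) (h *: 1) - G (rm (s + t) v)))
          = (fun h : R => h^-1 *: (((fun t => G (rm t v)) \o shift (s + t)) (h *: 1) - G (rm (s + t) v))).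
          by apply/funext => h /=; rewrite addrA.
        by split; [move: d1|rewrite -d2]; rewrite /derivable /derive E.
      - by move=> s _; exact: (csupp_slice _ (F := G)).
      - exact: (csupp_slice _ (F := partial F k)).
    move=> [d1 d2]; rewrite add0r in d2.
    have E : (fun h : R => h^-1 *: (((fun s => integral_rV (fun v : 'rV[R]_n => G (rm (s + t) v))) \o shift 0) (h *: 1) -
            integral_rV (fun v : 'rV[R]_n => G (rm (0 + t) v))))
       = (fun h : R => h^-1 *: (((fun t => integral_rV (fun v : 'rV[R]_n => G (rm t v))) \o shift t) (h *: 1) -
            integral_rV (fun v : 'rV[R]_n => G (rm t v)))).
      by apply/funext => h /=; rewrite addr0 add0r.
    by split; [move: d1|rewrite -d2]; rewrite /derivable /derive E.
  apply: (Rintegral_derive0 r0 _ slD).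
  - exact: (integral_rV_slice_continuous r0 (F := partial F k)).
  - exact: (integral_rV_slice_supp r0 (F := G)).
  - exact: (integral_rV_slice_supp r0 (F := partial F k)).
have A t v u h : rm t (h *: u + v) = h *: (rm 0 u : 'rV[R]_(1 + n)) + rm t v.
  by rewrite scale_row_mx add_row_mx scale_scalar_mx mulr0 -raddfD /= add0r.
have E0 : delta_mx 0 k = rm 0 (delta_mx 0 j) :> 'rV[R]_(1 + n).
  rewrite raddf0 kE; exact: delta_mx_rshift.
have PE t : (fun v : 'rV[R]_n => partial F k (rm t v)) = partial (fun v => G (rm t v)) j.
  apply/funext => v; rewrite /partial.
  by rewrite (derive_affine (A := fun v => rm t v) (L := fun u => rm 0 u) G) ?E0.
rewrite [X in Rintegral _ _ X](_ : _ = fun=> 0); last first.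
  apply/funext => t; rewrite PE; apply: IH.
  - exact: (csupp_slice _ (F := G)).
  - move=> v; have := dF (rm t v); rewrite E0.
    suff E : (fun h : R => h^-1 *: (((fun v => G (rm t v)) \o shift v) (h *: delta_mx 0 j) - G (rm t v)))
      = (fun h : R => h^-1 *: ((F \o shift (rm t v)) (h *: rm 0 (delta_mx 0 j)) - F (rm t v))).
      by rewrite /derivable E.
    by apply/funext => h /=; rewrite A.
  - by rewrite -PE; exact: (csupp_slice _ (F := partial F k)).
by rewrite Rintegral_cst ?mul0r.
Qed.

End integral_rV_divergence.

(** * Bump functions and smooth families *)

Section flat_function.
Context {R : realType}.
Implicit Types (x y : R) (m k : nat).

(* The power of x^-1 makes the family closed under differentiation. *)
Definition flat m x : R := if 0 < x then x^-1 ^+ m * expR (- x^-1) else 0.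

(** The exponential of [y / m.+1%:R] is at least [y / m.+1%:R]; raise this to the power [m.+1]. *)
Lemma exprn_expRN_le m y : 0 <= y -> y ^+ m.+1 * expR (- y) <= m.+1%:R ^+ m.+1.
Proof.
move=> y0; rewrite expRN ler_pdivrMr ?expR_gt0 //.
have {2}-> : y = m.+1%:R * (y / m.+1%:R) by rewrite mulrC divfK.
rewrite expRM_natl -exprMn; apply: lerXn2r; rewrite ?nnegrE //.
rewrite mulrC -ler_pdivrMr //; by apply: le_trans (expR_ge1Dx _); rewrite lerDr.
Qed.

Lemma flat_ge0 m x : 0 <= flat m x.
Proof. by rewrite /flat; case: ifP => // x0; rewrite mulr_ge0 ?expR_ge0 // exprn_ge0 // invr_ge0 ltW. Qed.

Lemma flat_gt0 m x : 0 < x -> 0 < flat m x.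
Proof. by move=> x0; rewrite /flat x0 mulr_gt0 ?expR_gt0 // exprn_gt0 // invr_gt0. Qed.

Lemma flat_le0 m x : x <= 0 -> flat m x = 0.
Proof. by rewrite /flat ltNge => ->. Qed.

(** The bound is quadratic so that the difference quotient at the origin is O(h), which makes the
    derivative there 0. *)
Lemma flat_bound m x : flat m x <= m.+2%:R ^+ m.+2 * x ^+ 2.
Proof.
rewrite /flat; case: ifP => [x0|_]; last by rewrite mulr_ge0 ?sqr_ge0 // exprn_ge0.
have y0 : 0 <= x^-1 by rewrite invr_ge0 ltW.
have H := exprn_expRN_le m.+1 y0.
rewrite -ler_pdivrMr ?exprn_gt0 //.
have -> : x^-1 ^+ m * expR (- x^-1) / x ^+ 2 = x^-1 ^+ m.+2 * expR (- x^-1).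
  by rewrite -exprVn mulrAC -exprD addn2.
exact: H.
Qed.

Lemma is_derive_flat m x :
  is_derive x (1 : R) (flat m) (- m%:R * flat m.+1 x + flat m.+2 x).
Proof.
have [x0|x0|<-] := ltgtP 0 x; last first.
- rewrite !flat_le0 // mulr0 addr0.
  have H : (fun h : R => h^-1 *: ((flat m \o shift 0) (h *: 1) - flat m 0)) @ (0 : R)^' --> (0 : R).
    apply/cvgrPdist_le => e e0; near=> h.
    have h0 : h != 0 by near: h; exact: nbhs_dnbhs_neq.
    rewrite sub0r normrN /= addr0 [h *: 1]mulr1 (flat_le0 _ (lexx 0)) subr0 normrM normfV.
    rewrite mulrC ler_pdivrMr ?normr_gt0 // (ger0_norm (flat_ge0 _ _)).
    rewrite (le_trans (flat_bound _ _))// -real_normK ?num_real // expr2 mulrA ler_wpM2r //.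
    rewrite mulrC -ler_pdivlMr ?exprn_gt0 //; near: h; apply: dnbhs0_le.
    by rewrite divr_gt0 ?exprn_gt0.
  by split; [apply/cvg_ex; exists 0|exact: cvg_lim H].
- rewrite !flat_le0 ?(ltW x0) // mulr0 addr0.
  apply: (near_eq_is_derive _ (is_derive_cst (0 : R) x (1 : R))).
  near=> y; apply/esym; rewrite flat_le0 // ltW //; near: y; exact: lt_nbhsl.
- rewrite /flat x0.
  suff H : is_derive x (1 : R) (fun y => (y^-1) ^+ m * expR (- y^-1))
      (- m%:R * (x^-1 ^+ m.+1 * expR (- x^-1)) + x^-1 ^+ m.+2 * expR (- x^-1)).
    apply: (near_eq_is_derive _ H).
    near=> y; rewrite ifT //; near: y; exact: lt_nbhsr.
  have xn : x != 0 by rewrite gt_eqF.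
  have dV : is_derive x (1 : R) (fun y : R => y^-1) (- (x^-1 ^+ 2)).
    split; first by apply: derivableV => //; exact: derivable_id.
    rewrite deriveV ?derive_id // -exprVn; exact: mulr1.
  have dp y : is_derive y (1 : R) (fun y : R => y ^+ m * expR (- y))
     (m%:R * y ^+ m.-1 * expR (- y) - y ^+ m * expR (- y)).
    have de : is_derive y (1 : R) (fun y : R => expR (- y)) (- expR (- y)).
      have d0 : derivable (fun y : R => - y) y 1 by apply: derivableN; exact: derivable_id.
      have d1 : derivable expR (- y) 1 by exact: derivable_expR.
      have := is_derive_comp1 d0 d1; rewrite derive1E derive_val deriveN; last exact: derivable_id.
      by rewrite derive_id mulrN1.
    have dX : is_derive y (1 : R) (fun y : R => y ^+ m) (m%:R * y ^+ m.-1).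
      have [d1 d2] := @is_deriveX _ _ (@id R) m y 1 1 (is_derive_id _ _).
      have E : (fun y : R => y ^+ m) = (@id R) ^+ m by apply/funext => z; rewrite exprfctE.
      split; rewrite E //; rewrite d2 -mulr_natl; exact: mulr1.
    have [h1 h2] := @is_deriveM _ _ (fun y : R => y ^+ m) (fun y => expR (- y)) y 1 _ _ dX de.
    split; first exact: h1.
    rewrite [LHS]h2 -![_ *: _]/(_ * _); ring.
  have [dV1 dV2] := dV; have [dp1 dp2] := dp x^-1.
  have [h1 h2] := is_derive_comp1 dV1 dp1; split; first exact: h1.
  rewrite [LHS]h2 derive1E dV2 dp2; case: (m) => [|m']; first by rewrite !mul0r; ring.
  by rewrite /= !exprS; ring.
Unshelve. all: by end_near. Qed.

Lemma Ck_flat k m (U : set R) : open U -> Ck k U (flat m).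
Proof.
have cf m' x : {for x, continuous (flat m')}.
  by have [d _] := is_derive_flat m' x; apply: differentiable_continuous; exact/derivable1_diffP.
move=> Uo; elim: k m => [|k IH] m; first by split=> // x _; exact: cf.
apply: Ck_step => // v.
exists (fun x => v * (- m%:R * flat m.+1 x + flat m.+2 x)).
  move=> x _; have [d1 d2] := is_derive_flat m x.
  by have := is_derive_dirZ v d1; rewrite d2 [v *: 1]mulr1.
by apply: CkM => //; [exact: Ck_cst|apply: CkD => //; apply: CkM => //; exact: Ck_cst].
Qed.

End flat_function.

Lemma openX_prod (S T : topologicalType) (U : set S) (V : set T) :
  open U -> open V -> open (U `*` V).
Proof.
move=> Uo Vo; rewrite openE => -[x y] [/= Ux Vy].
by exists (U, V) => //; split; exact: open_nbhs_nbhs.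
Qed.

Lemma pairZD (R : realType) (V W : normedModType R) (h : R) (v w : V) (u x : W) :
  (h *: v + w, h *: u + x) = h *: (v, u) + (w, x) :> V * W.
Proof. by []. Qed.

(** * Charts and smooth families of functions *)

Section atlas_facts.
Context {R : realType} {n : nat} {M : ptopologicalType} (A : oriented_atlas R n M).
Notation img i := (coord i @` dom i).

Lemma paramP (i : index A) x : img i x -> dom i (param i x) /\ coord i (param i x) = x.
Proof. by move=> [p dp <-]; rewrite coordK. Qed.

Lemma img_coord (i : index A) p : dom i p -> img i (coord i p).
Proof. by move=> dp; exists p. Qed.

Lemma open_img (i : index A) (O : set M) : open O -> open (coord i @` (dom i `&` O)).
Proof.
move=> Oo; rewrite openE => x [p [dp Op] px].
have ix : img i x by exists p.
have pO : nbhs (param i x) O by rewrite -px coordK //; exact: open_nbhs_nbhs.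
have := param_continuous ix pO; rewrite /= nbhs_simpl /= => H.
have H' : nbhs x (img i) by apply: open_nbhs_nbhs; split => //; exact: image_open.
apply: filterS2 H H' => y /= Oy iy; have [dy cy] := paramP iy.
by exists (param i y).
Qed.

Lemma img_setI (i : index A) (O : set M) x : img i x -> O (param i x) -> (coord i @` (dom i `&` O)) x.
Proof. by move=> ix Ox; have [d c] := paramP ix; exists (param i x). Qed.

Lemma near_param (i : index A) (O : set M) x : img i x -> nbhs (param i x) O ->
  \forall y \near x, img i y /\ O (param i y).
Proof.
move=> ix pO; have := param_continuous ix pO; rewrite /= nbhs_simpl /= => H.
have H' : nbhs x (img i) by apply: open_nbhs_nbhs; split => //; exact: image_open.
by apply: filterS2 H H' => y.
Qed.

End atlas_facts.

Section families.
Context {R : realType} {n : nat} {M : ptopologicalType} (A : oriented_atlas R n M).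
Context {P : normedModType R}.
Notation img i := (coord i @` dom i).
Implicit Types (W : set P) (F G : P -> M -> R).

Lemma openX_img W (i : index A) : open W -> open (W `*` img i).
Proof. by move=> Wo; apply: openX_prod => //; exact: image_open. Qed.

Section closure.
Variable W : set P.
Hypothesis Wo : open W.

Lemma familyD F G : smooth_family A W F -> smooth_family A W G -> smooth_family A W (fun w p => F w p + G w p).
Proof. by move=> sF sG i k; apply: CkD; [exact: openX_img|exact: sF|exact: sG]. Qed.

Lemma familyB F G : smooth_family A W F -> smooth_family A W G -> smooth_family A W (fun w p => F w p - G w p).
Proof. by move=> sF sG i k; apply: CkB; [exact: openX_img|exact: sF|exact: sG]. Qed.

Lemma familyM F G : smooth_family A W F -> smooth_family A W G -> smooth_family A W (fun w p => F w p * G w p).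
Proof. by move=> sF sG i k; apply: CkM; [exact: openX_img|exact: sF|exact: sG]. Qed.

Lemma family_cst c : smooth_family A W (fun _ _ => c).
Proof. by move=> i k; exact: Ck_cst. Qed.

Lemma familyX2 F : smooth_family A W F -> smooth_family A W (fun w p => F w p ^+ 2).
Proof. by move=> sF; have := familyM sF sF. Qed.

Lemma family_sum (I : Type) (r : seq I) (F : I -> P -> M -> R) :
  (forall i, smooth_family A W (F i)) -> smooth_family A W (fun w p => \sum_(i <- r) F i w p).
Proof. by move=> sF i k; apply: Ck_sum; [exact: openX_img|move=> j _; exact: sF]. Qed.

Lemma familyV F : (forall w p, W w -> F w p != 0) -> smooth_family A W F ->
  smooth_family A W (fun w p => (F w p)^-1).
Proof.
move=> F0 sF i k; apply: CkV; [exact: openX_img| |exact: sF].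
by move=> [w x] [/= Ww _]; exact: F0.
Qed.

Lemma family_sqrt F : (forall w p, W w -> 0 < F w p) -> smooth_family A W F ->
  smooth_family A W (fun w p => Num.sqrt (F w p)).
Proof.
move=> F0 sF i k; apply: Ck_sqrt; [exact: openX_img| |exact: sF].
by move=> [w x] [/= Ww _]; exact: F0.
Qed.

Lemma family_eq F G : (forall w p, W w -> F w p = G w p) -> smooth_family A W G -> smooth_family A W F.
Proof.
move=> FG sG i k; apply: Ck_near (sG i k) => z Wz.
have : nbhs z (W `*` img i) by apply: open_nbhs_nbhs; split => //; exact: openX_img.
by apply: filterS => -[w x] [/= Ww _]; exact: FG.
Qed.

(** In a chart, a derivative in the parameter is the derivative along [(v, 0)] on the product, which
    [Ck] already controls. *)
Lemma family_derive F v : smooth_family A W F -> smooth_family A W (fun w p => 'D_v (F ^~ p) w).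
Proof.
move=> sF i k; have := (sF i k.+1).2 (v, 0) => -[_].
congr (Ck k _ _); apply/funext => -[w x] /=.
apply/esym; apply: (@derive_affine R (P * 'rV[R]_n)%type P R (fun z => F z.1 (param i z.2)) (fun w => (w, x)) (fun v => (v, 0)) w v).
by move=> w' v' h; rewrite -pairZD scaler0 add0r.
Qed.

Lemma family_is_derive F w v p : smooth_family A W F -> W w -> is_derive w v (F ^~ p) ('D_v (F ^~ p) w).
Proof.
move=> sF Ww; set i := chart_at A p; have dp : dom i p := dom_chart_at A p.
have := ((sF i 1%N).2 (v, 0)).1 (w, coord i p); move=> H.
have {H} : derivable (fun z : P * 'rV[R]_n => F z.1 (param i z.2)) (w, coord i p) (v, 0).
  by apply: H; split => //=; exact: img_coord.
move=> H; apply: derivableP; move: H; rewrite /derivable.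
set f1 := (fun h : R => _); set f2 := (fun h : R => _).
suff -> : f1 = f2 by [].
apply/funext => h; by rewrite /f1 /f2 /= scaler0 add0r coordK.
Qed.

Lemma family_continuous F w p : smooth_family A W F -> W w ->
  {for (w, p), continuous (fun z : P * M => F z.1 z.2)}.
Proof.
move=> sF Ww; set i := chart_at A p; have dp : dom i p := dom_chart_at A p.
have c1 : {for (w, coord i p), continuous (fun z : P * 'rV[R]_n => F z.1 (param i z.2))}.
  by apply: (sF i 0%N).1; split => //=; exact: img_coord.
have c2 : {for (w, p), continuous (fun z : P * M => (z.1, coord i z.2))}.
  apply: continuous_pair; first exact: cvg_fst.
  by apply: (@continuous_comp _ _ _ snd (coord i)); [exact: cvg_snd|exact: coord_continuous].
have c3 := @continuous_comp _ _ _ (fun z : P * M => (z.1, coord i z.2)) _ (w, p) c2 c1.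
rewrite /prop_for /continuous_at; have E : F w (param i (coord i p)) = F w p by rewrite coordK.
rewrite /= -E; apply: cvg_trans c3; apply: near_eq_cvg.
have : nbhs (w, p) (setT `*` dom i).
  by exists (setT, dom i) => //; split; [exact: filterT|apply: open_nbhs_nbhs; split => //; exact: dom_open].
by apply: filterS => -[w' p'] [_ /= dp'] /=; rewrite coordK.
Qed.

Lemma family_slice F w : smooth_family A W F -> W w -> smooth_fun A (F w).
Proof.
move=> sF Ww i k.
apply: (@Ck_affine _ _ _ _ _ (W `*` img i) (img i) (fun z : P * 'rV[R]_n => F z.1 (param i z.2))
  (fun x => (w, x)) (fun u => (0, u))).
- by move=> x; apply: continuous_pair; [exact: cst_continuous|exact: cvg_id].
- by move=> x v h; rewrite -pairZD scaler0 add0r.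
- by move=> x ix.
- exact: sF.
Qed.

Lemma family_fun (f : M -> R) : smooth_fun A f -> smooth_family A W (fun=> f).
Proof.
move=> sf i k.
apply: (@Ck_affine _ _ _ _ _ (img i) (W `*` img i) (f \o param i) snd snd).
- by move=> z; exact: cvg_snd.
- by move=> [w x] [w' v] h.
- by move=> z [].
- exact: sf.
Qed.

Lemma family_par (h : P -> R) : smooth_on W h -> smooth_family A W (fun w _ => h w).
Proof.
move=> sh i k.
apply: (@Ck_affine _ _ _ _ _ W (W `*` img i) h fst fst).
- by move=> z; exact: cvg_fst.
- by move=> [w x] [w' v] l.
- by move=> z [].
- exact: sh.
Qed.

End closure.

Lemma family_affine (P' : normedModType R) W (W' : set P') F (B L : P' -> P) :
  continuous B -> (forall x v h, B (h *: v + x) = h *: L v + B x) ->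
  (forall x, W' x -> W (B x)) -> smooth_family A W F -> smooth_family A W' (fun w => F (B w)).
Proof.
move=> Bc BL WW sF i k.
apply: (@Ck_affine _ _ _ _ _ (W `*` img i) (W' `*` img i) (fun z : P * 'rV[R]_n => F z.1 (param i z.2))
  (fun z => (B z.1, z.2)) (fun z => (L z.1, z.2))).
- move=> z; apply: continuous_pair; last exact: cvg_snd.
  by apply: (@continuous_comp _ _ _ fst B); [exact: cvg_fst|exact: Bc].
- by move=> [w x] [v u] h; rewrite -pairZD /= BL.
- by move=> [w x] [/= Ww ix]; split => //; exact: WW.
- exact: sF.
Qed.

End families.

Section smooth_functions.
Context {R : realType} {n : nat} {M : ptopologicalType} (A : oriented_atlas R n M).

Lemma smooth_fun_continuous (f : M -> R) : smooth_fun A f -> continuous f.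
Proof.
move=> sf p; have sF : smooth_family A [set: R] (fun=> f) by apply: family_fun => //; exact: openT.
have c := @family_continuous _ _ _ _ _ _ _ 0 p sF I.
apply: (@continuous_comp _ _ _ (fun p => ((0 : R), p)) (fun z : R * M => f z.2)); last exact: c.
by apply: continuous_pair; [exact: cst_continuous|exact: cvg_id].
Qed.

End smooth_functions.

(** * Integration over the compact manifold *)

Section compact_integral.
Context {R : realType} {M : ptopologicalType} (mu : {measure set (borel M) -> \bar R}).
Hypothesis M_compact : compact [set: M].
Hypothesis mu_total : mu [set: M] = 1%E.
Implicit Types (f h : M -> R).

Lemma continuous_borel_measurable f : continuous f -> measurable_fun [set: borel M] (f : borel M -> R).
Proof.
move=> /continuousP cf; apply: (measurability _ (measurable_realfun.RGenOpens.measurableE R)).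
move=> _ [_ [a [b ->] <-]]; rewrite setTI; apply: sub_sigma_algebra.
exact/cf/interval_open.
Qed.

Lemma compact_bounded_fun f : continuous f -> exists B : R, forall p, `|f p| <= B.
Proof.
move=> cf; have /compact_bounded[B [_ HB]] : compact (f @` setT).
  by apply: continuous_compact => //; exact: continuous_subspaceT.
by exists (B + 1) => p; apply: HB; [rewrite ltrDl|exists p].
Qed.

Lemma continuous_integrable f : continuous f -> mu.-integrable [set: borel M] (EFin \o f).
Proof.
move=> cf; apply: measurable_bounded_integrable => //.
- by rewrite mu_total ltry.
- exact: continuous_borel_measurable.
- have [B HB] := compact_bounded_fun cf.
  exists B; split; first exact: num_real.
  by move=> c Bc p _ /=; rewrite (le_trans (HB p)) // ltW.
Qed.

Lemma continuous_lin (S : topologicalType) a (u v : S -> R) : continuous u -> continuous v -> continuous (fun p => a * u p + v p).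
Proof.
move=> cu cv p; apply: (@continuousD _ _ _ (fun p => a * u p) v); last exact: cv.
by apply: (@continuousM _ _ (fun=> a) u); [exact: cst_continuous|exact: cu].
Qed.

Lemma cint_lin a f h : continuous f -> continuous h ->
  \int[mu]_p (a * f p + h p) = a * \int[mu]_p f p + \int[mu]_p h p.
Proof.
move=> cf ch; have caf : continuous (fun p => a * f p).
  by move=> p; apply: (@continuousM _ _ (fun=> a) f); [exact: cst_continuous|exact: cf].
rewrite RintegralD ?RintegralZl //; exact: continuous_integrable.
Qed.

Lemma cintD f h : continuous f -> continuous h ->
  \int[mu]_p (f p + h p) = \int[mu]_p f p + \int[mu]_p h p.
Proof.
move=> cf ch; rewrite -[X in _ = X + _]mul1r -cint_lin //.
by congr (Rintegral _ _ _); apply/funext => p; rewrite mul1r.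
Qed.

Lemma cintZ a f : continuous f -> \int[mu]_p (a * f p) = a * \int[mu]_p f p.
Proof. by move=> cf; rewrite RintegralZl //; exact: continuous_integrable. Qed.

Lemma cintB f h : continuous f -> continuous h ->
  \int[mu]_p (f p - h p) = \int[mu]_p f p - \int[mu]_p h p.
Proof.
move=> cf ch; rewrite [RHS]addrC -mulN1r -cint_lin //.
by congr (Rintegral _ _ _); apply/funext => p; rewrite mulN1r addrC.
Qed.

Lemma cint_cst c : \int[mu]_p c = c.
Proof. by rewrite Rintegral_cst // [X in fine X]mu_total mulr1. Qed.

Lemma cint_le f h : continuous f -> continuous h -> (forall p, f p <= h p) ->
  \int[mu]_p f p <= \int[mu]_p h p.
Proof. by move=> cf ch fh; apply: le_Rintegral => //; exact: continuous_integrable. Qed.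

(** The factor 1 and the guard [[set: M] p] instantiate the constant [B] and the compact [K] of
    [functional_continuous] and [functional_derive]. *)
Lemma cint_bound f c : continuous f -> (forall p, [set: M] p -> `|f p| <= c) -> `|\int[mu]_p f p| <= 1 * c.
Proof.
move=> cf fc; have cn : continuous (fun p => `|f p|).
  by move=> x; apply: continuous_comp; [exact: cf|exact: norm_continuous].
rewrite mul1r (le_trans (le_normr_Rintegral _ (continuous_integrable cf)))//.
by rewrite -[leRHS]cint_cst; apply: cint_le => // [p|p]; [exact: cst_continuous|exact: fc].
Qed.

End compact_integral.

Section integral_of_family.
Context {R : realType} {n : nat} {M : ptopologicalType} (A : oriented_atlas R n M).
Context (mu : {measure set (borel M) -> \bar R}).
Hypothesis M_compact : compact [set: M].
Hypothesis mu_total : mu [set: M] = 1%E.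
Context {P : normedModType R}.
Variable W : set P.
Hypothesis Wo : open W.
Implicit Types (F G : P -> M -> R).

Lemma family_continuous_slice F w : smooth_family A W F -> W w -> continuous (F w).
Proof. by move=> sF Ww; apply: smooth_fun_continuous; exact: family_slice sF Ww. Qed.

Lemma integral_family_continuous F w : smooth_family A W F -> W w ->
  {for w, continuous (fun w => \int[mu]_p F w p)}.
Proof.
move=> sF Ww.
apply: (functional_continuous M_compact (@continuous_lin R M) (@cint_lin _ _ mu M_compact mu_total)
  (@cint_bound _ _ mu M_compact mu_total)).
  by move=> p _; exact: family_continuous.
have : nbhs w W by exact: open_nbhs_nbhs.
by apply: filterS => w' Ww'; exact: family_continuous_slice sF Ww'.
Qed.

Lemma integral_family_is_derive F w v : smooth_family A W F -> W w ->
  is_derive w v (fun w => \int[mu]_p F w p) (\int[mu]_p 'D_v (F ^~ p) w).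
Proof.
move=> sF Ww; have [d d0 dW] : exists2 d : R, 0 < d & forall s, `|s| < d -> W (s *: v + w).
  have /near_ball_segment[d d0 dW] : nbhs w W by exact: open_nbhs_nbhs.
  exists (d / (`|v| + 1)); first by rewrite divr_gt0 // ltr_wpDl.
  move=> s; rewrite ltr_pdivlMr ?ltr_wpDl // => sd; apply: dW.
  by rewrite addrK normrZ (le_lt_trans _ sd) // ler_wpM2l // lerDl.
have sD := family_derive v sF.
have : is_derive (0 : R) (1 : R) (fun s => \int[mu]_p F (s *: v + w) p)
    (\int[mu]_p 'D_v (F ^~ p) (0 *: v + w)).
  apply: (functional_derive M_compact (@continuous_lin R M) (@cint_lin _ _ mu M_compact mu_total)
    (@cint_bound _ _ mu M_compact mu_total) (F := fun s p => F (s *: v + w) p)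
    (dF := fun s p => 'D_v (F ^~ p) (s *: v + w)) d0).
  - move=> p _.
    apply: (@continuous_comp _ _ _ (fun z : R * M => (z.1 *: v + w, z.2)) (fun z : P * M => 'D_v (F ^~ z.2) z.1)).
      apply: continuous_pair; last exact: cvg_snd.
      by apply: cvgD; [apply: cvgZl; exact: cvg_fst|exact: cvg_cst].
    by apply: (@family_continuous _ _ _ _ _ _ _ _ p sD); apply: dW; rewrite normr0.
  - move=> s p sd _; have [d1 _] := family_is_derive v p sF (dW s sd).
    exact: is_derive_line.
  - by move=> s sd; exact: family_continuous_slice sF (dW s sd).
  - by apply: family_continuous_slice sD _; apply: dW; rewrite normr0.
move=> [d1 d2]; split; first by apply/derivable1P.
by rewrite derive_line derive1E d2 scale0r add0r.
Qed.

Lemma integral_family_smooth F : smooth_family A W F -> smooth_on W (fun w => \int[mu]_p F w p).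
Proof.
move=> sF k; elim: k F sF => [|k IH] F sF.
  by split=> // w Ww; exact: integral_family_continuous.
apply: Ck_step => // [w Ww|v]; first exact: integral_family_continuous.
exists (fun w => \int[mu]_p 'D_v (F ^~ p) w); last by apply: IH; exact: family_derive.
by move=> w Ww; exact: integral_family_is_derive.
Qed.

End integral_of_family.

(** * Bump functions on the manifold *)

Section bumps.
Context {R : realType} {n : nat} {M : ptopologicalType} (A : oriented_atlas R n M).
Notation img i := (coord i @` dom i).

(** The sup norm of row vectors is not smooth; the squared Euclidean distance is polynomial and its
    balls lie in balls of the norm. *)
Definition sqdist (a x : 'rV[R]_n) : R := \sum_k (x 0 k - a 0 k) ^+ 2.

Lemma norm_sqdist (a x : 'rV[R]_n) (r : R) : 0 <= r -> sqdist a x <= r ^+ 2 -> `|x - a| <= r.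
Proof.
move=> r0 H; rewrite [leLHS]/Num.Def.normr /= mx_normrE; apply: bigmax_le => // -[i k] _ /=.
rewrite (ord1 i) !mxE -(@ler_pXn2r _ 2) ?nnegrE // real_normK ?num_real // (le_trans _ H) //.
by rewrite /sqdist (bigD1 k) //= lerDl sumr_ge0 // => j _; exact: sqr_ge0.
Qed.

Lemma Ck_sqdist (V : normedModType R) k (U : set V) (T : V -> 'rV[R]_n) a : open U -> Ck k U T ->
  Ck k U (fun x => sqdist a (T x)).
Proof.
move=> Uo CT; apply: Ck_sum => // j _.
have C1 : Ck k U (fun x => T x 0 j - a 0 j) by apply: CkB => //; [exact: Ck_coord|exact: Ck_cst].
exact: CkM.
Qed.

Lemma flat_le1 (x : R) : flat 0 x <= 1.
Proof.
rewrite /flat; case: ifP => // x0; rewrite expr0 mul1r -expR0 ler_expR.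
by rewrite oppr_le0 invr_ge0 ltW.
Qed.

Hypothesis M_hausdorff : hausdorff_space M.

Lemma param_image_compact (i : index A) (K : set 'rV[R]_n) : compact K -> K `<=` img i ->
  compact (param i @` K).
Proof.
move=> Kc Ki; apply: continuous_compact => //; apply: continuous_in_subspaceT => x /set_mem Kx.
by apply: param_continuous; exact: Ki.
Qed.

Lemma coord_image_compact (i : index A) (K : set M) : compact K -> K `<=` dom i ->
  compact (coord i @` K).
Proof.
move=> Kc Ki; apply: continuous_compact => //; apply: continuous_in_subspaceT => x /set_mem Kx.
by apply: coord_continuous; exact: Ki.
Qed.

Definition supp (f : M -> R) : set M := closure [set p | f p != 0].

Lemma notin_supp (f : M -> R) p : ~ supp f p -> f p = 0.
Proof.
move=> Hp; apply/eqP; apply/negPn/negP => fp; apply: Hp.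
exact: subset_closure.
Qed.

Lemma near_notin_supp (f : M -> R) p : ~ supp f p -> \forall q \near p, f q = 0.
Proof.
move=> Hp; have : nbhs p (~` supp f).
  by apply: open_nbhs_nbhs; split => //; apply: closed_openC; exact: closed_closure.
by apply: filterS => q; exact: notin_supp.
Qed.

(** A flat function of r^2 minus the squared distance is transplanted from the chart at [p] and
    extended by zero. The image [K] of a closed ball is compact, hence closed since [M] is
    Hausdorff; this makes the extension smooth across the boundary of the chart. *)
Lemma bump_exists (O : set M) p : open O -> O p -> exists psi : M -> R,
  [/\ smooth_fun A psi, forall q, 0 <= psi q <= 1, 0 < psi p &
      supp psi `<=` dom (chart_at A p) `&` O].
Proof.
move=> Oo Op; set i := chart_at A p; have dp : dom i p := dom_chart_at A p.
pose U := coord i @` (dom i `&` O); have Uo : open U by exact: open_img.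
pose a := coord i p; have Ua : U a by exists p.
have /near_ball_segment[d d0 dU] : nbhs a U by exact: open_nbhs_nbhs.
pose r := d / 2; have r0 : 0 < r by rewrite divr_gt0.
have rd : r < d by rewrite /r; lra.
pose B := [set x : 'rV[R]_n | `|x - a| <= r].
have BU : B `<=` U by move=> x /= xr; apply: dU; exact: le_lt_trans xr rd.
have Ui : U `<=` img i by move=> x [q [dq _] <-]; exists q.
have Bc : compact B.
  apply: bounded_closed_compact.
    exists (`|a| + r); split; first exact: num_real.
    move=> c rc x /= xr; rewrite -(subrK a x) (le_trans (ler_normD _ _))//.
    by apply: le_trans (ltW rc); rewrite addrC lerD2l.
  have -> : B = (fun x : 'rV[R]_n => `|x - a|) @^-1` [set y | y <= r] by [].
  apply: closed_comp => [x _|]; last exact: closed_le.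
  have c : {for x, continuous (fun y : 'rV[R]_n => y - a)}.
    by apply: (@continuousB _ _ _ id (fun=> a)); [exact: cvg_id|exact: cst_continuous].
  exact: cvg_norm c.
pose K := param i @` B.
have Kcl : closed K.
  by apply: compact_closed => //; apply: param_image_compact => // x /BU /Ui.
have KO : K `<=` dom i `&` O.
  by move=> q [x /BU [q' [dq' Oq'] <-] <-]; rewrite coordK.
pose psi := (fun q => flat 0 (r ^+ 2 - sqdist a (coord i q))) \_ (dom i).
have psiE q : dom i q -> psi q = flat 0 (r ^+ 2 - sqdist a (coord i q)).
  by move=> dq; rewrite /psi patchE mem_set.
have psi0 q : ~ K q -> psi q = 0.
  move=> Kq; rewrite /psi patchE; case: ifPn => // /set_mem dq.
  apply: flat_le0; rewrite leNgt subr_gt0; apply/negP => H; apply: Kq.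
  exists (coord i q); last by rewrite coordK.
  by apply: norm_sqdist; exact: ltW.
exists psi; split.
(* Smoothness is tested point by point in an arbitrary chart [j]: over [dom i] the formula is
   composed with the transition map, and outside [dom i] the point avoids the closed set [K], so
   [psi] is zero nearby. *)
- move=> j k; apply: Ck_cover => x jx.
  have [dj cj] := paramP jx.
  have [di|ndi] := pselect (dom i (param j x)).
    apply: (@Ck_near _ _ _ _ _ _ (fun y => flat 0 (r ^+ 2 - sqdist a ((coord i \o param j) y)))).
      move=> y ->; have : nbhs (param j x) (dom i) by apply: open_nbhs_nbhs; split => //; exact: dom_open.
      by move=> /(near_param jx); apply: filterS => z [_ dz]; exact: psiE.
    have To : open (coord j @` (dom j `&` dom i)) by apply: open_img; exact: dom_open.
    apply: (@Ck_sub _ _ _ _ (coord j @` (dom j `&` dom i))).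
      by move=> y ->; exact: img_setI.
    apply: (@Ck_comp _ _ _ _ setT (flat 0)) => //; [exact: openT|apply: Ck_flat; exact: openT|].
    apply: CkB => //; first exact: Ck_cst.
    by apply: Ck_sqdist => //; exact: transition_smooth.
  apply: (@Ck_near _ _ _ _ _ _ (fun=> 0)); last exact: Ck_cst.
  move=> y ->; have : nbhs (param j x) (~` K).
    apply: open_nbhs_nbhs; split; first exact: closed_openC.
    by move=> /KO[].
  by move=> /(near_param jx); apply: filterS => z [_ dz]; exact: psi0.
- move=> q; rewrite /psi patchE; case: ifP => _; last by rewrite lexx ler01.
  by rewrite flat_ge0 flat_le1.
- rewrite psiE // flat_gt0 // /sqdist big1 ?subr0 ?exprn_gt0 // => k _.
  by rewrite subrr expr0n.
- apply: subset_trans KO; rewrite ((closure_id K).1 Kcl); apply: closure_subset => q /= pq.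
  by apply: contrapT => /psi0 /eqP; rewrite (negbTE pq).
Qed.

Lemma continuous_mul_supp (psi u : M -> R) (O : set M) : open O -> continuous psi -> supp psi `<=` O ->
  (forall p, O p -> {for p, continuous u}) -> continuous (fun p => psi p * u p).
Proof.
move=> Oo cpsi sO cu p; have [Op|nOp] := pselect (O p).
  by apply: (@continuousM _ _ psi u); [exact: cpsi|exact: cu].
have nsp : ~ supp psi p by move=> /sO.
rewrite /continuous_at (notin_supp nsp) mul0r.
apply: cvg_trans (@cvg_cst _ _ _ (nbhs p) _).
by apply: near_eq_cvg; apply: filterS (near_notin_supp nsp) => q ->; rewrite mul0r.
Qed.

End bumps.

(** * Extension by zero of functions read in a chart *)

Section chart_zero_extension.
Context {R : realType} {n : nat} {M : ptopologicalType} (A : oriented_atlas R n M).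
Notation img i := (coord i @` dom i).
Hypothesis M_compact : compact [set: M].
Variables (i : index A) (K : set M).
Hypothesis Kcl : closed K.
Hypothesis Ki : K `<=` dom i.

Lemma coordK_compact : compact (coord i @` K).
Proof. by apply: coord_image_compact => //; exact: subclosed_compact Kcl M_compact _. Qed.

Lemma coordK_bounded : exists2 r : R, 0 <= r & forall x, (coord i @` K) x -> `|x| <= r.
Proof.
have [B [_ HB]] := compact_bounded coordK_compact.
exists (`|B| + 1) => [|x Kx]; first by rewrite addr_ge0.
by apply: HB Kx; rewrite (le_lt_trans (ler_norm _)) // ltrDl.
Qed.

Definition vanishes_off (Phi : 'rV[R]_n -> R) := forall x, img i x -> ~ K (param i x) -> Phi x = 0.

Lemma zext_near_in (Phi : 'rV[R]_n -> R) x : img i x -> \forall y \near x, (Phi \_ (img i)) y = Phi y.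
Proof.
move=> ix; have : nbhs x (img i) by apply: open_nbhs_nbhs; split => //; exact: image_open.
by apply: filterS => y iy; rewrite patchE mem_set.
Qed.

(** [K] is closed in a compact space, so its coordinate image is compact, hence closed in R^n. This
    covers the boundary points of the chart image, where [Phi] itself is meaningless. *)
Lemma zext_near_out (Phi : 'rV[R]_n -> R) x : vanishes_off Phi -> ~ (coord i @` K) x ->
  \forall y \near x, (Phi \_ (img i)) y = 0.
Proof.
move=> PK nKx; have Ccl : closed (coord i @` K).
  by apply: compact_closed; [exact: norm_hausdorff|exact: coordK_compact].
have : nbhs x (~` (coord i @` K)) by apply: open_nbhs_nbhs; split => //; exact: closed_openC.
apply: filterS => y nKy; rewrite patchE; case: ifPn => // /set_mem iy.
by apply: PK => // Ky; apply: nKy; exists (param i y) => //; have [] := paramP iy.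
Qed.

Lemma img_or_out x : img i x \/ ~ (coord i @` K) x.
Proof.
have [ix|nix] := pselect (img i x); [by left|right => -[p Kp px]; apply: nix].
by exists p => //; exact: Ki.
Qed.

Lemma zext_csupp (Phi : 'rV[R]_n -> R) r : (forall x, (coord i @` K) x -> `|x| <= r) ->
  vanishes_off Phi -> (forall x, img i x -> {for x, continuous Phi}) -> csupp r (Phi \_ (img i)).
Proof.
move=> Kr PK cP; split.
  move=> x; have [ix|nKx] := img_or_out x.
    rewrite /continuous_at patchE mem_set //; apply: cvg_trans (cP x ix).
    have E : \forall y \near x, Phi y = (Phi \_ (img i)) y.
      by apply: filterS (zext_near_in Phi ix) => y ->.
    exact: near_eq_cvg E.
  have H := zext_near_out PK nKx.
  rewrite /continuous_at (nbhs_singleton H).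
  apply: cvg_trans (@cvg_cst _ _ _ (nbhs x) _).
  have E : \forall y \near x, cst (0 : R) y = (Phi \_ (img i)) y.
    by apply: filterS H => y ->.
  exact: near_eq_cvg E.
move=> x rx; have nKx : ~ (coord i @` K) x by move=> /Kr; rewrite leNgt rx.
exact: nbhs_singleton (zext_near_out PK nKx).
Qed.

Lemma vanishes_off_partial (Phi : 'rV[R]_n -> R) k : vanishes_off Phi -> vanishes_off (partial Phi k).
Proof.
move=> PK x ix nK; rewrite /partial.
have : nbhs (param i x) (~` K) by apply: open_nbhs_nbhs; split => //; exact: closed_openC.
move=> /(near_param ix) H.
rewrite (@near_eq_derive _ _ _ _ (cst 0)) ?derive_cst //.
by apply: filterS H => y [iy nKy]; exact: PK.
Qed.

(** Extension by zero commutes with partial derivatives, because the extended function vanishes near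
    every point off the compact image of [K]; the divergence theorem then applies on all of R^n. *)
Lemma integral_rV_zext_partial (Phi : 'rV[R]_n -> R) k : vanishes_off Phi -> Ck 1 (img i) Phi ->
  integral_rV ((partial Phi k) \_ (img i)) = 0.
Proof.
move=> PK CP; have [r r0 Kr] := coordK_bounded.
have PE : (partial Phi k) \_ (img i) = partial (Phi \_ (img i)) k.
  apply/funext => x; have [ix|nKx] := img_or_out x.
    by rewrite patchE mem_set // /partial (near_eq_derive _ (zext_near_in Phi ix)).
  rewrite (nbhs_singleton (zext_near_out (vanishes_off_partial k PK) nKx)).
  by rewrite /partial (near_eq_derive _ (zext_near_out PK nKx)) derive_cst.
rewrite PE; apply: (integral_rV_partial r0).
- by apply: zext_csupp => // x ix; exact: CP.1.
- move=> x; have [ix|nKx] := img_or_out x.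
    apply: (@near_eq_derivable _ _ _ Phi); last exact: (CP.2 _).1.
    by apply: filterS (zext_near_in Phi ix) => y ->.
  apply: (@near_eq_derivable _ _ _ (cst 0)); last exact: derivable_cst.
  by apply: filterS (zext_near_out PK nKx) => y ->.
- rewrite -PE; apply: zext_csupp => //; first exact: vanishes_off_partial.
  by move=> x ix; exact: (CP.2 _).2.1.
Qed.

End chart_zero_extension.

(** * Gradient, Laplacian and Green's formula *)

Section smooth_matrices.
Context {R : realType} {V : normedModType R}.
Variables (U : set V) (k : nat).
Hypothesis Uo : open U.

Lemma Ck_det m (F : V -> 'M[R]_m) : (forall i j, Ck k U (fun x => F x i j)) ->
  Ck k U (fun x => \det (F x)).
Proof.
move=> CF; apply: Ck_sum => // s _; apply: CkM => //; first exact: Ck_cst.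
by apply: Ck_prod => // i _; exact: CF.
Qed.

Lemma Ck_invmx m (F : V -> 'M[R]_m) i j : (forall i j, Ck k U (fun x => F x i j)) ->
  (forall x, U x -> \det (F x) != 0) -> Ck k U (fun x => invmx (F x) i j).
Proof.
move=> CF dF.
apply: (@Ck_near _ _ _ _ _ _ (fun x => (\det (F x))^-1 * \adj (F x) i j)).
  move=> x Ux; have : nbhs x U by exact: open_nbhs_nbhs.
  apply: filterS => y Uy; rewrite /invmx unitmxE unitfE dF //.
  by rewrite !mxE.
apply: CkM => //; first by apply: CkV => //; exact: Ck_det.
under eq_fun do rewrite mxE /cofactor; apply: CkM => //; first exact: Ck_cst.
apply: Ck_det => a b; under eq_fun do rewrite !mxE; exact: CF.
Qed.

End smooth_matrices.

Section positive_definite.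
Context {R : realType}.

(* \det (t G + (1 - t) I) goes from 1 to \det G without vanishing. *)
Lemma posdef_det_gt0 m (G : 'M[R]_m) :
  (forall v : 'rV[R]_m, v != 0 -> 0 < (v *m G *m v^T) 0 0) -> 0 < \det G.
Proof.
move=> Gpos.
pose f (t : R) : R := \det (t *: G + (1 - t) *: (1%:M : 'M[R]_m)).
have cf : continuous f.
  have C : Ck 0 setT f.
    apply: Ck_det; first exact: openT.
    move=> i j; under eq_fun do rewrite !mxE.
    have C1 : Ck 0 [set: R] (@id R) by split=> // x _; exact: cvg_id.
    apply: CkD; [exact: openT| |]; apply: CkM; try exact: openT; try exact: Ck_cst => //.
    - exact: C1.
    - by apply: CkB; [exact: openT|exact: Ck_cst|exact: C1].
  by move=> t; exact: C.1.
have f0 : f 0 = 1 by rewrite /f scale0r add0r subr0 scale1r det1.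
have f1 : f 1 = \det G by rewrite /f scale1r subrr scale0r addr0.
rewrite -f1 ltNge; apply/negP => f1n.
have [t t01 ft] : exists2 t, t \in `[0, 1] & f t = 0.
  apply: IVT => //; first exact: continuous_subspaceT.
  by rewrite f0 ge_min f1n orbT le_max ler01.
move: t01; rewrite in_itv /= => /andP[t0 t1].
have /det0P[v v0] : f t == 0 by rewrite ft.
move=> /(congr1 (fun w => (w *m v^T) 0 0)).
rewrite mulmxDr mulmxDl -!scalemxAr -!scalemxAl mulmx1 mul0mx !mxE => E.
have vv : 0 < (v *m v^T) 0 0.
  rewrite mxE lt_def; apply/andP; split; last by apply: sumr_ge0 => k _; rewrite mxE -expr2 sqr_ge0.
  apply: contra v0; rewrite psumr_eq0; last by move=> k _; rewrite mxE -expr2 sqr_ge0.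
  move=> /allP H; apply/eqP/rowP => k; have := H k (mem_index_enum _).
  by rewrite !mxE -expr2 sqrf_eq0 => /eqP.
have gv := Gpos v v0.
have E' : t * (v *m G *m v^T) 0 0 + (1 - t) * (v *m v^T) 0 0 = 0.
  by rewrite [(v *m G *m v^T) 0 0]mxE [(v *m v^T) 0 0]mxE.
have [t00|tp] := eqVneq t 0.
  by move: E' vv; rewrite t00 mul0r add0r subr0 mul1r => ->; rewrite ltxx.
have tpos : 0 < t by rewrite lt_def tp.
have : 0 < t * (v *m G *m v^T) 0 0 + (1 - t) * (v *m v^T) 0 0.
  by rewrite ltr_wpDr ?mulr_gt0 // mulr_ge0 ?subr_ge0 // ltW.
by rewrite E' ltxx.
Qed.

End positive_definite.

(** * Gradients and change of chart *)

Section gradient.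
Context {R : realType} {n : nat} {M : ptopologicalType} (A : oriented_atlas R n M).
Variable g : riemannian_metric A.
Notation img i := (coord i @` dom i).

Lemma open_image (i : index A) : open (img i). Proof. exact: image_open. Qed.

Lemma detg_gt0 i x : img i x -> 0 < \det (gmx g i x).
Proof. by move=> ix; apply: posdef_det_gt0 => v; exact: gmx_posdef. Qed.

Lemma sqrtdetg_gt0 i x : img i x -> 0 < sqrtdetg g i x.
Proof. by move=> ix; rewrite sqrtr_gt0 detg_gt0. Qed.

Lemma gmx_unit i x : img i x -> gmx g i x \in unitmx.
Proof. by move=> ix; rewrite unitmxE unitfE gt_eqF ?detg_gt0. Qed.

Lemma Ck_sqrtdetg k i : Ck k (img i) (sqrtdetg g i).
Proof.
have Uo : open (img i) := @open_image i.
apply: Ck_sqrt => //; first by move=> x; exact: detg_gt0.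
by apply: Ck_det => // a b; exact: gmx_smooth.
Qed.

Lemma Ck_ginv k i a b : Ck k (img i) (fun x => invmx (gmx g i x) a b).
Proof.
have Uo : open (img i) := @open_image i.
apply: Ck_invmx => //; first by move=> c d; exact: gmx_smooth.
by move=> x ix; rewrite gt_eqF ?detg_gt0.
Qed.

(** This is dH(grad F), which equals g(grad F, grad H) and contains the inverse metric only once. *)
Definition local_inner i (F H : 'rV[R]_n -> R) (x : 'rV[R]_n) : R :=
  \sum_l local_grad g i F x 0 l * partial H l x.

Definition grad_inner (f h : M -> R) (p : M) : R :=
  let i := chart_at A p in local_inner i (f \o param i) (h \o param i) (coord i p).

Lemma local_gradE i F x l : local_grad g i F x 0 l = \sum_k partial F k x * invmx (gmx g i x) k l.
Proof. by rewrite /local_grad mxE; apply: eq_bigr => k _; rewrite mxE. Qed.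

Lemma local_innerE i F H x :
  local_inner i F H x = ((\row_k partial F k x) *m invmx (gmx g i x) *m (\row_k partial H k x)^T) 0 0.
Proof. by rewrite /local_inner mxE; apply: eq_bigr => l _; rewrite !mxE. Qed.

Lemma ginv_sym i x : img i x -> (invmx (gmx g i x))^T = invmx (gmx g i x).
Proof. by move=> ix; rewrite trmx_inv gmx_sym. Qed.

Lemma local_innerC i F H x : img i x -> local_inner i F H x = local_inner i H F x.
Proof.
move=> ix; have trE (X : 'M[R]_1) : X 0 0 = X^T 0 0 by rewrite mxE.
by rewrite !local_innerE [LHS]trE !trmx_mul trmxK ginv_sym // mulmxA.
Qed.

Lemma grad_normsqE f p : grad_normsq g f p = grad_inner f f p.
Proof.
rewrite /grad_normsq /grad_inner; set i := chart_at A p; set x := coord i p.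
have ix : img i x by apply: img_coord; exact: dom_chart_at.
rewrite local_innerE /local_grad trmx_mul ginv_sym // !mulmxA.
by rewrite mulmxKV // gmx_unit.
Qed.

Lemma grad_innerC f h p : grad_inner f h p = grad_inner h f p.
Proof. by apply: local_innerC; apply: img_coord; exact: dom_chart_at. Qed.

Section change_of_chart.
Variables (i j : index A) (p : M).
Hypothesis di : dom i p.
Hypothesis dj : dom j p.
Let x := coord i p.
Let y := coord j p.
Let T := coord j \o param i.

Let ox : (coord i @` (dom i `&` dom j)) x. Proof. by exists p. Qed.
Let ix : img i x. Proof. exact: img_coord. Qed.
Let jy : img j y. Proof. exact: img_coord. Qed.
Let Tx : T x = y. Proof. by rewrite /T /= coordK. Qed.

Lemma transition_differentiable : differentiable T x.
Proof.
apply: differentiable_rV => k.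
have Oo : open (coord i @` (dom i `&` dom j)) by apply: open_img; exact: dom_open.
apply: (Ck1_differentiable Oo ox).
by apply: (Ck_coord (f := T)) => //; exact: transition_smooth.
Qed.

Lemma param_transition (f : M -> R) : \forall z \near x, (f \o param i) z = ((f \o param j) \o T) z.
Proof.
have : nbhs (param i x) (dom j).
  rewrite coordK //; apply: open_nbhs_nbhs; split => //; exact: dom_open.
move=> /(near_param ix); apply: filterS => z [iz jz].
by rewrite /T /= coordK.
Qed.

Lemma partial_transition f : smooth_fun A f ->
  \row_k partial (f \o param i) k x = (\row_k partial (f \o param j) k y) *m (jacobian T x)^T.
Proof.
move=> sf; apply/rowP => k; rewrite !mxE /partial.
rewrite (near_eq_derive _ (param_transition f)).
have df : differentiable (f \o param j) (T x).
  by rewrite Tx; apply: (Ck1_differentiable (@open_image j) jy); exact: (sf j 1%N).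
have dT := transition_differentiable.
rewrite deriveE; last exact: differentiable_comp.
rewrite diff_comp //= -deriveE // Tx.
rewrite (derive_rV _ (@open_image j)) //; last exact: sf.
by apply: eq_bigr => l _; rewrite !mxE mulrC; congr (_ * _).
Qed.

Lemma jacobian_unit : jacobian T x \in unitmx.
Proof. by rewrite unitmxE unitfE gt_eqF //; exact: transition_oriented. Qed.

(** For row vectors the differentials transform by J^T on the right and the metric by J G J^T, so
    the Jacobians cancel in dF G^-1 dH^T. *)
Lemma local_inner_transition f h : smooth_fun A f -> smooth_fun A h ->
  local_inner i (f \o param i) (h \o param i) x = local_inner j (f \o param j) (h \o param j) y.
Proof.
move=> sf sh; rewrite !local_innerE !partial_transition //.
have gE := gmx_transition g ox.
rewrite coordK // in gE; rewrite -/y -/T in gE.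
set J := jacobian T x; have Ju : J \in unitmx := jacobian_unit.
have JTu : J^T \in unitmx by rewrite unitmx_tr.
have gu : gmx g j y \in unitmx by exact: gmx_unit.
rewrite gE -/J trmx_mul trmxK; congr (_ 0 0).
have -> : invmx (J *m gmx g j y *m J^T) = invmx (J^T) *m invmx (gmx g j y) *m invmx J.
  have Gu : J *m gmx g j y *m J^T \in unitmx by rewrite !unitmx_mul Ju gu.
  apply: (can_inj (mulKmx Gu)); rewrite mulmxV //.
  by rewrite !mulmxA mulmxK // mulmxK // mulmxV.
by rewrite !mulmxA mulmxK // mulmxKV.
Qed.

End change_of_chart.

Lemma grad_inner_chart i p f h : smooth_fun A f -> smooth_fun A h -> dom i p ->
  grad_inner f h p = local_inner i (f \o param i) (h \o param i) (coord i p).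
Proof. by move=> sf sh dp; apply: local_inner_transition => //; exact: dom_chart_at. Qed.

End gradient.

Section family_derivatives.
Context {R : realType} {n : nat} {M : ptopologicalType} (A : oriented_atlas R n M).
Variable g : riemannian_metric A.
Context {P : normedModType R}.
Notation img i := (coord i @` dom i).
Variable W : set P.
Hypothesis Wo : open W.
Implicit Types F G : P -> M -> R.

Lemma partial_slice (Phi : P * 'rV[R]_n -> R) w k x :
  partial (fun y => Phi (w, y)) k x = 'D_(0, delta_mx 0 k) Phi (w, x).
Proof.
apply: (@derive_affine R (P * 'rV[R]_n)%type 'rV[R]_n R Phi (fun x => (w, x)) (fun u => (0, u)) x (delta_mx 0 k)).
by move=> y u h; rewrite -pairZD scaler0 add0r.
Qed.

Lemma Ck_partial_slice (U : set 'rV[R]_n) (Phi : P * 'rV[R]_n -> R) k l : Ck k.+1 (W `*` U) Phi ->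
  Ck k (W `*` U) (fun z => partial (fun y => Phi (z.1, y)) l z.2).
Proof.
move=> CP; have := (CP.2 (0, delta_mx 0 l)).2; congr (Ck k _ _).
by apply/funext => -[w x]; rewrite partial_slice.
Qed.

Lemma Ck_lift_img (U : set 'rV[R]_n) (phi : 'rV[R]_n -> R) k : Ck k U phi -> Ck k (W `*` U) (fun z => phi z.2).
Proof.
apply: (@Ck_affine _ _ _ _ _ _ (W `*` U) phi snd snd).
- by move=> z; exact: cvg_snd.
- by move=> [w x] [w' v] h.
- by move=> z [].
Qed.

Lemma Ck_family_partial F (i : index A) k l : smooth_family A W F ->
  Ck k (W `*` img i) (fun z => partial (F z.1 \o param i) l z.2).
Proof.
by move=> sF; apply: (@Ck_partial_slice _ (fun z => F z.1 (param i z.2))); exact: sF.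
Qed.

Lemma Ck_family_local_grad F i k l : smooth_family A W F ->
  Ck k (W `*` img i) (fun z => local_grad g i (F z.1 \o param i) z.2 0 l).
Proof.
move=> sF; under eq_fun do rewrite local_gradE.
apply: Ck_sum => [|m _]; first exact: openX_img.
apply: CkM; [exact: openX_img|exact: Ck_family_partial|].
by apply: (@Ck_lift_img _ (fun x => invmx (gmx g i x) m l)); exact: Ck_ginv.
Qed.

Lemma Ck_family_local_inner F G i k : smooth_family A W F -> smooth_family A W G ->
  Ck k (W `*` img i) (fun z => local_inner g i (F z.1 \o param i) (G z.1 \o param i) z.2).
Proof.
move=> sF sG; apply: Ck_sum => [|m _]; first exact: openX_img.
by apply: CkM; [exact: openX_img|exact: Ck_family_local_grad|exact: Ck_family_partial].
Qed.

Lemma family_grad_inner F G : smooth_family A W F -> smooth_family A W G ->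
  smooth_family A W (fun w p => grad_inner g (F w) (G w) p).
Proof.
move=> sF sG i k; apply: Ck_near (Ck_family_local_inner i k sF sG) => z Wz.
have : nbhs z (W `*` img i) by apply: open_nbhs_nbhs; split => //; exact: openX_img.
apply: filterS => -[w x] [/= Ww ix]; have [d c] := paramP ix.
by rewrite (@grad_inner_chart _ _ _ _ g i) ?c //; exact: family_slice Ww.
Qed.

Definition local_lap i (F : 'rV[R]_n -> R) := local_div g i (local_grad g i F).

Lemma Ck_family_local_lap F i k : smooth_family A W F ->
  Ck k (W `*` img i) (fun z => local_lap i (F z.1 \o param i) z.2).
Proof.
move=> sF; have Xo := @openX_img _ _ _ A _ W i Wo.
apply: CkM => //.
  apply: (@Ck_lift_img _ (fun x => (sqrtdetg g i x)^-1)); apply: CkV; [exact: open_image| |exact: Ck_sqrtdetg].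
  by move=> x ix; rewrite gt_eqF // sqrtdetg_gt0.
apply: Ck_sum => // l _.
apply: (@Ck_partial_slice _ (fun z => sqrtdetg g i z.2 * local_grad g i (F z.1 \o param i) z.2 0 l)).
apply: CkM => //; last exact: Ck_family_local_grad.
by apply: Ck_lift_img; exact: Ck_sqrtdetg.
Qed.

End family_derivatives.

Section single_function.
Context {R : realType} {n : nat} {M : ptopologicalType} (A : oriented_atlas R n M).
Variable g : riemannian_metric A.
Notation img i := (coord i @` dom i).
Implicit Types f h : M -> R.

(** A single function is a constant family over R, so the statements proved for families specialize
    by restriction to parameter 0. *)
Lemma Ck_of_family (U : set 'rV[R]_n) k (phi : 'rV[R]_n -> R) :
  Ck k ([set: R] `*` U) (fun z => phi z.2) -> Ck k U phi.
Proof.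
move=> H; apply: (@Ck_affine _ _ _ _ _ _ U (fun z : R * 'rV[R]_n => phi z.2) (fun x => (0, x)) (fun u => (0, u))) H.
- by move=> x; apply: continuous_pair; [exact: cst_continuous|exact: cvg_id].
- by move=> x v h; rewrite -pairZD scaler0 add0r.
- by move=> x.
Qed.

Let To : open [set: R]. Proof. exact: openT. Qed.
Let cf f : smooth_fun A f -> smooth_family A [set: R] (fun=> f). Proof. by move=> sf; exact: family_fun. Qed.

Lemma smooth_fun_of_family f : smooth_family A [set: R] (fun=> f) -> smooth_fun A f.
Proof. by move=> sF; apply: (family_slice (w := 0) sF). Qed.

Lemma smooth_funM f h : smooth_fun A f -> smooth_fun A h -> smooth_fun A (fun p => f p * h p).
Proof. by move=> sf sh; apply: smooth_fun_of_family; apply: familyM => //; exact: cf. Qed.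

Lemma smooth_funV f : (forall p, f p != 0) -> smooth_fun A f -> smooth_fun A (fun p => (f p)^-1).
Proof. by move=> f0 sf; apply: smooth_fun_of_family; apply: familyV => //; exact: cf. Qed.

Lemma smooth_fun_sqrt f : (forall p, 0 < f p) -> smooth_fun A f -> smooth_fun A (fun p => Num.sqrt (f p)).
Proof. by move=> f0 sf; apply: smooth_fun_of_family; apply: family_sqrt => //; exact: cf. Qed.

Lemma smooth_fun_sum (I : Type) (r : seq I) (F : I -> M -> R) : (forall i, smooth_fun A (F i)) ->
  smooth_fun A (fun p => \sum_(i <- r) F i p).
Proof. by move=> sF; apply: smooth_fun_of_family; apply: family_sum => // i; exact: cf. Qed.

Lemma smooth_fun_grad_inner f h : smooth_fun A f -> smooth_fun A h -> smooth_fun A (grad_inner g f h).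
Proof. by move=> sf sh; apply: smooth_fun_of_family; apply: family_grad_inner => //; exact: cf. Qed.

Lemma Ck_local_grad f i k l : smooth_fun A f -> Ck k (img i) (fun x => local_grad g i (f \o param i) x 0 l).
Proof. by move=> sf; apply: Ck_of_family; exact: (Ck_family_local_grad g To i k l (cf sf)). Qed.

Lemma Ck_local_lap f i k : smooth_fun A f -> Ck k (img i) (local_lap g i (f \o param i)).
Proof. by move=> sf; apply: Ck_of_family; exact: (Ck_family_local_lap g To i k (cf sf)). Qed.

Lemma local_innerDr i F H1 H2 x : img i x -> Ck 1 (img i) H1 -> Ck 1 (img i) H2 ->
  local_inner g i F (fun y => H1 y + H2 y) x = local_inner g i F H1 x + local_inner g i F H2 x.
Proof.
move=> ix C1 C2; rewrite /local_inner -big_split /=; apply: eq_bigr => l _.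
rewrite -mulrDr; congr (_ * _); rewrite /partial deriveD //; [exact: (C1.2 _).1|exact: (C2.2 _).1].
Qed.

Lemma grad_innerDr f h1 h2 p : smooth_fun A h1 -> smooth_fun A h2 ->
  grad_inner g f (fun q => h1 q + h2 q) p = grad_inner g f h1 p + grad_inner g f h2 p.
Proof.
move=> s1 s2; apply: local_innerDr; [|exact: s1|exact: s2].
by apply: img_coord; exact: dom_chart_at.
Qed.

Lemma grad_inner_near0 f h p : (\forall q \near p, h q = 0) -> grad_inner g f h p = 0.
Proof.
move=> h0; rewrite /grad_inner /local_inner big1 // => l _; rewrite /partial.
set i := chart_at A p; have dp : dom i p := dom_chart_at A p.
rewrite (@near_eq_derive _ _ _ _ (cst 0)) ?derive_cst ?mulr0 //.
have := near_param (img_coord dp); rewrite coordK // => /(_ _ h0).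
by apply: filterS => y [].
Qed.

Lemma grad_inner0 f p : grad_inner g f (fun=> 0) p = 0.
Proof. by apply: grad_inner_near0; near=> q. Unshelve. all: by end_near. Qed.

(** The Leibniz rule for div(psi grad F), multiplied by the volume density: the right-hand side
    becomes a Euclidean divergence, ready for integration over R^n. *)
Lemma local_div_product i (psi F : 'rV[R]_n -> R) x : img i x -> Ck 1 (img i) psi ->
  (forall l, Ck 1 (img i) (fun x => local_grad g i F x 0 l)) ->
  psi x * local_lap g i F x * sqrtdetg g i x + local_inner g i F psi x * sqrtdetg g i x =
  \sum_l partial (fun y => psi y * (sqrtdetg g i y * local_grad g i F y 0 l)) l x.
Proof.
move=> ix Cp CG; have s0 : sqrtdetg g i x != 0 by rewrite gt_eqF // sqrtdetg_gt0.
have Cs : Ck 1 (img i) (sqrtdetg g i) by exact: Ck_sqrtdetg.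
have CsG l : Ck 1 (img i) (fun y => sqrtdetg g i y * local_grad g i F y 0 l).
  by apply: CkM; [exact: open_image|exact: Cs|exact: CG].
have E l : partial (fun y => psi y * (sqrtdetg g i y * local_grad g i F y 0 l)) l x =
    psi x * partial (fun y => sqrtdetg g i y * local_grad g i F y 0 l) l x
    + sqrtdetg g i x * local_grad g i F x 0 l * partial psi l x.
  by rewrite /partial deriveM //; [exact: (Cp.2 _).1|exact: ((CsG l).2 _).1].
rewrite (eq_bigr _ (fun l _ => E l)) big_split /=; congr (_ + _).
  rewrite -mulr_sumr -mulrA; congr (_ * _).
  by rewrite /local_lap /local_div mulrC mulrA mulfV // mul1r.
rewrite /local_inner mulr_suml; apply: eq_bigr => l _.
by rewrite mulrC mulrA.
Qed.

End single_function.

(** * The Laplacian in weak form and Green's formula *)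

Section weak_laplacian.
Context {R : realType} {n : nat} {M : ptopologicalType} (A : oriented_atlas R n M).
Variable g : riemannian_metric A.
Variable mu : {measure set (borel M) -> \bar R}.
Hypothesis M_compact : compact [set: M].
Hypothesis M_hausdorff : hausdorff_space M.
Hypothesis mu_volume : is_volume g mu.
Hypothesis mu_total : mu [set: M] = 1%E.
Notation img i := (coord i @` dom i).
Implicit Types f h psi : M -> R.

Lemma supp_closed f : closed (supp f). Proof. exact: closed_closure. Qed.

Lemma supp_sub f h : (forall p, f p = 0 -> h p = 0) -> supp h `<=` supp f.
Proof. by move=> fh; apply: closure_subset => p /= hp; apply: contra hp => /eqP /fh ->. Qed.

Lemma chart_csupp i f (K : set M) : continuous f -> closed K -> K `<=` dom i ->
  (forall p, ~ K p -> f p = 0) ->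
  forall r, (forall x, (coord i @` K) x -> `|x| <= r) ->
  csupp r ((fun x => f (param i x) * sqrtdetg g i x) \_ (img i)).
Proof.
move=> cf Kcl Ki f0 r Kr; apply: (zext_csupp M_compact Kcl Ki) => //.
  by move=> x ix nK; rewrite f0 // mul0r.
move=> x ix; apply: (@continuousM _ _ (f \o param i) (sqrtdetg g i)).
  by apply: (@continuous_comp _ _ _ (param i) f); [exact: param_continuous|exact: cf].
exact: (Ck_sqrtdetg g 0 i).1.
Qed.

Lemma integral_gt0 h p : continuous h -> (forall q, 0 <= h q) -> supp h `<=` dom (chart_at A p) ->
  0 < h p -> 0 < \int[mu]_q h q.
Proof.
move=> ch h0 sh hp; set i := chart_at A p; have dp : dom i p := dom_chart_at A p.
rewrite (mu_volume ch sh).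
have [r r0 Kr] := coordK_bounded M_compact (@supp_closed h) sh.
apply: (@integral_rV_gt0 _ _ r _ (coord i p)) => //.
- by apply: (chart_csupp ch (@supp_closed h) sh) => // q; exact: notin_supp.
- move=> x; rewrite patchE; case: ifP => // /set_mem ix.
  by rewrite mulr_ge0 // ltW // sqrtdetg_gt0.
- have ix : img i (coord i p) by exact: img_coord.
  by rewrite patchE mem_set // coordK // mulr_gt0 // sqrtdetg_gt0.
Qed.

(** If [u p] were nonzero, [u q * u p] would be positive near [p], and a bump supported there would
    give a positive integral; the factor [u p] treats both signs at once. Test functions are
    confined to the chart at [p] because positivity of an integral is read off in a single chart. *)
Lemma fundamental_lemma (O : set M) (u : M -> R) p : open O -> O p ->
  (forall q, O q -> {for q, continuous u}) ->
  (forall psi, smooth_fun A psi -> (forall q, 0 <= psi q <= 1) -> supp psi `<=` O ->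
     supp psi `<=` dom (chart_at A p) -> \int[mu]_q (psi q * u q) = 0) ->
  u p = 0.
Proof.
move=> Oo Op cu H; apply/eqP; apply/negPn/negP => up.
pose s := u p; have ss : 0 < u p * s by rewrite -expr2 exprn_even_gt0.
have cus : {for p, continuous (fun q => u q * s)}.
  by apply: (@continuousM _ _ u (fun=> s)); [exact: cu|exact: cst_continuous].
have N : nbhs p (O `&` [set q | 0 < u q * s]).
  apply: filterI; first exact: open_nbhs_nbhs.
  exact: (cus _ (lt_nbhsr ss)).
have [psi [sp p01 pp sO]] := bump_exists A M_hausdorff (@open_interior _ (O `&` [set q | 0 < u q * s])) N.
have sO' : supp psi `<=` O by move=> q /sO [_] /interior_subset [].
have sd : supp psi `<=` dom (chart_at A p) by move=> q /sO [].
have cp := smooth_fun_continuous sp.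
have cpu : continuous (fun q => psi q * u q) by exact: continuous_mul_supp Oo cp sO' cu.
have cpus : continuous (fun q => s * (psi q * u q)).
  by move=> q; apply: (@continuousM _ _ (fun=> s) (fun q => psi q * u q)); [exact: cst_continuous|exact: cpu].
have : 0 < \int[mu]_q (s * (psi q * u q)).
  apply: (@integral_gt0 _ p) => //.
  - move=> q; rewrite mulrCA; have [sq|nsq] := pselect (supp psi q); last by rewrite (notin_supp nsq) mul0r.
    move: (sq) => /sO [_ /interior_subset [_ /=]]; rewrite mulrC => uq.
    by rewrite mulr_ge0 ?(ltW uq) //; have /andP[] := p01 q.
  - apply: subset_trans sd; apply: supp_sub => q ->; rewrite mul0r mulr0 //.
  - by rewrite mulrCA mulr_gt0 // mulrC.
by rewrite cintZ // H // mulr0 ltxx.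
Qed.

(** The Laplacian in one fixed chart, visibly continuous on [dom i], whereas [laplacian] changes
    chart with the point. *)
Definition chart_lap i f : M -> R := fun p => local_lap g i (f \o param i) (coord i p).

Lemma chart_lap_continuous i f p : smooth_fun A f -> dom i p -> {for p, continuous (chart_lap i f)}.
Proof.
move=> sf dp; apply: (@continuous_comp _ _ _ (coord i) (local_lap g i (f \o param i))).
  exact: coord_continuous.
by apply: (Ck_local_lap g i 0 sf).1; exact: img_coord.
Qed.

Lemma integral_rV_sum m r (I : Type) (s : seq I) (F : I -> 'rV[R]_m -> R) : 0 <= r ->
  (forall i, csupp r (F i)) ->
  csupp r (fun x => \sum_(i <- s) F i x) /\
  integral_rV (fun x => \sum_(i <- s) F i x) = \sum_(i <- s) integral_rV (F i).
Proof.
move=> r0 CF; elim: s => [|i s [IH1 IH2]].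
  have C0 : csupp r (fun _ : 'rV[R]_m => 0 : R) by split => // x; exact: cst_continuous.
  rewrite (_ : (fun x => _) = fun=> 0); last by apply/funext => x; rewrite big_nil.
  rewrite big_nil; split=> //; apply/eqP; rewrite -normr_le0.
  by rewrite (le_trans (integral_rV_bound r0 (c := 0) C0 _)) ?mulr0 // => x _; rewrite normr0.
rewrite (_ : (fun x => _) = fun x => 1 * F i x + \sum_(j <- s) F j x); last first.
  by apply/funext => x; rewrite big_cons mul1r.
split; first exact: csupp_lin.
by rewrite (integral_rV_lin r0) // big_cons mul1r IH2.
Qed.

(** When the test function is supported in the chart, the two integrals add up to that of div(psi
    grad f), which vanishes after extension by zero. *)
Lemma weak_chart_lap i f psi : smooth_fun A f -> smooth_fun A psi -> supp psi `<=` dom i ->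
  \int[mu]_q (psi q * chart_lap i f q) = - \int[mu]_q grad_inner g f psi q.
Proof.
move=> sf sp sd; apply/eqP; rewrite -subr_eq0 opprK; apply/eqP.
have cp := smooth_fun_continuous sp.
have c1 : continuous (fun q => psi q * chart_lap i f q).
  apply: (continuous_mul_supp (@dom_open _ _ _ A i) cp sd) => q dq.
  exact: chart_lap_continuous.
have c2 : continuous (grad_inner g f psi) by apply: smooth_fun_continuous; exact: smooth_fun_grad_inner.
have z1 q : ~ supp psi q -> psi q * chart_lap i f q = 0 by move=> /notin_supp ->; rewrite mul0r.
have z2 q : ~ supp psi q -> grad_inner g f psi q = 0.
  by move=> /near_notin_supp; exact: grad_inner_near0.
have sub (u : M -> R) : (forall q, ~ supp psi q -> u q = 0) -> supp u `<=` supp psi.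
  move=> u0; rewrite [X in _ `<=` X]((closure_id _).1 (@supp_closed psi)).
  apply: closure_subset => q /= uq.
  by apply: contrapT => /u0 /eqP; rewrite (negbTE uq).
rewrite (@mu_volume i _ c1); last by move=> q /(sub _ z1); exact: sd.
rewrite (@mu_volume i _ c2); last by move=> q /(sub _ z2); exact: sd.
have [r r0 Kr] := coordK_bounded M_compact (@supp_closed psi) sd.
have C1 := chart_csupp c1 (@supp_closed psi) sd z1 Kr.
have C2 := chart_csupp c2 (@supp_closed psi) sd z2 Kr.
rewrite -[X in X + _]mul1r -(integral_rV_lin r0) //.
(* The components of psi grad f times the volume density; their partial derivatives sum to the
   integrand. *)
pose Phi l y := (psi \o param i) y * (sqrtdetg g i y * local_grad g i (f \o param i) y 0 l).
have Cs : Ck 1 (img i) (sqrtdetg g i) by exact: Ck_sqrtdetg.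
have CG l : Ck 1 (img i) (fun x => local_grad g i (f \o param i) x 0 l) by exact: Ck_local_grad.
have CP l : Ck 1 (img i) (Phi l).
  apply: CkM; [exact: open_image|exact: sp|].
  by apply: CkM; [exact: open_image|exact: Cs|exact: CG].
have PK l : vanishes_off i (supp psi) (Phi l).
  by move=> x ix nK; rewrite /Phi /= (notin_supp nK) mul0r.
rewrite (_ : (fun x => _) = fun x => \sum_l ((partial (Phi l) l) \_ (img i)) x); last first.
  apply/funext => x; rewrite mul1r !patchE.
  have [ix|nix] := pselect (img i x); last first.
    rewrite memNset // addr0 big1 // => l _; by rewrite patchE memNset.
  rewrite mem_set //; under [RHS]eq_bigr do rewrite patchE mem_set //.
  have [d c] := paramP ix.
  rewrite (@grad_inner_chart _ _ _ _ g i) // /chart_lap c.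
  exact: (local_div_product ix (sp i 1%N) CG).
have CsP l : csupp r ((partial (Phi l) l) \_ (img i)).
  apply: (zext_csupp M_compact (@supp_closed psi) sd) => //.
    by apply: vanishes_off_partial => //; exact: supp_closed.
  by move=> x ix; exact: ((CP l).2 _).2.1.
rewrite (integral_rV_sum _ r0 CsP).2 big1 // => l _.
exact: (integral_rV_zext_partial M_compact (@supp_closed psi) sd l (PK l) (CP l)).
Qed.

(* Both sides satisfy the same weak equation against functions supported in the
   overlap of the charts, so no transformation law for second derivatives is
   needed. *)
Lemma laplacian_chart i f p : smooth_fun A f -> dom i p -> laplacian g f p = chart_lap i f p.
Proof.
move=> sf dp; set j := chart_at A p; have djp : dom j p := dom_chart_at A p.
have Oo : open (dom i `&` dom j) by apply: openI; exact: dom_open.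
apply/eqP; rewrite eq_sym -subr_eq0; apply/eqP.
rewrite -[LHS]/((fun q => chart_lap i f q - chart_lap j f q) p).
apply: (fundamental_lemma Oo (conj dp djp)).
  move=> q [di dj]; apply: (@continuousB _ _ _ (chart_lap i f) (chart_lap j f)); exact: chart_lap_continuous.
move=> psi sp _ sO _.
have si : supp psi `<=` dom i by move=> q /sO[].
have sj : supp psi `<=` dom j by move=> q /sO[].
have cp := smooth_fun_continuous sp.
under [X in Rintegral _ _ X]eq_fun do rewrite mulrBr.
rewrite (cintB M_compact mu_total).
- by rewrite !weak_chart_lap // subrr.
- apply: (continuous_mul_supp (@dom_open _ _ _ A i) cp si) => q dq; exact: chart_lap_continuous.
- apply: (continuous_mul_supp (@dom_open _ _ _ A j) cp sj) => q dq; exact: chart_lap_continuous.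
Qed.

(** Joint smoothness is visible in a chart [i] once [laplacian_chart] has replaced the preferred
    chart of every nearby point by [i]. *)
Lemma family_laplacian (P : normedModType R) (W : set P) (F : P -> M -> R) : open W ->
  smooth_family A W F -> smooth_family A W (fun w p => laplacian g (F w) p).
Proof.
move=> Wo sF i k; apply: Ck_near (Ck_family_local_lap g Wo i k sF) => z Wz.
have : nbhs z (W `*` img i) by apply: open_nbhs_nbhs; split => //; exact: openX_img.
apply: filterS => -[w x] [/= Ww ix]; have [d c] := paramP ix.
by rewrite (@laplacian_chart i) /chart_lap ?c //; exact: family_slice Ww.
Qed.

Lemma smooth_fun_laplacian f : smooth_fun A f -> smooth_fun A (laplacian g f).
Proof.
move=> sf; apply: smooth_fun_of_family; apply: (family_laplacian (F := fun=> f)); first exact: openT.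
by apply: family_fun => //; exact: openT.
Qed.

(** By compactness finitely many of the sets where a bump is positive cover [M]. Dividing by the
    positive sum gives a partition of unity. *)
Lemma covering_bumps : exists (s : seq M) (psi : M -> M -> R),
  (forall c, [/\ smooth_fun A (psi c), forall q, 0 <= psi c q & supp (psi c) `<=` dom (chart_at A c)]) /\
  forall p, 0 < \sum_(c <- s) psi c p.
Proof.
have H (c : M) : {psi : M -> R | [/\ smooth_fun A psi, forall q, 0 <= psi q <= 1, 0 < psi c &
      supp psi `<=` dom (chart_at A c) `&` setT]}.
  by apply: cid; apply: bump_exists => //; exact: openT.
pose psi c := sval (H c).
have := M_compact; rewrite compact_cover => /(_ M setT (fun c => [set q | 0 < psi c q])).
case.
- move=> c _; have [sp _ _ _] := svalP (H c).
  rewrite -/(psi c) in sp; have cp := smooth_fun_continuous sp.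
  have -> : [set q | 0 < psi c q] = psi c @^-1` [set x | 0 < x] by [].
  by apply: open_comp; [move=> q _; exact: cp|exact: open_gt].
- by move=> q _; exists q => //; have [] := svalP (H q).
move=> D _ cov; exists (finmap.enum_fset D), psi; split.
  move=> c; have [sp p01 _ sd] := svalP (H c); split => //.
    by move=> q; have /andP[] := p01 q.
  by move=> q /sd[].
have p0 c q : 0 <= psi c q by have [_ p01 _ _] := svalP (H c); have /andP[] := p01 q.
move=> p; have [c /= cD pc] := cov p I.
rewrite (bigD1_seq c) //=.
by rewrite ltr_pwDl // sumr_ge0.
Qed.

(** The test function is split into the pieces [hc c], each supported in one chart, where the weak
    form is known; both sides are additive in the test function. *)
Lemma green f h : smooth_fun A f -> smooth_fun A h ->
  \int[mu]_p (h p * laplacian g f p) = - \int[mu]_p grad_inner g f h p.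
Proof.
move=> sf sh; have [s [psi [Hpsi pos]]] := covering_bumps.
pose Psi p := \sum_(c <- s) psi c p.
have sPsi : smooth_fun A Psi by apply: smooth_fun_sum => c; have [] := Hpsi c.
have sV : smooth_fun A (fun p => (Psi p)^-1).
  by apply: smooth_funV => // p; rewrite gt_eqF // pos.
pose hc c p := psi c p * (h p * (Psi p)^-1).
have shc c : smooth_fun A (hc c).
  by apply: smooth_funM; [have [] := Hpsi c|exact: smooth_funM].
have hE : h = fun p => \sum_(c <- s) hc c p.
  apply/funext => p; rewrite /hc -mulr_suml mulrCA -/(Psi p) mulfV ?mulr1 //.
  by rewrite gt_eqF // pos.
have key c : \int[mu]_p (hc c p * laplacian g f p) = - \int[mu]_p grad_inner g f (hc c) p.
  have [_ _ sd] := Hpsi c.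
  have sd' : supp (hc c) `<=` dom (chart_at A c).
    by apply: subset_trans sd; apply: supp_sub => q; rewrite /hc => ->; rewrite mul0r.
  rewrite -(weak_chart_lap sf (shc c) sd'); congr (Rintegral _ _ _); apply/funext => p.
  have [dp|ndp] := pselect (dom (chart_at A c) p); first by rewrite (@laplacian_chart (chart_at A c)).
  by rewrite (@notin_supp _ _ (hc c) p) ?mul0r // => /sd'.
have cl : continuous (laplacian g f) by apply: smooth_fun_continuous; exact: smooth_fun_laplacian.
(* Stated for every list because the induction passes through partial sums, while only the sum over
   [s] equals [h]. *)
have main (t : seq M) : \int[mu]_p ((\sum_(c <- t) hc c p) * laplacian g f p) =
   - \int[mu]_p grad_inner g f (fun p => \sum_(c <- t) hc c p) p.
  elim: t => [|c t IH].
    have -> : (fun p => (\sum_(c <- [::]) hc c p) * laplacian g f p) = fun=> 0.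
      by apply/funext => p; rewrite big_nil mul0r.
    have -> : grad_inner g f (fun p => \sum_(c <- [::]) hc c p) = fun=> 0.
      apply/funext => p; rewrite (_ : (fun p => _) = fun=> 0) ?grad_inner0 //.
      by apply/funext => q; rewrite big_nil.
    by rewrite (cint_cst mu_total) oppr0.
  have st : smooth_fun A (fun p => \sum_(c <- t) hc c p) by exact: smooth_fun_sum.
  have -> : (fun p => (\sum_(c <- c :: t) hc c p) * laplacian g f p) =
     fun p => hc c p * laplacian g f p + (\sum_(c <- t) hc c p) * laplacian g f p.
    by apply/funext => p; rewrite big_cons mulrDl.
  have -> : grad_inner g f (fun p => \sum_(c <- c :: t) hc c p) =
     fun p => grad_inner g f (hc c) p + grad_inner g f (fun p => \sum_(c <- t) hc c p) p.
    apply/funext => p; rewrite -grad_innerDr //; congr (grad_inner _ _ _ _).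
    by apply/funext => q; rewrite big_cons.
  have cM u : smooth_fun A u -> continuous (fun p => u p * laplacian g f p).
    by move=> su; apply: smooth_fun_continuous; apply: smooth_funM => //; exact: smooth_fun_laplacian.
  have cI u : smooth_fun A u -> continuous (grad_inner g f u).
    by move=> su; apply: smooth_fun_continuous; exact: smooth_fun_grad_inner.
  rewrite !(cintD M_compact mu_total) ?opprD ?key ?IH //; [exact: cM|exact: cM|exact: cI|exact: cI].
by rewrite {1 2}hE; exact: main.
Qed.

End weak_laplacian.

(** * Commuting parameter derivatives with the gradient *)

Section parameter_derivatives.
Context {R : realType} {n : nat} {M : ptopologicalType} (A : oriented_atlas R n M).
Variable g : riemannian_metric A.
Context {P : normedModType R}.
Variable W : set P.
Hypothesis Wo : open W.
Notation img i := (coord i @` dom i).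
Implicit Types F G : P -> M -> R.

Lemma family_at F p : smooth_family A W F -> smooth_on W (F ^~ p).
Proof.
move=> sF k; set i := chart_at A p; have dp : dom i p := dom_chart_at A p.
have E : (F ^~ p) = (fun z : P * 'rV[R]_n => F z.1 (param i z.2)) \o (fun w => (w, coord i p)).
  by apply/funext => w /=; rewrite coordK.
rewrite E; apply: (@Ck_affine _ _ _ _ _ (W `*` img i) W _ _ (fun v => (v, 0))).
- by move=> w; apply: (@continuous_pair _ _ _ id (fun=> coord i p)); [exact: cvg_id|exact: cst_continuous].
- by move=> w v h; rewrite -pairZD scaler0 add0r.
- by move=> w Ww; split => //=; exact: img_coord.
- exact: sF.
Qed.

(** Symmetry of second derivatives on the product space, for the directions [(v, 0)] and
    [(0, delta_mx 0 l)]. *)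
Lemma derive_partial F (i : index A) l w v x : smooth_family A W F -> W w -> img i x ->
  is_derive w v (fun w => partial (F w \o param i) l x)
    (partial ((fun q => 'D_v (F ^~ q) w) \o param i) l x).
Proof.
move=> sF Ww ix; pose U z := F z.1 (param i z.2) : R.
have CU k : Ck k (W `*` img i) U by exact: sF.
have Xo := @openX_img _ _ _ A _ W i Wo.
have wx : (W `*` img i) (w, x) by [].
have sD := family_derive v sF.
have E1 : (fun w => partial (F w \o param i) l x) = ('D_(0, delta_mx 0 l) U) \o (fun w => (w, x)).
  by apply/funext => w'; rewrite /= -partial_slice.
have E2 : (fun z : P * 'rV[R]_n => 'D_v (F ^~ (param i z.2)) z.1) = 'D_(v, 0) U.
  apply/funext => -[w' y] /=.
  apply: (@derive_affine R (P * 'rV[R]_n)%type P R U (fun w => (w, y)) (fun v => (v, 0)) w' v).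
  by move=> w'' v' h; rewrite -pairZD scaler0 add0r.
have E3 : partial ((fun q => 'D_v (F ^~ q) w) \o param i) l x = 'D_(0, delta_mx 0 l) ('D_(v, 0) U) (w, x).
  by rewrite -E2 -partial_slice.
rewrite E3 (deriveC _ _ Xo wx (CU 2)).
have D1 : derivable ('D_(0, delta_mx 0 l) U) (w, x) (v, 0) by exact: (((CU 2).2 _).2.2 (v, 0)).1.
rewrite E1; have AL w'' v' h : (h *: v' + w'', x) = h *: (v', 0) + (w'', x) :> P * 'rV[R]_n.
  by rewrite -pairZD scaler0 add0r.
split; last exact: (@derive_affine R (P * 'rV[R]_n)%type P R _ (fun w => (w, x)) (fun v => (v, 0)) w v).
move: D1; rewrite /derivable; set f1 := (fun h : R => _); set f2 := (fun h : R => _).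
suff -> : f1 = f2 by [].
by apply/funext => h; rewrite /f1 /f2 /= AL.
Qed.

Lemma is_derive_prod (f h : P -> R) w v df dh : is_derive w v f df -> is_derive w v h dh ->
  is_derive w v (fun w => f w * h w) (df * h w + f w * dh).
Proof.
move=> [f1 <-] [h1 <-]; split; first exact: (derivableM f1 h1).
rewrite [LHS](deriveM f1 h1) addrC; congr (_ + _); exact: mulrC.
Qed.

Lemma is_derive_bigsum (I : Type) (r : seq I) (f df : I -> P -> R) w v :
  (forall i, is_derive w v (f i) (df i w)) ->
  is_derive w v (fun w => \sum_(i <- r) f i w) (\sum_(i <- r) df i w).
Proof.
move=> H; elim: r => [|i r IH].
  under eq_fun do rewrite big_nil; rewrite big_nil; exact: is_derive_cst.
under eq_fun do rewrite big_cons; rewrite big_cons.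
exact: is_deriveD.
Qed.

(** At a fixed point the metric coefficients are constant in the parameter, so only the two
    differentials contribute to the product rule. *)
Lemma derive_grad_inner F G w v p : smooth_family A W F -> smooth_family A W G -> W w ->
  'D_v (fun w => grad_inner g (F w) (G w) p) w =
  grad_inner g (fun q => 'D_v (F ^~ q) w) (G w) p + grad_inner g (F w) (fun q => 'D_v (G ^~ q) w) p.
Proof.
move=> sF sG Ww; rewrite /grad_inner /local_inner; set i := chart_at A p; set x := coord i p.
have ix : img i x by apply: img_coord; exact: dom_chart_at.
rewrite -big_split /=.
have H l : is_derive w v
   (fun w => local_grad g i (F w \o param i) x 0 l * partial (G w \o param i) l x)
   (local_grad g i ((fun q => 'D_v (F ^~ q) w) \o param i) x 0 l * partial (G w \o param i) l x
    + local_grad g i (F w \o param i) x 0 l * partial ((fun q => 'D_v (G ^~ q) w) \o param i) l x).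
  apply: is_derive_prod; last exact: derive_partial.
  under eq_fun do rewrite local_gradE; rewrite local_gradE.
  apply: (is_derive_bigsum _ (df := fun k w => partial ((fun q => 'D_v (F ^~ q) w) \o param i) k x * invmx (gmx g i x) k l)) => k.
  have := is_derive_prod (derive_partial k v sF Ww ix) (is_derive_cst (invmx (gmx g i x) k l) w v).
  by rewrite mulr0 addr0.
have [_ <-] := is_derive_bigsum (index_enum _) (df := fun l w =>
   local_grad g i ((fun q => 'D_v (F ^~ q) w) \o param i) x 0 l * partial (G w \o param i) l x
    + local_grad g i (F w \o param i) x 0 l * partial ((fun q => 'D_v (G ^~ q) w) \o param i) l x) H.
by [].
Qed.

End parameter_derivatives.

(** * Gradient and Laplacian of a square *)

Section square.
Context {R : realType} {n : nat} {M : ptopologicalType} (A : oriented_atlas R n M).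
Variable g : riemannian_metric A.
Notation img i := (coord i @` dom i).
Implicit Types f h : M -> R.

Lemma partial_square (i : index A) f x l : smooth_fun A f -> img i x ->
  partial ((fun p => f p ^+ 2) \o param i) l x = 2 * f (param i x) * partial (f \o param i) l x.
Proof.
move=> sf ix; have d : derivable (f \o param i) x (delta_mx 0 l) by apply: ((sf i 1%N).2 _).1.
rewrite /partial [LHS](_ : _ = 'D_(delta_mx 0 l) (fun y => (f \o param i) y * (f \o param i) y) x) //.
rewrite [LHS](deriveM d d); set D := 'D_ _ _ _.
by rewrite -[_ *: _]/(f (param i x) * D) -mulrDl -mulr2n mulr_natl.
Qed.

Lemma grad_inner_square f p : smooth_fun A f ->
  grad_normsq g (fun q => f q ^+ 2) p = 4 * f p ^+ 2 * grad_normsq g f p.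
Proof.
move=> sf; rewrite !grad_normsqE /grad_inner /local_inner.
set i := chart_at A p; have dp : dom i p := dom_chart_at A p.
have ix : img i (coord i p) by exact: img_coord.
rewrite mulr_sumr; apply: eq_bigr => l _; rewrite partial_square // coordK //.
have -> : local_grad g i ((fun q => f q ^+ 2) \o param i) (coord i p) 0 l =
   2 * f p * local_grad g i (f \o param i) (coord i p) 0 l.
  rewrite !local_gradE mulr_sumr; apply: eq_bigr => k _.
  by rewrite partial_square // coordK // mulrA.
ring.
Qed.

Lemma laplacian_square f p : smooth_fun A f ->
  laplacian g (fun q => f q ^+ 2) p = 2 * f p * laplacian g f p + 2 * grad_normsq g f p.
Proof.
move=> sf; rewrite grad_normsqE /laplacian /grad_inner.
set i := chart_at A p; have dp : dom i p := dom_chart_at A p.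
set x := coord i p; have ix : img i x by exact: img_coord.
have s0 : sqrtdetg g i x != 0 by rewrite gt_eqF // sqrtdetg_gt0.
(* The gradient of f^2 is psi grad f with psi = 2 f, which puts the Laplacian of f^2 in the form
   treated by [local_div_product]. *)
pose psi y := 2 * (f \o param i) y.
have Cpsi : Ck 1 (img i) psi.
  apply: CkM; [exact: open_image|exact: Ck_cst|exact: (sf i 1%N)].
have CG l : Ck 1 (img i) (fun x => local_grad g i (f \o param i) x 0 l) by exact: Ck_local_grad.
have E := local_div_product ix Cpsi CG.
have -> : local_div g i (local_grad g i ((fun q => f q ^+ 2) \o param i)) x =
   (sqrtdetg g i x)^-1 * \sum_l partial (fun y => psi y * (sqrtdetg g i y * local_grad g i (f \o param i) y 0 l)) l x.
  congr (_ * _); apply: eq_bigr => l _; rewrite /partial; apply: near_eq_derive.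
  have : nbhs x (img i) by apply: open_nbhs_nbhs; split => //; exact: image_open.
  apply: filterS => y iy; rewrite mulrCA; congr (_ * _).
  rewrite !local_gradE mulr_sumr; apply: eq_bigr => k _.
  by rewrite partial_square // mulrA.
have alg (s a b : R) : s != 0 -> s^-1 * (a * s + b * s) = a + b by move=> sn; field.
rewrite -E (alg _ _ _ s0) /psi /= coordK // !mulrA; congr (_ + _).
rewrite /local_inner mulr_sumr; apply: eq_bigr => l _.
have d : derivable (f \o param i) x (delta_mx 0 l) by apply: ((sf i 1%N).2 _).1.
by rewrite /partial deriveMl // mulrCA.
Qed.

End square.

(** * First variation of the action *)

Lemma is_derive_sqr (R : realType) (V : normedModType R) (f : V -> R) w v df :
  is_derive w v f df -> is_derive w v (fun w => f w ^+ 2) (2 * (f w * df)).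
Proof.
move=> d; have H := is_derive_prod d d.
have -> : (fun w => f w ^+ 2) = (fun w => f w * f w) by apply/funext => z; rewrite expr2.
by have -> : 2 * (f w * df) = df * f w + f w * df; [ring|exact: H].
Qed.

Lemma is_derive_half_diff (R : realType) (V : normedModType R) (f h : V -> R) w v df dh :
  is_derive w v f df -> is_derive w v h dh ->
  is_derive w v (fun w => 2^-1 * f w - 2^-1 * h w) (2^-1 * df - 2^-1 * dh).
Proof.
move=> df' dh'; have i3 := is_derive_prod (is_derive_cst (2^-1 : R) w v) df'.
have i4 := is_derive_prod (is_derive_cst (2^-1 : R) w v) dh'.
by have := is_deriveB i3 i4; rewrite !mul0r !add0r.
Qed.

Lemma is_derive_slice1 (R : realType) (phi : R * R -> R) s t : derivable phi (s, t) (1, 0) ->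
  is_derive s (1 : R) (fun s => phi (s, t)) ('D_(1, 0) phi (s, t)).
Proof.
move=> d; have PE (h : R) : (h *: 1 + s, t) = h *: (1, 0) + (s, t) :> R * R.
  by rewrite -pairZD scaler0 add0r.
have E : (fun h : R => h^-1 *: (((fun s => phi (s, t)) \o shift s) (h *: 1) - phi (s, t)))
   = (fun h : R => h^-1 *: ((phi \o shift (s, t)) (h *: (1, 0)) - phi (s, t))).
  by apply/funext => h /=; rewrite PE.
by split; [move: d|]; rewrite /derivable /derive E.
Qed.

Section time_families.
Context {R : realType} {n : nat} {M : ptopologicalType} (A : oriented_atlas R n M).

Lemma dtE (q : R -> M -> R) t p : dt q t p = 'D_1 (q ^~ p) t.
Proof. by rewrite /dt derive1E. Qed.

Lemma family_dt (J : set R) (q : R -> M -> R) : smooth_family A J q -> smooth_family A J (dt q).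
Proof.
move=> sq; have := family_derive (1 : R) sq; congr (smooth_family A J _).
by apply/funext => t; apply/funext => p; rewrite dtE.
Qed.

Lemma dt_slice (C : R * R -> M -> R) s t p :
  dt (fun t => C (s, t)) t p = 'D_(0, 1) (C ^~ p) (s, t).
Proof.
rewrite dtE.
apply: (@derive_affine R (R * R)%type R R (C ^~ p) (fun t => (s, t)) (fun v => (0, v)) t 1).
by move=> t' v h; rewrite -pairZD scaler0 add0r.
Qed.

Lemma dt_slice1 (C : R * R -> M -> R) s t p :
  'D_1 (fun s => C (s, t) p) s = 'D_(1, 0) (C ^~ p) (s, t).
Proof.
apply: (@derive_affine R (R * R)%type R R (C ^~ p) (fun s => (s, t)) (fun v => (v, 0)) s 1).
by move=> t' v h; rewrite -pairZD scaler0 add0r.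
Qed.

Lemma family_slice2 (I J : set R) (C : R * R -> M -> R) s : I s -> smooth_family A (I `*` J) C ->
  smooth_family A J (fun t => C (s, t)).
Proof.
move=> Is sC; apply: (family_affine (B := fun t => (s, t)) (L := fun v => (0, v)) _ _ _ sC).
- by move=> t; apply: (@continuous_pair _ _ _ (fun=> s) id); [exact: cst_continuous|exact: cvg_id].
- by move=> t' v h; rewrite -pairZD scaler0 add0r.
- by move=> t Jt.
Qed.

Lemma within_continuous_segment (a b : R) (f : R -> R) :
  (forall t, a <= t <= b -> {for t, continuous f}) -> {within `[a, b], continuous f}.
Proof.
move=> cf; apply: continuous_in_subspaceT => t /set_mem /=; rewrite in_itv /=; exact: cf.
Qed.

Lemma segment_sub (a b : R) (J : set R) : `[a, b] `<=` J -> forall t, a <= t <= b -> J t.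
Proof. by move=> abJ t tab; apply: abJ; rewrite /= in_itv. Qed.

End time_families.

Section first_variation.
Context {R : realType} {n : nat} {M : ptopologicalType} (A : oriented_atlas R n M).
Variable g : riemannian_metric A.
Variable mu : {measure set (borel M) -> \bar R}.
Hypothesis M_compact : compact [set: M].
Hypothesis M_hausdorff : hausdorff_space M.
Hypothesis mu_volume : is_volume g mu.
Hypothesis mu_total : mu [set: M] = 1%E.
Variable J : set R.
Hypothesis J_open : open J.

(** The Lagrangian to which [newton] unfolds for [L2_metric] and [dirichlet]. *)
Definition kinetic_minus_dirichlet (q v : M -> R) : R := 2^-1 * L2_metric mu q v - dirichlet g mu q.

Definition wave_residual (q : R -> M -> R) (t : R) (p : M) : R :=
  dt (dt q) t p - laplacian g (q t) p.

Lemma family_wave_residual q : smooth_family A J q -> smooth_family A J (wave_residual q).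
Proof.
move=> sq; apply: familyB => //; first by do 2 apply: family_dt.
exact: (family_laplacian M_compact M_hausdorff mu_volume mu_total).
Qed.

Section variation.
Variables (a b e : R) (C : R * R -> M -> R).
Hypothesis ab : a < b.
Hypothesis abJ : `[a, b] `<=` J.
Hypothesis e0 : 0 < e.
Let W : set (R * R) := `]- e, e[ `*` J.
Hypothesis sC : smooth_family A W C.

Let Wo : open W. Proof. by apply: openX_prod => //; exact: interval_open. Qed.
Let I0 : `]- e, e[%classic (0 : R). Proof. by rewrite /= in_itv /= oppr_lt0 e0. Qed.
Let W0 t : J t -> W (0, t). Proof. by move=> Jt; split. Qed.

Let Ct (z : R * R) p : R := 'D_(0, 1) (C ^~ p) z.
Let Cs (z : R * R) p : R := 'D_(1, 0) (C ^~ p) z.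
Let q t := C (0, t).
Let zeta t := Cs (0, t).

Let sCt : smooth_family A W Ct. Proof. exact: family_derive. Qed.
Let sCs : smooth_family A W Cs. Proof. exact: family_derive. Qed.
Let sq : smooth_family A J q. Proof. exact: family_slice2 I0 sC. Qed.
Let szeta : smooth_family A J zeta. Proof. exact: family_slice2 I0 sCs. Qed.

Let ell (z : R * R) : R := 2^-1 * \int[mu]_p (Ct z p ^+ 2) - 2^-1 * \int[mu]_p grad_inner g (C z) (C z) p.

Let lag_ell s t : kinetic_minus_dirichlet (C (s, t)) (dt (fun t => C (s, t)) t) = ell (s, t).
Proof.
rewrite /kinetic_minus_dirichlet /L2_metric /dirichlet /ell.
have -> : (fun p => dt (fun t => C (s, t)) t p ^+ 2) = (fun p => Ct (s, t) p ^+ 2).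
  by apply/funext => p; rewrite dt_slice.
have -> : grad_normsq g (C (s, t)) = grad_inner g (C (s, t)) (C (s, t)).
  by apply/funext => p; exact: grad_normsqE.
by [].
Qed.

Let sG : smooth_family A W (fun z p => grad_inner g (C z) (C z) p).
Proof. exact: family_grad_inner. Qed.

Let ell_smooth : smooth_on W ell.
Proof.
move=> k; apply: CkB => //; apply: CkM => //; try exact: Ck_cst.
  by apply: (integral_family_smooth M_compact mu_total Wo); exact: familyX2.
exact: (integral_family_smooth M_compact mu_total Wo).
Qed.

(** The boundary term of the integration by parts in time; [dm] is its derivative and [r] pairs the
    residual with the variation field. *)
Let m (t : R) : R := \int[mu]_p (dt q t p * zeta t p).
Let dm (t : R) : R := \int[mu]_p 'D_1 (fun t => dt q t p * zeta t p) t.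
Let r (t : R) : R := \int[mu]_p (wave_residual q t p * zeta t p).

Let s1 : smooth_family A J (fun t p => dt q t p * zeta t p).
Proof. by apply: familyM => //; exact: family_dt. Qed.

Let s2 : smooth_family A J (fun t p => wave_residual q t p * zeta t p).
Proof. by apply: familyM => //; exact: family_wave_residual. Qed.

(** The derivative in [s] is \int q' zeta' - \int g(grad q, grad zeta). The first term is rewritten
    by the product rule in time as [dm] minus \int q'' zeta, the second by Green's formula. *)
Let ell_derive t : J t -> 'D_(1, 0) ell (0, t) = (-1) * r t + dm t.
Proof.
move=> Jt; have Wt := W0 Jt.
have cont (F : R -> M -> R) : smooth_family A J F -> continuous (F t).
  by move=> sF; exact: family_continuous_slice sF Jt.
have i1 := integral_family_is_derive M_compact mu_total Wo (1, 0) (familyX2 Wo sCt) Wt.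
have i2 := integral_family_is_derive M_compact mu_total Wo (1, 0) sG Wt.
have CtE p : Ct (0, t) p = dt q t p by exact/esym/dt_slice.
(* Mixed derivatives in [(s, t)] commute: the variation of the velocity is the velocity of the
   variation field. *)
have CtsE p : 'D_(1, 0) (Ct ^~ p) (0, t) = dt zeta t p.
  rewrite dt_slice /Ct /Cs; apply: (deriveC _ _ Wo Wt); exact: (family_at p sC).
have E1 : \int[mu]_p 'D_(1, 0) (fun z => Ct z p ^+ 2) (0, t) = 2 * \int[mu]_p (dt q t p * dt zeta t p).
  rewrite -(cintZ M_compact mu_total); last by apply: (cont (fun t p => dt q t p * dt zeta t p)); apply: familyM => //; exact: family_dt.
  congr (Rintegral _ _ _); apply/funext => p.
  have d := @family_is_derive R n M A (R * R)%type W Ct (0, t) (1, 0) p sCt Wt.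
  by have [_ ->] := is_derive_sqr d; rewrite CtsE CtE.
have E2 : \int[mu]_p 'D_(1, 0) (fun z => grad_inner g (C z) (C z) p) (0, t) = 2 * \int[mu]_p grad_inner g (q t) (zeta t) p.
  rewrite -(cintZ M_compact mu_total); last by apply: (cont (fun t p => grad_inner g (q t) (zeta t) p)); exact: family_grad_inner.
  congr (Rintegral _ _ _); apply/funext => p.
  by rewrite (derive_grad_inner g Wo) // grad_innerC -/(zeta t) mulr2n mulrDl !mul1r.
have [_ ->] := is_derive_half_diff i1 i2.
rewrite E1 E2 !mulrA mulVf // !mul1r.
have sqt : smooth_fun A (q t) by exact: family_slice sq Jt.
have szt : smooth_fun A (zeta t) by exact: family_slice szeta Jt.
rewrite -[X in _ - X]opprK -(green M_compact M_hausdorff mu_volume mu_total sqt szt) opprK.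
have -> : dm t = \int[mu]_p (dt (dt q) t p * zeta t p) + \int[mu]_p (dt q t p * dt zeta t p).
  rewrite -(cintD M_compact mu_total).
  - congr (Rintegral _ _ _); apply/funext => p.
    have [_ ->] := is_derive_prod (family_is_derive (1 : R) p (family_dt sq) Jt) (family_is_derive (1 : R) p szeta Jt).
    by rewrite -!dtE.
  - by apply: (cont (fun t p => dt (dt q) t p * zeta t p)); apply: familyM => //; do 2 apply: family_dt.
  - by apply: (cont (fun t p => dt q t p * dt zeta t p)); apply: familyM => //; exact: family_dt.
have -> : r t = \int[mu]_p (dt (dt q) t p * zeta t p) - \int[mu]_p (zeta t p * laplacian g (q t) p).
  rewrite -(cintB M_compact mu_total).
  - by congr (Rintegral _ _ _); apply/funext => p; rewrite /wave_residual mulrBl; congr (_ - _); rewrite mulrC.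
  - by apply: (cont (fun t p => dt (dt q) t p * zeta t p)); apply: familyM => //; do 2 apply: family_dt.
  - apply: (cont (fun t p => zeta t p * laplacian g (q t) p)); apply: familyM => //.
    exact: (family_laplacian M_compact M_hausdorff mu_volume mu_total).
have alg (x y z : R) : x + z = -1 * (y - z) + (y + x) by ring.
exact: alg.
Qed.

Hypothesis zeta_a : forall p, 'D_(1, 0) (C ^~ p) (0, a) = 0.
Hypothesis zeta_b : forall p, 'D_(1, 0) (C ^~ p) (0, b) = 0.

(** [C] is an arbitrary smooth family: the constraint does not enter here, and the boundary term
    drops because the variation field vanishes at both ends. *)
Lemma first_variation :
  is_derive (0 : R) (1 : R) (fun s => action kinetic_minus_dirichlet a b (fun t => C (s, t)))
    (- \int[@lebesgue_measure R]_(t in `[a, b])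
         \int[mu]_p (wave_residual (fun t => C (0, t)) t p * 'D_(1, 0) (C ^~ p) (0, t))).
Proof.
have Jab := segment_sub abJ.
have actE : (fun s => action kinetic_minus_dirichlet a b (fun t => C (s, t))) =
    fun s => \int[@lebesgue_measure R]_(t in `[a, b]) ell (s, t).
  by apply/funext => s; congr (Rintegral _ _ _); apply/funext => t; rewrite lag_ell.
have cW s t : `|s| < e -> a <= t <= b -> W (s, t).
  by move=> se tab; split; [rewrite /= in_itv /= -ltr_norml|exact: Jab].
have d_int : is_derive (0 : R) (1 : R) (fun s => \int[@lebesgue_measure R]_(t in `[a, b]) ell (s, t))
    (\int[@lebesgue_measure R]_(t in `[a, b]) 'D_(1, 0) ell (0, t)).
  apply: (functional_derive (@segment_compact _ a b) (@within_continuous_lin R `[a, b]%classic)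
     (@segment_integral_lin R a b) (fun f c cf => segment_integral_bound (ltW ab) cf)
     (F := fun s t => ell (s, t)) (dF := fun s t => 'D_(1, 0) ell (s, t)) e0).
  - move=> t /=; rewrite in_itv /= => tab.
    have -> : (fun z : R * R => 'D_(1, 0) ell (z.1, z.2)) = 'D_(1, 0) ell by apply/funext => -[].
    by apply: ((ell_smooth 1%N).2 _).2.1; apply: cW => //; rewrite normr0.
  - move=> s t se /=; rewrite in_itv /= => tab.
    have d1 : derivable ell (s, t) (1, 0) by apply: ((ell_smooth 1%N).2 _).1; exact: cW.
    exact: is_derive_slice1.
  - move=> s se; apply: within_continuous_segment => t tab.
    apply: (@continuous_comp _ _ _ (fun t => (s, t)) ell).
      by apply: (@continuous_pair _ _ _ (fun=> s) id); [exact: cst_continuous|exact: cvg_id].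
    by apply: (ell_smooth 0%N).1; exact: cW.
  - apply: within_continuous_segment => t tab.
    apply: (@continuous_comp _ _ _ (fun t => (0, t)) ('D_(1, 0) ell)).
      by apply: (@continuous_pair _ _ _ (fun=> 0) id); [exact: cst_continuous|exact: cvg_id].
    by apply: ((ell_smooth 1%N).2 _).2.1; apply: cW => //; rewrite normr0.
rewrite actE.
have E : \int[@lebesgue_measure R]_(t in `[a, b]) 'D_(1, 0) ell (0, t) =
    - \int[@lebesgue_measure R]_(t in `[a, b]) r t.
  have -> : \int[@lebesgue_measure R]_(t in `[a, b]) 'D_(1, 0) ell (0, t) =
     \int[@lebesgue_measure R]_(t in `[a, b]) ((-1) * r t + dm t).
    apply: eq_Rintegral => t /set_mem /=; rewrite in_itv /= => tab.
    by rewrite ell_derive //; exact: Jab.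
  have cr : {within `[a, b], continuous r}.
    apply: within_continuous_segment => t tab.
    exact: (integral_family_continuous M_compact mu_total J_open s2 (Jab _ tab)).
  have cm : {within `[a, b], continuous dm}.
    apply: within_continuous_segment => t tab.
    exact: (integral_family_continuous M_compact mu_total J_open (family_derive (1 : R) s1) (Jab _ tab)).
  have Hm t : a <= t <= b -> is_derive t (1 : R) m (dm t).
    move=> tab.
    exact: (integral_family_is_derive M_compact mu_total J_open (1 : R) s1 (Jab _ tab)).
  rewrite segment_integral_lin // mulN1r (segment_integral_derive ab cm Hm).
  have -> : m b = 0.
    rewrite /m (_ : (fun p => _) = fun=> 0) ?(cint_cst mu_total) //.
    by apply/funext => p; rewrite /zeta /Cs zeta_b mulr0.
  have -> : m a = 0; last by rewrite subrr addr0.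
  rewrite /m (_ : (fun p => _) = fun=> 0) ?(cint_cst mu_total) //.
  by apply/funext => p; rewrite /zeta /Cs zeta_a mulr0.
by have := d_int; rewrite E.
Qed.

End variation.
End first_variation.

(** * The Neumann problem on the sphere *)

Section time_congruence.
Context {R : realType} {n : nat} {M : ptopologicalType} (A : oriented_atlas R n M).
Variable g : riemannian_metric A.
Variable J : set R.
Hypothesis J_open : open J.

Lemma dt_congr (q q' : R -> M -> R) : (forall t, J t -> q t = q' t) -> forall t, J t -> dt q t = dt q' t.
Proof.
move=> qq t Jt; apply/funext => p; rewrite !dtE; apply: near_eq_derive.
have : nbhs t J by exact: open_nbhs_nbhs.
by apply: filterS => s /qq ->.
Qed.

Lemma wave_residual_congr (q q' : R -> M -> R) : (forall t, J t -> q t = q' t) ->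
  forall t, J t -> wave_residual g q t = wave_residual g q' t.
Proof.
move=> qq t Jt; apply/funext => p; have E := dt_congr (dt_congr qq) Jt.
by rewrite /wave_residual E (qq t Jt).
Qed.

End time_congruence.

Section unit_sphere.
Context {R : realType} {n : nat} {M : ptopologicalType} (A : oriented_atlas R n M).
Variable g : riemannian_metric A.
Variable mu : {measure set (borel M) -> \bar R}.
Hypothesis M_compact : compact [set: M].
Hypothesis M_hausdorff : hausdorff_space M.
Hypothesis mu_volume : is_volume g mu.
Hypothesis mu_total : mu [set: M] = 1%E.
Variable J : set R.
Hypothesis J_open : open J.

Lemma neumann_newton f : curve_in A (Sphere A mu) J f ->
  (exists lambda' : R -> R, forall t p, J t -> wave_residual g f t p = - lambda' t * f t p) ->
  newton A (Sphere A mu) (L2_metric mu) (dirichlet g mu) J f.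
Proof.
move=> cf [lam fE]; split => // a b e c ab abJ e0 sc Qc c0 cab.
have Jab := segment_sub abJ.
pose C (z : R * R) := c z.1 z.2.
pose W : set (R * R) := `]- e, e[ `*` J.
have Wo : open W by apply: openX_prod => //; exact: interval_open.
have sC : smooth_family A W C by exact: sc.
have near_e : \forall s \near (0 : R), s \in `]- e, e[.
  by apply: near_in_itvoo; rewrite in_itv /= oppr_lt0 e0.
have W0 t : J t -> W (0, t) by move=> Jt; split; rewrite //= in_itv /= oppr_lt0 e0.
have zeta0 t p : (forall s, s \in `]- e, e[ -> c s t = f t) -> 'D_(1, 0) (C ^~ p) (0, t) = 0.
  move=> ct; rewrite -dt_slice1 (@near_eq_derive _ _ _ _ (cst (f t p))) ?derive_cst //.
  by apply: filterS near_e => s es; rewrite /C /= ct.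
have cfz t : J t -> continuous (fun p => f t p * 'D_(1, 0) (C ^~ p) (0, t)).
  move=> Jt; rewrite -c0 //.
  apply: (family_continuous_slice (W := W) (F := fun z p => C z p * 'D_(1, 0) (C ^~ p) z)) (W0 t Jt).
  exact: (familyM Wo sC (family_derive ((1, 0) : R * R) sC)).
(* The constraint is differentiated under the integral: the squared norm is constantly 1 for [s]
   near 0. *)
have ortho t : J t -> \int[mu]_p (f t p * 'D_(1, 0) (C ^~ p) (0, t)) = 0.
  move=> Jt; have Wt := W0 t Jt.
  have [_ D] := integral_family_is_derive M_compact mu_total Wo (1, 0) (familyX2 Wo sC) Wt.
  have E : \int[mu]_p 'D_(1, 0) (fun z => C z p ^+ 2) (0, t) = 2 * \int[mu]_p (f t p * 'D_(1, 0) (C ^~ p) (0, t)).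
    rewrite -(cintZ M_compact mu_total); last exact: cfz.
    congr (Rintegral _ _ _); apply/funext => p.
    have d := @family_is_derive R n M A (R * R)%type W C (0, t) (1, 0) p sC Wt.
    by have [_ ->] := is_derive_sqr d; rewrite /C /= c0.
  rewrite E in D.
  have D0 : 'D_(1, 0) (fun z => \int[mu]_p C z p ^+ 2) (0, t) = 0.
    have -> : 'D_(1, 0) (fun z => \int[mu]_p C z p ^+ 2) (0, t) = 'D_1 (fun s => \int[mu]_p C (s, t) p ^+ 2) (0 : R).
      by have := dt_slice1 (fun z (_ : M) => \int[mu]_p C z p ^+ 2) 0 t point => ->.
    rewrite (@near_eq_derive _ _ _ _ (cst (1 : R))) ?derive_cst //.
    by apply: filterS near_e => s es; have [] := Qc s t es Jt.
  by apply/eqP; have /eqP := D; rewrite D0 eq_sym mulf_eq0 pnatr_eq0 /=.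
have main := first_variation M_compact M_hausdorff mu_volume mu_total J_open ab abJ e0 sC
  (fun p => zeta0 a p (fun s es => (cab s es).1)) (fun p => zeta0 b p (fun s es => (cab s es).2)).
have Z : \int[@lebesgue_measure R]_(t in `[a, b])
   \int[mu]_p (wave_residual g (fun t => C (0, t)) t p * 'D_(1, 0) (C ^~ p) (0, t)) = 0.
  have -> : \int[@lebesgue_measure R]_(t in `[a, b])
     \int[mu]_p (wave_residual g (fun t => C (0, t)) t p * 'D_(1, 0) (C ^~ p) (0, t)) =
     \int[@lebesgue_measure R]_(t in `[a, b]) 0.
    apply: eq_Rintegral => t /set_mem /=; rewrite in_itv /= => tab.
    have Jt := Jab t tab.
    have -> : (fun p => wave_residual g (fun t => C (0, t)) t p * 'D_(1, 0) (C ^~ p) (0, t)) =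
       fun p => - lam t * (f t p * 'D_(1, 0) (C ^~ p) (0, t)).
      apply/funext => p; rewrite (@wave_residual_congr _ _ _ _ g J J_open (fun t => C (0, t)) f) //.
      by rewrite fE // mulrA.
    by rewrite (cintZ M_compact mu_total) ?ortho ?mulr0 //; exact: cfz.
  by rewrite segment_integral_cst ?mulr0 // ltW.
by rewrite Z oppr0 in main.
Qed.

(** * Normalized variations on the sphere *)

Section normalized_variation.
Variables (f eta : R -> M -> R).
Hypothesis cf : curve_in A (Sphere A mu) J f.
Hypothesis seta : smooth_family A J eta.
Hypothesis eta1 : forall t, J t -> \int[mu]_p (eta t p ^+ 2) <= 1.

Definition sphere_shift (z : R * R) (p : M) : R := f z.2 p + z.1 * eta z.2 p.
Definition shift_normsq (z : R * R) : R := \int[mu]_p (sphere_shift z p ^+ 2).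
Definition sphere_variation (z : R * R) (p : M) : R := sphere_shift z p / Num.sqrt (shift_normsq z).

(** For |s| at most 1/4 the bound 1 - 2 |s| on the squared norm is at least 1/2, so the
    normalization never divides by zero. *)
Let e : R := 4^-1.
Let W : set (R * R) := `]- e, e[ `*` J.
Let Wo : open W. Proof. by apply: openX_prod => //; exact: interval_open. Qed.
Let sf : smooth_family A J f. Proof. exact: cf.1. Qed.

Let contJ (F : R -> M -> R) t : smooth_family A J F -> J t -> continuous (F t).
Proof. by move=> sF Jt; exact: family_continuous_slice sF Jt. Qed.

Let fnorm t : J t -> \int[mu]_p (f t p ^+ 2) = 1.
Proof. by move=> Jt; have [] := cf.2 t Jt. Qed.

Lemma shift_normsqE s t : J t -> shift_normsq (s, t) =
  1 + s * (2 * \int[mu]_p (f t p * eta t p)) + s ^+ 2 * \int[mu]_p (eta t p ^+ 2).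
Proof.
move=> Jt; rewrite /shift_normsq /sphere_shift /=.
have c1 : continuous (fun p => f t p ^+ 2) by apply: (contJ (F := fun t p => f t p ^+ 2)) => //; exact: familyX2.
have c2 : continuous (fun p => f t p * eta t p) by apply: (contJ (F := fun t p => f t p * eta t p)) => //; exact: familyM.
have c3 : continuous (fun p => eta t p ^+ 2) by apply: (contJ (F := fun t p => eta t p ^+ 2)) => //; exact: familyX2.
have -> : (fun p => (f t p + s * eta t p) ^+ 2) =
   fun p => (s * 2) * (f t p * eta t p) + (s ^+ 2 * (eta t p ^+ 2) + f t p ^+ 2).
  by apply/funext => p; ring.
rewrite (cint_lin M_compact mu_total) ?(cint_lin M_compact mu_total) ?fnorm //; last exact: continuous_lin.
have alg (x X Y : R) : x * 2 * X + (x ^+ 2 * Y + 1) = 1 + x * (2 * X) + x ^+ 2 * Y by ring.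
exact: alg.
Qed.

(* By Cauchy-Schwarz the norm squared is at least 1 - 2 |s|. *)
Lemma shift_normsq_ge s t : `|s| <= 4^-1 -> J t -> 2^-1 <= shift_normsq (s, t).
Proof.
move=> se Jt; rewrite shift_normsqE //.
set al := \int[mu]_p (f t p * eta t p); set be := \int[mu]_p (eta t p ^+ 2).
have be0 : 0 <= be by apply: Rintegral_ge0 => p _; exact: sqr_ge0.
have al1 : `|al| <= 1.
  have c1 : continuous (fun p => f t p ^+ 2) by apply: (contJ (F := fun t p => f t p ^+ 2)) => //; exact: familyX2.
  have c2 : continuous (fun p => f t p * eta t p) by apply: (contJ (F := fun t p => f t p * eta t p)) => //; exact: familyM.
  have c3 : continuous (fun p => eta t p ^+ 2) by apply: (contJ (F := fun t p => eta t p ^+ 2)) => //; exact: familyX2.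
  have cZ (k : R) : continuous (fun p => k * (f t p * eta t p)).
    by move=> p; apply: (@continuousM _ _ (fun=> k) (fun p => f t p * eta t p)); [exact: cst_continuous|exact: c2].
  (* Cauchy-Schwarz for two functions of norm at most 1: integrate the square of f - k eta, with k =
     1 and k = -1. *)
  have H (k : R) : `|k| = 1 -> k * (2 * al) <= 2.
    move=> k1; have kk : k ^+ 2 = 1 by rewrite -real_normK ?num_real // k1 expr1n.
    have -> : k * (2 * al) = \int[mu]_p ((k * 2) * (f t p * eta t p)) by rewrite (cintZ M_compact mu_total) // mulrA.
    have H2 : \int[mu]_p (1 * (f t p ^+ 2) + eta t p ^+ 2) <= 2.
      rewrite (cint_lin M_compact mu_total) // fnorm // mul1r.
      by have := eta1 Jt; rewrite -/be; lra.
    apply: le_trans H2; apply: cint_le => //; first exact: continuous_lin.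
    move=> p; have := sqr_ge0 (f t p - k * eta t p).
    by rewrite sqrrB exprMn kk; lra.
  rewrite ler_norml; have := H 1 (normr1 _); have := H (-1).
  by rewrite normrN normr1 => /(_ erefl); lra.
have := ler_norm (- (s * al)); rewrite normrN normrM => H1.
have H2 : `|s| * `|al| <= 4^-1 by rewrite -[leRHS]mulr1 ler_pM.
have H3 : 0 <= s ^+ 2 * be by rewrite mulr_ge0 ?sqr_ge0.
rewrite mulrCA; lra.
Qed.

Let N_gt0 z : W z -> 0 < shift_normsq z.
Proof.
case: z => s t [/= se Jt]; apply: lt_le_trans (shift_normsq_ge _ Jt) => //.
by move: se; rewrite in_itv /= -ltr_norml => /ltW.
Qed.

Let s_shift : smooth_family A W sphere_shift.
Proof.
have sp2 (F : R -> M -> R) : smooth_family A J F -> smooth_family A W (fun z => F z.2).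
  move=> sF; apply: (family_affine (B := snd) (L := snd) _ _ _ sF).
  - by move=> z; exact: cvg_snd.
  - by move=> [x y] [v w] h.
  - by move=> z [].
apply: familyD; [exact: Wo|exact: sp2|apply: familyM; [exact: Wo| |exact: sp2]].
apply: (family_par (h := fst)) => k; apply: (@Ck_affine _ _ _ _ _ setT W id fst fst).
- by move=> z; exact: cvg_fst.
- by move=> [x y] [v w] h.
- by [].
- exact: Ck_id.
Qed.

Lemma sphere_variation_smooth : smooth_family A W sphere_variation.
Proof.
apply: (familyM Wo s_shift); apply: (family_par (h := fun z => (Num.sqrt (shift_normsq z))^-1)) => k.
have CN : Ck k W shift_normsq.
  by apply: (integral_family_smooth M_compact mu_total Wo); exact: familyX2.
apply: CkV => //; last exact: Ck_sqrt.
by move=> z Wz; rewrite gt_eqF // sqrtr_gt0 N_gt0.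
Qed.

Lemma sphere_variation_sphere s t : s \in `]- 4^-1, 4^-1[ -> J t -> Sphere A mu (sphere_variation (s, t)).
Proof.
move=> se Jt; have Wst : W (s, t) by [].
split; first exact: family_slice sphere_variation_smooth Wst.
have N0 := N_gt0 Wst.
have -> : (fun p => sphere_variation (s, t) p ^+ 2) = fun p => (shift_normsq (s, t))^-1 * (sphere_shift (s, t) p ^+ 2).
  by apply/funext => p; rewrite /sphere_variation expr_div_n sqr_sqrtr ?(ltW N0) // mulrC.
rewrite (cintZ M_compact mu_total) -?/(shift_normsq _) ?mulVf ?gt_eqF //.
exact: (family_continuous_slice (familyX2 Wo s_shift) Wst).
Qed.

Lemma sphere_variation0 t : J t -> sphere_variation (0, t) = f t.
Proof.
move=> Jt; apply/funext => p; rewrite /sphere_variation shift_normsqE // /sphere_shift /=.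
by rewrite expr0n /= !mul0r !addr0 sqrtr1 divr1.
Qed.

Lemma sphere_variation_fixed s t : J t -> (forall p, eta t p = 0) -> sphere_variation (s, t) = f t.
Proof.
move=> Jt e0; apply/funext => p; rewrite /sphere_variation shift_normsqE // /sphere_shift /= e0.
rewrite (_ : (fun p => f t p * eta t p) = fun=> 0); last by apply/funext => q; rewrite e0 mulr0.
rewrite (_ : (fun p => eta t p ^+ 2) = fun=> 0); last by apply/funext => q; rewrite e0 expr0n.
by rewrite (cint_cst mu_total) !mulr0 !addr0 sqrtr1 divr1.
Qed.

Lemma is_derive_normalized (x y al be : R) :
  is_derive (0 : R) (1 : R) (fun s => (x + s * y) / Num.sqrt (1 + s * (2 * al) + s ^+ 2 * be)) (y - x * al).
Proof.
pose phi (s : R) := 1 + s * (2 * al) + s ^+ 2 * be.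
have did := is_derive_id (0 : R) (1 : R).
have dlin (k l : R) : is_derive (0 : R) (1 : R) (fun s => k + s * l) l.
  have := is_deriveD (is_derive_cst k (0 : R) (1 : R)) (is_derive_prod did (is_derive_cst l (0 : R) (1 : R))).
  by rewrite add0r mulr0 addr0 mul1r.
have dphi : is_derive (0 : R) (1 : R) phi (2 * al).
  have d2 := is_derive_prod (is_derive_sqr did) (is_derive_cst be (0 : R) (1 : R)).
  have := is_deriveD (dlin 1 (2 * al)) d2.
  by rewrite mul0r !mulr0 mul0r !addr0.
have phi0 : phi 0 = 1 by rewrite /phi expr0n /= !mul0r !addr0.
have [dp1 dp2] := dphi.
have [ds1 ds2] : is_derive (phi 0) (1 : R) Num.sqrt (2 * Num.sqrt (phi 0))^-1.
  by apply: is_derive1_sqrt; rewrite phi0.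
have [dq1 dq2] := is_derive_comp1 dp1 ds1.
rewrite derive1E ds2 dp2 phi0 sqrtr1 mulr1 mulrA mulVf // mul1r in dq2.
have q0 : (Num.sqrt \o phi) 0 = 1 by rewrite /= phi0 sqrtr1.
have dinv : is_derive (0 : R) (1 : R) (fun s => ((Num.sqrt \o phi) s)^-1) (- al).
  split; first by apply: derivableV => //; rewrite q0.
  rewrite deriveV // ?q0 // dq2 expr1n invr1.
  by rewrite -[_ *: _]/(_ * _) mulN1r.
have := is_derive_prod (dlin x y) dinv.
by rewrite q0 invr1 mulr1 mul0r addr0 mulrN.
Qed.

(** The velocity is the L^2-orthogonal projection of [eta t] onto the tangent space of the sphere at
    [f t]. *)
Lemma sphere_variation_derive t p : J t ->
  'D_(1, 0) (sphere_variation ^~ p) (0, t) = eta t p - f t p * \int[mu]_p (f t p * eta t p).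
Proof.
move=> Jt; rewrite -dt_slice1.
have -> : (fun s => sphere_variation (s, t) p) = fun s => (f t p + s * eta t p) /
   Num.sqrt (1 + s * (2 * \int[mu]_p (f t p * eta t p)) + s ^+ 2 * \int[mu]_p (eta t p ^+ 2)).
  by apply/funext => s; rewrite /sphere_variation shift_normsqE.
by have [] := is_derive_normalized (f t p) (eta t p) (\int[mu]_p (f t p * eta t p)) (\int[mu]_p (eta t p ^+ 2)).
Qed.

(** If the residual is a multiple of [f t], pairing it with [f t], of unit norm, identifies the
    coefficient as this integral. It is the opposite of [lambda']. *)
Definition multiplier (t : R) : R := \int[mu]_p (wave_residual g f t p * f t p).

(** The orthogonal projection is self-adjoint, so it is moved from [eta] to the residual; [eta] then
    becomes a free test function. *)
Lemma stationary_weak a b : a < b -> `[a, b] `<=` J ->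
  (forall p, eta a p = 0) -> (forall p, eta b p = 0) ->
  is_derive (0 : R) (1 : R) (fun s => action (kinetic_minus_dirichlet g mu) a b (fun t => sphere_variation (s, t))) 0 ->
  \int[@lebesgue_measure R]_(t in `[a, b])
    \int[mu]_p ((wave_residual g f t p - multiplier t * f t p) * eta t p) = 0.
Proof.
move=> ab abJ etaa etab [_ D].
have Jab := segment_sub abJ.
have e0 : 0 < e by rewrite invr_gt0.
have Ja : J a by apply: Jab; rewrite lexx ltW.
have Jb : J b by apply: Jab; rewrite lexx ltW.
have z0 t p : J t -> (forall p, eta t p = 0) -> 'D_(1, 0) (sphere_variation ^~ p) (0, t) = 0.
  move=> Jt et; rewrite sphere_variation_derive // et.
  rewrite (_ : (fun p => f t p * eta t p) = fun=> 0); last by apply/funext => q; rewrite et mulr0.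
  by rewrite (cint_cst mu_total) mulr0 subr0.
have [_ D'] := first_variation M_compact M_hausdorff mu_volume mu_total J_open ab abJ e0 sphere_variation_smooth
   (fun p => z0 a p Ja etaa) (fun p => z0 b p Jb etab).
rewrite D in D'; move/eqP: D'; rewrite eq_sym oppr_eq0 => /eqP D'.
rewrite -[RHS]D'; apply: eq_Rintegral => t /set_mem /=; rewrite in_itv /= => tab.
have Jt := Jab t tab.
have su : smooth_family A J (wave_residual g f) by exact: (family_wave_residual M_compact M_hausdorff mu_volume mu_total).
have c1 : continuous (fun p => wave_residual g f t p * eta t p).
  by apply: (contJ (F := fun t p => wave_residual g f t p * eta t p)) => //; exact: familyM.
have c2 : continuous (fun p => f t p * eta t p) by apply: (contJ (F := fun t p => f t p * eta t p)) => //; exact: familyM.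
have c3 : continuous (fun p => wave_residual g f t p * f t p).
  by apply: (contJ (F := fun t p => wave_residual g f t p * f t p)) => //; exact: familyM.
have -> : (fun p => (wave_residual g f t p - multiplier t * f t p) * eta t p) =
   fun p => (- multiplier t) * (f t p * eta t p) + wave_residual g f t p * eta t p.
  by apply/funext => p; ring.
rewrite (cint_lin M_compact mu_total) //.
have -> : (fun p => wave_residual g (fun t => sphere_variation (0, t)) t p * 'D_(1, 0) (sphere_variation ^~ p) (0, t)) =
   fun p => (- \int[mu]_p (f t p * eta t p)) * (wave_residual g f t p * f t p) + wave_residual g f t p * eta t p.
  apply/funext => p; rewrite sphere_variation_derive //.
  rewrite (@wave_residual_congr _ _ _ _ g J J_open (fun t => sphere_variation (0, t)) f) //; last first.
    by move=> s Js; exact: sphere_variation0.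
  move: (\int[mu]_p _) (wave_residual g f t p) => x y; ring.
by rewrite (cint_lin M_compact mu_total) // -/(multiplier t) !mulNr mulrC.
Qed.

End normalized_variation.
End unit_sphere.

(** * Localization in time *)

Section time_bump.
Context {R : realType}.
Notation lam := (@lebesgue_measure R).
Implicit Types a b t : R.

Definition tbump a b t : R := flat 0 ((t - a) * (b - t)).

Lemma tbump_ge0 a b t : 0 <= tbump a b t. Proof. exact: flat_ge0. Qed.
Lemma tbump_le1 a b t : tbump a b t <= 1. Proof. exact: flat_le1. Qed.

Lemma tbump_smooth a b : smooth_on [set: R] (tbump a b).
Proof.
move=> k; apply: (@Ck_comp _ _ _ _ setT (flat 0) (fun t => (t - a) * (b - t))) => //; [exact: openT..| |].
  by apply: Ck_flat; exact: openT.
apply: CkM; first exact: openT.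
  by apply: CkB; [exact: openT|exact: Ck_id|exact: Ck_cst].
by apply: CkB; [exact: openT|exact: Ck_cst|exact: Ck_id].
Qed.

Lemma tbump_continuous a b : continuous (tbump a b).
Proof. by move=> t; exact: Ck_continuous (tbump_smooth a b 0) _. Qed.

Lemma tbump_left a b : tbump a b a = 0.
Proof. by rewrite /tbump subrr mul0r flat_le0. Qed.

Lemma tbump_right a b : tbump a b b = 0.
Proof. by rewrite /tbump subrr mulr0 flat_le0. Qed.

Lemma tbump_out a b t : a < b -> ~~ (a <= t <= b) -> tbump a b t = 0.
Proof.
move=> ab; rewrite negb_and -!ltNge => /orP[ta|bt]; rewrite /tbump flat_le0 //.
  by rewrite mulr_le0_ge0 // ?subr_le0 ?subr_ge0 ltW //; exact: lt_trans ab.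
by rewrite mulr_ge0_le0 // ?subr_le0 ?subr_ge0 ltW //; exact: lt_trans bt.
Qed.

Lemma tbump_integral_gt0 a b : a < b -> 0 < \int[lam]_(t in `[a, b]) tbump a b t.
Proof.
move=> ab; rewrite Rintegral_mkcond (_ : _ \_ _ = tbump a b); last first.
  apply/funext => t; rewrite patchE; case: ifPn => //; rewrite notin_setE /= in_itv /= => /negP H.
  by rewrite tbump_out.
apply: (@Rintegral_pos _ _ (`|a| + `|b|) ((a + b) / 2)); [exact: tbump_continuous| |exact: tbump_ge0|].
  move=> t ht; apply: tbump_out => //; apply/negP => /andP[at_ tb].
  have : `|t| <= `|a| + `|b|.
    have := ler_norm (- a); have := ler_norm b; rewrite normrN.
    have := normr_ge0 a; have := normr_ge0 b.
    by rewrite ler_norml; move: at_ tb ab; move: `|a| `|b| => x y; lra.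
  by rewrite leNgt ht.
by apply: flat_gt0; rewrite mulr_gt0 //; lra.
Qed.

(** If [k t0] were nonzero, [k t0 * k t] would stay above [c], half of [k t0 ^+ 2], on a small
    segment around [t0]; its integral against the bump of that segment would be at least [c] times a
    positive number. *)
Lemma tbump_localize (J : set R) (k : R -> R) : open J -> (forall t, J t -> {for t, continuous k}) ->
  (forall a b, a < b -> `[a, b] `<=` J -> \int[lam]_(t in `[a, b]) (tbump a b t * k t) = 0) ->
  forall t, J t -> k t = 0.
Proof.
move=> Jo ck H t0 Jt0; apply/eqP; apply/negPn/negP => kt0.
have kk0 : 0 < k t0 * k t0 by rewrite -expr2 exprn_even_gt0.
pose c := k t0 * k t0 / 2; have c0 : 0 < c by rewrite divr_gt0.
have ckk : {for t0, continuous (fun t => k t0 * k t)}.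
  by apply: (@continuousM _ _ (fun=> k t0) k); [exact: cst_continuous|exact: ck].
have N : \forall t \near t0, J t /\ c <= k t0 * k t.
  near=> t; split; first by near: t; exact: open_nbhs_nbhs.
  have : `|k t0 * k t0 - k t0 * k t| <= c.
    by near: t; move/cvgrPdist_le : ckk => /(_ _ c0).
  by rewrite ler_norml /c; move: (k t0 * k t0) (k t0 * k t) => x y; lra.
have /nbhs_ballP[d /= d0 D] := N.
pose a := t0 - d / 2; pose b := t0 + d / 2.
have ab : a < b by rewrite /a /b; lra.
have B t : a <= t <= b -> J t /\ c <= k t0 * k t.
  move=> tab; apply: D; rewrite /ball /= ltr_norml; move: tab; rewrite /a /b.
  by move=> /andP[h1 h2]; apply/andP; split; lra.
have abJ : `[a, b] `<=` J by move=> t /=; rewrite in_itv /= => /B[].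
have cb : {within `[a, b], continuous (tbump a b)}.
  by apply: within_continuous_segment => t _; exact: tbump_continuous.
have cbk : {within `[a, b], continuous (fun t => tbump a b t * k t)}.
  apply: within_continuous_segment => t /B[Jt _].
  by apply: (@continuousM _ _ (tbump a b) k); [exact: tbump_continuous|exact: ck].
have c0' : {within `[a, b], continuous (fun=> 0 : R)}.
  by apply: within_continuous_segment => t _; exact: cst_continuous.
have E1 := segment_integral_lin c cb c0'.
have E2 := segment_integral_lin (k t0) cbk c0'.
rewrite (H a b ab abJ) mulr0 in E2.
have L : \int[lam]_(t in `[a, b]) (c * tbump a b t + 0) <= \int[lam]_(t in `[a, b]) (k t0 * (tbump a b t * k t) + 0).
  apply: segment_integral_le.
  - exact: within_continuous_lin cb c0'.
  - exact: within_continuous_lin cbk c0'.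
  - move=> t /B[_ h]; rewrite !addr0 mulrCA [leLHS]mulrC; apply: ler_wpM2l => //; exact: tbump_ge0.
rewrite E1 E2 in L.
have P := mulr_gt0 c0 (tbump_integral_gt0 ab).
by move: L P; move: (\int[lam]_(t in _) 0) (c * _) => x y; lra.
Unshelve. all: by end_near.
Qed.

End time_bump.

(** * From stationarity to the equation *)

Section pde.
Context {R : realType} {n : nat} {M : ptopologicalType} (A : oriented_atlas R n M).
Variable g : riemannian_metric A.
Variable mu : {measure set (borel M) -> \bar R}.
Hypothesis M_compact : compact [set: M].
Hypothesis M_hausdorff : hausdorff_space M.
Hypothesis mu_volume : is_volume g mu.
Hypothesis mu_total : mu [set: M] = 1%E.
Variable J : set R.
Hypothesis J_open : open J.

Definition localized (a b : R) (psi : M -> R) (w : R -> M -> R) (t : R) (p : M) : R :=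
  tbump a b t * psi p * w t p.

Lemma localized_smooth a b psi (w : R -> M -> R) : smooth_fun A psi -> smooth_family A J w ->
  smooth_family A J (localized a b psi w).
Proof.
move=> sp sw; apply: (familyM J_open _ sw); apply: (familyM J_open).
  by apply: (family_par (h := tbump a b)) => k; apply: Ck_sub (tbump_smooth a b k).
exact: family_fun.
Qed.

Lemma localized_left a b psi w p : localized a b psi w a p = 0.
Proof. by rewrite /localized tbump_left !mul0r. Qed.

Lemma localized_right a b psi w p : localized a b psi w b p = 0.
Proof. by rewrite /localized tbump_right !mul0r. Qed.

Lemma cutoff_bound a b (psi : M -> R) t p : (forall q, 0 <= psi q <= 1) -> 0 <= tbump a b t * psi p <= 1.
Proof.
move=> /(_ p)/andP[p0 p1]; rewrite mulr_ge0 ?tbump_ge0 //=.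
by rewrite -[leRHS]mulr1 ler_pM ?tbump_ge0 ?tbump_le1.
Qed.

Lemma localized_normsq a b psi (w : R -> M -> R) t : smooth_fun A psi -> (forall q, 0 <= psi q <= 1) ->
  smooth_family A J w -> J t -> \int[mu]_p (w t p ^+ 2) <= 1 ->
  \int[mu]_p (localized a b psi w t p ^+ 2) <= 1.
Proof.
move=> sp p01 sw Jt; apply: le_trans; apply: cint_le => //.
- exact: (family_continuous_slice (familyX2 J_open (localized_smooth a b sp sw)) Jt).
- exact: (family_continuous_slice (familyX2 J_open sw) Jt).
move=> p; rewrite /localized exprMn -[leRHS]mul1r ler_wpM2r ?sqr_ge0 //.
by have /andP[h0 h1] := cutoff_bound a b t p p01; rewrite expr_le1.
Qed.

(** Time and space are separated: for each spatial bump the time bumps annihilate \int psi u w at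
    every instant, and the fundamental lemma on [M] is then applied at a fixed time. *)
Lemma localized_orthogonal (u w : R -> M -> R) : smooth_family A J u -> smooth_family A J w ->
  (forall a b psi, a < b -> `[a, b] `<=` J -> smooth_fun A psi -> (forall q, 0 <= psi q <= 1) ->
     \int[@lebesgue_measure R]_(t in `[a, b]) \int[mu]_p (u t p * localized a b psi w t p) = 0) ->
  forall t p, J t -> u t p * w t p = 0.
Proof.
move=> su sw H t p Jt; have suw := familyM J_open su sw.
apply: (@fundamental_lemma _ _ _ A g mu M_compact M_hausdorff mu_volume mu_total setT
   (fun q => u t q * w t q) p) => //; first exact: openT.
  by move=> q _; exact: (family_continuous_slice suw Jt).
move=> psi sp p01 _ _; have sk := familyM J_open (family_fun J sp) suw.
apply: (tbump_localize (k := fun t => \int[mu]_q (psi q * (u t q * w t q))) J_open _ _ Jt).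
  by move=> s Js; exact: (integral_family_continuous M_compact mu_total J_open sk Js).
move=> a b ab abJ; rewrite -[RHS](H a b psi ab abJ sp p01).
apply: eq_Rintegral => s /set_mem /=; rewrite in_itv /= => sab.
have Js := segment_sub abJ sab.
rewrite -(cintZ M_compact mu_total) //; last exact: (family_continuous_slice sk Js).
congr (Rintegral _ _ _); apply/funext => q; rewrite /localized.
by have alg (x y z v : R) : x * (y * (z * v)) = z * (x * y * v) by [ring]; exact: alg.
Qed.

(* On the sphere w = 1 is enough; for densities w = f keeps f + s eta positive. *)
Lemma stationary_neumann f (w : R -> M -> R) : curve_in A (Sphere A mu) J f -> smooth_family A J w ->
  (forall t p, J t -> w t p != 0) -> (forall t, J t -> \int[mu]_p (w t p ^+ 2) <= 1) ->
  (forall a b psi, a < b -> `[a, b] `<=` J -> smooth_fun A psi -> (forall q, 0 <= psi q <= 1) ->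
    is_derive (0 : R) (1 : R) (fun s => action (kinetic_minus_dirichlet g mu) a b
      (fun t => sphere_variation mu f (localized a b psi w) (s, t))) 0) ->
  exists lambda' : R -> R, forall t p, J t -> wave_residual g f t p = - lambda' t * f t p.
Proof.
move=> cf sw w0 w1 H; have sf := cf.1; pose m := multiplier g mu f.
have swr : smooth_family A J (wave_residual g f) by exact: (family_wave_residual M_compact M_hausdorff mu_volume mu_total).
have sm : smooth_on J m by apply: (integral_family_smooth M_compact mu_total J_open); exact: (familyM J_open swr sf).
have su : smooth_family A J (fun t p => wave_residual g f t p - m t * f t p).
  by apply: (familyB J_open swr); apply: (familyM J_open _ sf); exact: family_par sm.
exists (fun t => - m t) => t p Jt; rewrite opprK; apply/eqP; rewrite -subr_eq0.
have := localized_orthogonal su sw _ p Jt; move=> E.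
have /eqP : (wave_residual g f t p - m t * f t p) * w t p = 0.
  apply: E => a b psi ab abJ sp p01.
  apply: (stationary_weak M_compact M_hausdorff mu_volume mu_total J_open cf
     (localized_smooth a b sp sw) _ ab abJ _ _ (H a b psi ab abJ sp p01)).
  - by move=> s Js; apply: localized_normsq => //; exact: w1.
  - by move=> q; exact: localized_left.
  - by move=> q; exact: localized_right.
by rewrite mulf_eq0 (negbTE (w0 _ _ Jt)) orbF.
Qed.

Lemma newton_neumann f : newton A (Sphere A mu) (L2_metric mu) (dirichlet g mu) J f ->
  exists lambda' : R -> R, forall t p, J t -> wave_residual g f t p = - lambda' t * f t p.
Proof.
move=> [cf H]; have e0 : (0 : R) < 4^-1 by rewrite invr_gt0.
have s1 : smooth_family A J (fun _ _ => 1) by exact: family_cst.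
have n1 t : J t -> \int[mu]_(p in [set: M]) ((1 : R) ^+ 2) <= 1 by rewrite expr1n cint_cst.
apply: (stationary_neumann cf s1 _ n1) => [t p _|a b psi ab abJ sp p01]; first exact: oner_neq0.
pose eta := localized a b psi (fun _ _ => 1).
have seta : smooth_family A J eta by exact: localized_smooth.
have eta1 t : J t -> \int[mu]_p (eta t p ^+ 2) <= 1.
  by move=> Jt; apply: localized_normsq => //; exact: (n1 t).
apply: (H a b 4^-1 (fun s t => sphere_variation mu f eta (s, t)) ab abJ e0).
- have := sphere_variation_smooth M_compact mu_total J_open cf seta eta1.
  by congr (smooth_family A _ _); apply/funext => -[s t].
- by move=> s t se Jt; apply: (sphere_variation_sphere M_compact mu_total J_open cf seta eta1).
- by move=> t Jt; exact: (sphere_variation0 M_compact mu_total J_open cf seta Jt).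
- move=> s se; have Ja : J a by apply: (segment_sub abJ); rewrite lexx ltW.
  have Jb : J b by apply: (segment_sub abJ); rewrite lexx ltW.
  split; apply: (sphere_variation_fixed M_compact mu_total J_open cf seta) => // p.
    exact: localized_left.
  exact: localized_right.
Qed.

End pde.

(** * The square root map *)

Section square_root.
Context {R : realType} {n : nat} {M : ptopologicalType} (A : oriented_atlas R n M).
Variable g : riemannian_metric A.
Variable mu : {measure set (borel M) -> \bar R}.
Hypothesis M_compact : compact [set: M].
Hypothesis M_hausdorff : hausdorff_space M.
Hypothesis mu_volume : is_volume g mu.
Hypothesis mu_total : mu [set: M] = 1%E.

Lemma Sphere_sqrt_map r : Dens A mu r -> Sphere A mu (sqrt_map r).
Proof.
move=> [sr r0 r1]; split; first exact: smooth_fun_sqrt.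
by rewrite -[RHS]r1; congr (Rintegral _ _ _); apply/funext => p; rewrite sqr_sqrtr // ltW.
Qed.

Lemma sqrt_map_gt0 r p : Dens A mu r -> 0 < sqrt_map r p.
Proof. by move=> [_ r0 _]; rewrite sqrtr_gt0. Qed.

Lemma sqr_sqrt_map r : Dens A mu r -> (fun p => sqrt_map r p ^+ 2) = r.
Proof. by move=> [_ r0 _]; apply/funext => p; rewrite sqr_sqrtr // ltW. Qed.

Lemma Dens_square f : Sphere A mu f -> (forall p, 0 < f p) -> Dens A mu (fun p => f p ^+ 2).
Proof.
move=> [sf f1] f0; split=> //; last by move=> p; rewrite exprn_gt0.
by have := smooth_funM sf sf.
Qed.

Lemma sqrt_map_bij : set_bij (Dens A mu) (Sphere A mu `&` [set f | forall p, 0 < f p]) (@sqrt_map R M).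
Proof.
split.
- by move=> r Dr; split; [exact: Sphere_sqrt_map|move=> p; exact: sqrt_map_gt0].
- by move=> r r' /set_mem Dr /set_mem Dr' E; rewrite -(sqr_sqrt_map Dr) -(sqr_sqrt_map Dr') E.
- move=> f [Sf f0]; exists (fun p => f p ^+ 2); first exact: Dens_square.
  by apply/funext => p; rewrite /sqrt_map sqrtr_sqr gtr0_norm.
Qed.

Variable J : set R.
Hypothesis J_open : open J.

Lemma curve_in_sqrt_map rho : (forall t, J t -> Dens A mu (rho t)) ->
  (curve_in A (Dens A mu) J rho <-> curve_in A (Sphere A mu) J (fun t => sqrt_map (rho t))).
Proof.
move=> Dr; split=> -[sr _]; split.
- by apply: (family_sqrt J_open _ sr) => t p /Dr[].
- by move=> t Jt; exact: Sphere_sqrt_map (Dr t Jt).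
- apply: (family_eq J_open _ (familyX2 J_open sr)) => t p Jt.
  by rewrite -[in LHS](sqr_sqrt_map (Dr t Jt)).
- exact: Dr.
Qed.

Definition fisher_lagrangian (r v : M -> R) : R := 2^-1 * fisher_rao mu r v - fisher_information g mu r.

Section squared_family.
Variable c : R -> M -> R.
Hypothesis sc : smooth_family A J c.
Hypothesis c0 : forall t p, J t -> c t p != 0.

Lemma dt_square t p : J t -> dt (fun t p => c t p ^+ 2) t p = 2 * (c t p * dt c t p).
Proof.
move=> Jt; rewrite !dtE.
by have [] := is_derive_sqr (@family_is_derive R n M A R J c t 1 p sc Jt).
Qed.

Lemma dt_dt_square t p : J t ->
  dt (dt (fun t p => c t p ^+ 2)) t p = 2 * (dt c t p ^+ 2 + c t p * dt (dt c) t p).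
Proof.
move=> Jt; have E s : J s -> dt (fun t p => c t p ^+ 2) s = fun p => 2 * (c s p * dt c s p).
  by move=> Js; apply/funext => q; exact: dt_square.
rewrite (dt_congr J_open E Jt) dtE.
have d1 := @family_is_derive R n M A R J c t 1 p sc Jt.
have d2 := @family_is_derive R n M A R J (dt c) t 1 p (family_dt sc) Jt.
have [_ ->] := is_derive_prod (is_derive_cst (2 : R) t (1 : R)) (is_derive_prod d1 d2).
rewrite -!dtE mul0r add0r.
by have alg (x y z : R) : 2 * (y * y + x * z) = 2 * (y ^+ 2 + x * z) by [ring]; exact: alg.
Qed.

Lemma square_residual t p : J t -> let rho := fun t p => c t p ^+ 2 in
  dt (dt rho) t p - laplacian g (rho t) p
    - (2 * rho t p)^-1 * (dt rho t p ^+ 2 - grad_normsq g (rho t) p)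
  = 2 * c t p * wave_residual g c t p.
Proof.
move=> Jt /=; have sct := family_slice sc Jt.
rewrite dt_dt_square // dt_square // laplacian_square // grad_inner_square // /wave_residual.
have alg (x v w l k : R) : x != 0 -> 2 * (v ^+ 2 + x * w) - (2 * x * l + 2 * k)
    - (2 * x ^+ 2)^-1 * ((2 * (x * v)) ^+ 2 - 4 * x ^+ 2 * k) = 2 * x * (w - l).
  by move=> x0; field.
exact: alg (c0 p Jt).
Qed.

Lemma fisher_lagrangian_square t : J t ->
  fisher_lagrangian (fun p => c t p ^+ 2) (dt (fun t p => c t p ^+ 2) t) =
  4 * kinetic_minus_dirichlet g mu (c t) (dt c t).
Proof.
move=> Jt; have sct := family_slice sc Jt.
rewrite /fisher_lagrangian /fisher_rao /fisher_information /kinetic_minus_dirichlet /L2_metric /dirichlet.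
have -> : (fun p => dt (fun t p => c t p ^+ 2) t p ^+ 2 / c t p ^+ 2) = fun p => 4 * dt c t p ^+ 2.
  apply/funext => p; rewrite dt_square //.
  have alg (x v : R) : x != 0 -> (2 * (x * v)) ^+ 2 / x ^+ 2 = 4 * v ^+ 2 by move=> x0; field.
  exact: alg (c0 p Jt).
have -> : (fun p => grad_normsq g (fun q => c t q ^+ 2) p / c t p ^+ 2) = fun p => 4 * grad_normsq g (c t) p.
  apply/funext => p; rewrite grad_inner_square //.
  have alg (x v : R) : x != 0 -> 4 * x ^+ 2 * v / x ^+ 2 = 4 * v by move=> x0; field.
  exact: alg (c0 p Jt).
have gc : continuous (grad_normsq g (c t)).
  rewrite (_ : grad_normsq g (c t) = grad_inner g (c t) (c t)).
    exact: smooth_fun_continuous (smooth_fun_grad_inner g sct sct).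
  by apply/funext => p; exact: grad_normsqE.
have vc := family_continuous_slice (familyX2 J_open (family_dt sc)) Jt.
rewrite (cintZ M_compact mu_total) // (cintZ M_compact mu_total) //.
have alg (x y : R) : 2^-1 * (4 * x) - 2^-1 * (4 * y) = 4 * (2^-1 * x - 2^-1 * y) by ring.
exact: alg.
Qed.

(** Continuity in time gives the integrability under which the factor 4 leaves the action
    integral. *)
Lemma lagrangian_continuous t : J t ->
  {for t, continuous (fun t => kinetic_minus_dirichlet g mu (c t) (dt c t))}.
Proof.
move=> Jt; rewrite /kinetic_minus_dirichlet /L2_metric /dirichlet.
have cc (h : R -> R) (k : R) : {for t, continuous h} -> {for t, continuous (fun t => k * h t)}.
  by move=> ch; apply: (@continuousM _ _ (fun=> k) h); [exact: cst_continuous|].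
apply: (@continuousB _ _ _ (fun t => 2^-1 * \int[mu]_p (dt c t p ^+ 2))
  (fun t => 2^-1 * \int[mu]_p grad_normsq g (c t) p)); apply: cc.
  exact: (integral_family_continuous M_compact mu_total J_open (familyX2 J_open (family_dt sc)) Jt).
have -> : (fun t => \int[mu]_p grad_normsq g (c t) p) = fun t => \int[mu]_p grad_inner g (c t) (c t) p.
  by apply/funext => s; congr (Rintegral _ _ _); apply/funext => p; exact: grad_normsqE.
exact: (integral_family_continuous M_compact mu_total J_open (family_grad_inner g J_open sc sc) Jt).
Qed.

Lemma action_square a b : `[a, b] `<=` J ->
  action fisher_lagrangian a b (fun t p => c t p ^+ 2) = 4 * action (kinetic_minus_dirichlet g mu) a b c.
Proof.
move=> abJ; have Jab := segment_sub abJ; rewrite /action -RintegralZl //.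
  apply: eq_Rintegral => t /set_mem /=; rewrite in_itv /= => tab.
  by rewrite fisher_lagrangian_square //; exact: Jab.
by apply: segment_integrable; apply: within_continuous_segment => t /Jab; exact: lagrangian_continuous.
Qed.

End squared_family.

Lemma action_congr L a b (q q' : R -> M -> R) : `[a, b] `<=` J -> (forall t, J t -> q t = q' t) ->
  action L a b q = action L a b q'.
Proof.
move=> abJ qq; apply: eq_Rintegral => t /set_mem /= tab; have Jt := abJ t tab.
by rewrite (qq t Jt) (dt_congr J_open qq Jt).
Qed.

(** The actions are proportional for [s] near 0, with factor 4, and a zero derivative survives
    scaling. [r] and [C] are separate data so that the lemma serves both when squares of a sphere
    variation are taken and when square roots of a density variation are. *)
Lemma stationary_square (a b e : R) (C : R -> R -> M -> R) (r : R -> R -> M -> R) : `[a, b] `<=` J -> 0 < e ->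
  smooth_family A (`]- e, e[ `*` J) (fun z : R * R => C z.1 z.2) ->
  (forall (s t : R) p, s \in `]- e, e[ -> J t -> 0 < C s t p) ->
  (forall s t : R, s \in `]- e, e[ -> J t -> r s t = fun p => C s t p ^+ 2) ->
  is_derive (0 : R) (1 : R) (fun s => action fisher_lagrangian a b (r s)) 0 <->
  is_derive (0 : R) (1 : R) (fun s => action (kinetic_minus_dirichlet g mu) a b (C s)) 0.
Proof.
move=> abJ e0 sC C0 rC.
pose h s := action (kinetic_minus_dirichlet g mu) a b (C s).
have E : \forall s \near (0 : R), action fisher_lagrangian a b (r s) = 4 * h s.
  have N : \forall s \near (0 : R), s \in `]- e, e[.
    by apply: near_in_itvoo; rewrite in_itv /= oppr_lt0 e0.
  apply: filterS N => s se.
  have sCs : smooth_family A J (C s) by exact: (family_slice2 (C := fun z => C z.1 z.2) se sC).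
  rewrite (@action_congr _ a b (r s) (fun t p => C s t p ^+ 2) abJ); last by move=> t Jt; exact: rC.
  by rewrite action_square // => t p Jt; rewrite gt_eqF // C0.
have Z (k : R) (u : R -> R) : is_derive (0 : R) (1 : R) u 0 -> is_derive (0 : R) (1 : R) (fun s => k * u s) 0.
  by move=> du; have := is_derive_prod (is_derive_cst k (0 : R) (1 : R)) du; rewrite mul0r mulr0 addr0.
split=> H.
  have E' : \forall s \near (0 : R), 4^-1 * action fisher_lagrangian a b (r s) = h s.
    by apply: filterS E => s ->; rewrite mulrA mulVf ?mul1r.
  exact: (near_eq_is_derive E' (Z 4^-1 _ H)).
have E' : \forall s \near (0 : R), 4 * h s = action fisher_lagrangian a b (r s) by apply: filterS E => s ->.
exact: (near_eq_is_derive E' (Z 4 h H)).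
Qed.

(** Only special sphere variations need to be squared into density variations: those with weight [w]
    equal to [f], which remain positive. They already suffice to force the equation. *)
Lemma newton_dens_neumann rho f : f = (fun t => sqrt_map (rho t)) ->
  newton A (Dens A mu) (fisher_rao mu) (fisher_information g mu) J rho ->
  exists lambda' : R -> R, forall t p, J t ->
    wave_residual g f t p = - lambda' t * f t p.
Proof.
move=> fE [cr H]; have Dr := cr.2.
have cf : curve_in A (Sphere A mu) J f by rewrite fE; apply/curve_in_sqrt_map.
have sqr_f t : J t -> (fun p => f t p ^+ 2) = rho t by move=> Jt; rewrite fE; exact: sqr_sqrt_map (Dr t Jt).
have sf := cf.1.
have f0 t p : J t -> 0 < f t p by move=> Jt; rewrite fE; exact: sqrt_map_gt0 (Dr t Jt).
clear fE.
have f1 t : J t -> \int[mu]_p (f t p ^+ 2) = 1 by move=> Jt; have [] := cf.2 t Jt.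
pose e : R := 4^-1; have e0 : 0 < e by rewrite invr_gt0.
have K a b psi : a < b -> `[a, b] `<=` J -> smooth_fun A psi -> (forall q, 0 <= psi q <= 1) ->
    is_derive (0 : R) (1 : R) (fun s => action (kinetic_minus_dirichlet g mu) a b
      (fun t => sphere_variation mu f (localized a b psi f) (s, t))) 0; last first.
  apply: (stationary_neumann M_compact M_hausdorff mu_volume mu_total J_open cf sf _ _ K) => [t p Jt|t Jt].
    by rewrite gt_eqF // f0.
  by rewrite f1.
move=> ab abJ sp p01; pose eta := localized a b psi f.
have seta : smooth_family A J eta by exact: localized_smooth.
have eta1 t : J t -> \int[mu]_p (eta t p ^+ 2) <= 1.
  by move=> Jt; apply: (localized_normsq M_compact mu_total J_open) => //; rewrite f1.
pose C s t := sphere_variation mu f eta (s, t).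
have sC : smooth_family A (`]- e, e[ `*` J) (fun z : R * R => C z.1 z.2).
  have := sphere_variation_smooth M_compact mu_total J_open cf seta eta1.
  by congr (smooth_family A _ _); apply/funext => -[s t].
have C0 (s t : R) p : s \in `]- e, e[ -> J t -> 0 < C s t p.
  rewrite in_itv /= -ltr_norml => se Jt; rewrite /C /sphere_variation.
  have N := shift_normsq_ge M_compact mu_total J_open cf seta eta1 (ltW se) Jt.
  rewrite divr_gt0 ?sqrtr_gt0 //; last by apply: lt_le_trans N; rewrite invr_gt0.
  (* The shift factors as (1 + s chi) f with chi the cutoff, and |s chi| is at most 1/4. *)
  rewrite /sphere_shift /= /eta /localized mulrA -[X in X + _]mul1r -mulrDl mulr_gt0 ?f0 //.
  have /andP[k0 k1] := cutoff_bound a b t p p01.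
  have : `|s * (tbump a b t * psi p)| <= 4^-1.
    by rewrite normrM (ger0_norm k0) -[leRHS]mulr1 ler_pM // ltW.
  by rewrite ler_norml; move: (s * _) => x; lra.
have [D _] := stationary_square abJ e0 sC C0 (r := fun s t p => C s t p ^+ 2) (fun _ _ _ _ => erefl).
have K : is_derive (0 : R) (1 : R) (fun s => action fisher_lagrangian a b (fun t p => C s t p ^+ 2)) 0; last exact: D K.
apply: (H a b e (fun s t p => C s t p ^+ 2) ab abJ e0).
- by apply: familyX2 => //; apply: openX_prod => //; exact: interval_open.
- move=> s t se Jt; apply: Dens_square; last by move=> p; exact: C0.
  exact: (sphere_variation_sphere M_compact mu_total J_open cf seta eta1).
- move=> t Jt; rewrite -[RHS](sqr_f t Jt) /C.
  by rewrite (sphere_variation0 M_compact mu_total J_open cf seta Jt).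
- move=> s se; have Ja : J a by apply: (segment_sub abJ); rewrite lexx ltW.
  have Jb : J b by apply: (segment_sub abJ); rewrite lexx ltW.
  have ea p : eta a p = 0 by exact: localized_left.
  have eb p : eta b p = 0 by exact: localized_right.
  rewrite /C (sphere_variation_fixed M_compact mu_total J_open cf seta s Ja ea).
  rewrite (sphere_variation_fixed M_compact mu_total J_open cf seta s Jb eb).
  by split; exact: sqr_f.
Qed.

(** Density variations are positive, so their square roots are smooth sphere variations with the
    corresponding end points, and stationarity transfers directly. *)
Lemma newton_sphere_dens rho : (forall t, J t -> Dens A mu (rho t)) ->
  newton A (Sphere A mu) (L2_metric mu) (dirichlet g mu) J (fun t => sqrt_map (rho t)) ->
  newton A (Dens A mu) (fisher_rao mu) (fisher_information g mu) J rho.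
Proof.
move=> Dr [cf H]; split; first exact/curve_in_sqrt_map.
move=> a b e r ab abJ e0 sr Qr r0 rab; pose C s t := sqrt_map (r s t).
have Wo : open (`]- e, e[ `*` J : set (R * R)) by apply: openX_prod => //; exact: interval_open.
have sC : smooth_family A (`]- e, e[ `*` J) (fun z : R * R => C z.1 z.2).
  by apply: (family_sqrt Wo _ sr) => -[s t] p [/= se Jt]; have [] := Qr s t se Jt.
have C0 (s t : R) p : s \in `]- e, e[ -> J t -> 0 < C s t p.
  by move=> se Jt; exact: sqrt_map_gt0 (Qr s t se Jt).
apply/(stationary_square abJ e0 sC C0 (r := r)).
  by move=> s t se Jt; rewrite -[LHS](sqr_sqrt_map (Qr s t se Jt)).
apply: (H a b e C ab abJ e0 sC).
- by move=> s t se Jt; exact: Sphere_sqrt_map (Qr s t se Jt).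
- by move=> t Jt; rewrite /C r0.
- by move=> s /rab[ra rb]; rewrite /C ra rb.
Qed.

(** The forward implication passes through the differential equation, since an arbitrary sphere
    variation need not consist of positive functions and has no density variation attached to it. *)
Lemma newton_sqrt_map rho : (forall t, J t -> Dens A mu (rho t)) ->
  (newton A (Dens A mu) (fisher_rao mu) (fisher_information g mu) J rho <->
   newton A (Sphere A mu) (L2_metric mu) (dirichlet g mu) J (fun t => sqrt_map (rho t))).
Proof.
move=> Dr; split; last exact: newton_sphere_dens.
move=> H; apply: (neumann_newton M_compact M_hausdorff mu_volume mu_total J_open).
  by apply/curve_in_sqrt_map => //; exact: H.1.
exact: newton_dens_neumann.
Qed.

Lemma newton_neumannE f : curve_in A (Sphere A mu) J f ->
  (newton A (Sphere A mu) (L2_metric mu) (dirichlet g mu) J f <->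
   exists lambda' : R -> R, forall t p, J t -> wave_residual g f t p = - lambda' t * f t p).
Proof.
move=> cf; split; last exact: neumann_newton.
exact: (newton_neumann M_compact M_hausdorff mu_volume mu_total J_open).
Qed.

Lemma newton_densE rho : curve_in A (Dens A mu) J rho ->
  (newton A (Dens A mu) (fisher_rao mu) (fisher_information g mu) J rho <->
   exists lambda : R -> R, forall t p, J t ->
     dt (dt rho) t p - laplacian g (rho t) p
     - (2 * rho t p)^-1 * (dt rho t p ^+ 2 - grad_normsq g (rho t) p)
     = lambda t * rho t p).
Proof.
move=> cr; have Dr := cr.2; pose f t := sqrt_map (rho t).
have cf : curve_in A (Sphere A mu) J f by apply/curve_in_sqrt_map.
have f0 t p : J t -> f t p != 0 by move=> Jt; rewrite gt_eqF //; exact: sqrt_map_gt0 (Dr t Jt).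
have rE t : J t -> rho t = fun p => f t p ^+ 2 by move=> Jt; rewrite -[LHS](sqr_sqrt_map (Dr t Jt)).
have key t p : J t -> dt (dt rho) t p - laplacian g (rho t) p
     - (2 * rho t p)^-1 * (dt rho t p ^+ 2 - grad_normsq g (rho t) p) = 2 * f t p * wave_residual g f t p.
  move=> Jt; rewrite -(square_residual cf.1 f0 p Jt).
  by rewrite (dt_congr J_open (dt_congr J_open rE) Jt) (dt_congr J_open rE Jt) (rE t Jt).
have N := newton_sqrt_map Dr; have S := newton_neumannE cf.
split=> [/N/S[l lE]|[l lE]].
  (* Multiplying the residual - lambda' f by 2 f gives - 2 lambda' f^2, hence lambda = - 2
     lambda'. *)
  exists (fun t => - (2 * l t)) => t p Jt; rewrite key // lE // rE //.
  have alg (x y : R) : 2 * x * (- y * x) = - (2 * y) * x ^+ 2 by ring.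
  exact: alg.
apply/N/S; exists (fun t => - (2^-1 * l t)) => t p Jt.
have := lE t p Jt; rewrite key // rE //; have := f0 t p Jt.
have alg (x y z : R) : x != 0 -> 2 * x * z = y * x ^+ 2 -> z = - - (2^-1 * y) * x.
  move=> x0 h; apply: (mulfI x0); apply: (@mulfI _ 2) => //; rewrite mulrA h opprK.
  by field.
exact: alg.
Qed.

End square_root.

Theorem proposition8p5 (R : realType) (n : nat) (M : ptopologicalType)
    (A : oriented_atlas R n M) (g : riemannian_metric A)
    (mu : {measure set (borel M) -> \bar R}) (J : set R)
    (M_compact : compact [set: M]) (M_hausdorff : hausdorff_space M)
    (M_connected : connected [set: M])
    (mu_volume : is_volume g mu) (mu_total : mu [set: M] = 1%E)
    (J_open : open J) (J_interval : is_interval J) :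
  [/\ (forall rho : R -> M -> R, curve_in A (Dens A mu) J rho ->
         (newton A (Dens A mu) (fisher_rao mu) (fisher_information g mu) J rho
          <->
          exists lambda : R -> R, forall t p, J t ->
            dt (dt rho) t p - laplacian g (rho t) p
            - (2 * rho t p)^-1 * (dt rho t p ^+ 2 - grad_normsq g (rho t) p)
            = lambda t * rho t p)),
      set_bij (Dens A mu) (Sphere A mu `&` [set f | forall p, 0 < f p])
        (@sqrt_map R M),
      (forall rho : R -> M -> R, (forall t, J t -> Dens A mu (rho t)) ->
         (curve_in A (Dens A mu) J rho <->
          curve_in A (Sphere A mu) J (fun t => sqrt_map (rho t)))),
      (forall rho : R -> M -> R, (forall t, J t -> Dens A mu (rho t)) ->
         (newton A (Dens A mu) (fisher_rao mu) (fisher_information g mu) J rho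
          <->
          newton A (Sphere A mu) (L2_metric mu) (dirichlet g mu) J
            (fun t => sqrt_map (rho t))))
    & (forall f : R -> M -> R, curve_in A (Sphere A mu) J f ->
         (newton A (Sphere A mu) (L2_metric mu) (dirichlet g mu) J f
          <->
          exists lambda' : R -> R, forall t p, J t ->
            dt (dt f) t p - laplacian g (f t) p = - lambda' t * f t p))].
Proof.
split.
- by move=> rho; apply: newton_densE.
- exact: sqrt_map_bij.
- exact: curve_in_sqrt_map.
- by move=> rho; apply: newton_sqrt_map.
- by move=> f; apply: newton_neumannE.
Qed.
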